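(* Suppose that $u$ is a solution of $$ i\partial_t u=2J\Pi(|u|^2)+\overline{J}u^2,\qquad J:=(u^2\vert u),$$ such that $u(0)=u_0\in\mathcal{L}(1)$, where $u_0$ is not a constant function of $x\in\mathbb{T}$. Then the following statements are equivalent: (i) There exists $s>\frac12$ such that $\|u(t)\|_{H^s}$ is unbounded as $t\to\pm\infty$ (i.e. $\sup_{t\in\mathbb{R}}\|u(t)\|_{H^s}=+\infty$). (ii) For all $s>\frac12$, there exist $C_s,B_s>0$ such that $\|u(t)\|_{H^s}\sim C_se^{B_s|t|}$ as $t\to\pm\infty$ (the ratio of the two sides tends to $1$). (iii) The energy $E=E(u_0)$ and the mass $Q=Q(u_0)$ satisfy the relation $$E=\tfrac12Q^3.$$
   Context: $\mathbb{T}$ is the one-dimensional torus; $(f\vert g):=\frac1{2\pi}\int_0^{2\pi}f(e^{ix})\overline{g(e^{ix})}\,dx$. $L^2_+(\mathbb{T})=\{u\in L^2(\mathbb{T}) : \hat u(k)=0\ \forall k<0\}$, $\Pi:L^2(\mathbb{T})\to L^2_+(\mathbb{T})$ is the orthogonal projection, $H^s_+:=H^s\cap L^2_+$, and $\|u\|_{H^s}^2=\sum_k(1+k^2)^s|\hat u(k)|^2$. For every $s>\frac12$ and $u_0\in H^s_+$ the equation has a unique global solution $u\in C^\infty(\mathbb{R},H^s_+)$ with $u(0)=u_0$; this is the solution meant here. $\mathcal{L}(1):=\left\{u(x)=b+\frac{ce^{ix}}{1-pe^{ix}} : b,c,p\in\mathbb{C},\ |p|<1\right\}$. Mass: $Q(u):=(u\vert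 u)$. Energy: $E(u):=\frac12|(u^2\vert u)|^2=\frac12|J|^2$. Both are conserved along the solution.
   Formalization: In (ii) the constant C_s may differ at t→+∞ and t→−∞ (B_s is common): with a single C_s, (iii)⇒(ii) fails, since replacing u(t) by u(t+a) preserves the equation, E and Q but multiplies the two prefactors by e^{B_s a} and e^{−B_s a}. *)

(* Defs.v *)
From HB Require Import structures.
From mathcomp Require Import all_boot all_order all_algebra complex.
From mathcomp Require Import all_classical all_reals all_analysis.

Set Implicit Arguments.
Unset Strict Implicit.
Unset Printing Implicit Defensive.

Import Order.TTheory GRing.Theory Num.Theory ComplexField.Normc.
Import numFieldNormedType.Exports.

Local Open Scope classical_set_scope.
Local Open Scope ring_scope.
Local Open Scope complex_scope.

(* A function on the torus is a 2pi-periodic function [f : R -> R[i]] of the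
   angle x, and equality in L^2 is equality almost everywhere on [period R].
   Complex integrals are taken componentwise. *)

Definition period (R : realType) : set R := `[0, 2 * pi]%classic.

Definition eq_torus (R : realType) (f g : R -> R[i]) : Prop :=
  f = g %[ae (@lebesgue_measure R) in @period R].

Definition cintegral (R : realType) (f : R -> R[i]) : R[i] :=
  (\int[lebesgue_measure]_(x in @period R) complex.Re (f x)) +i*
  (\int[lebesgue_measure]_(x in @period R) complex.Im (f x)).

Definition inner (R : realType) (f g : R -> R[i]) : R[i] :=
  ((2 * pi)^-1)%:C * cintegral (fun x => f x * (g x)^*%C).

Definition expi (R : realType) (x : R) : R[i] := cos x +i* sin x.

Definition fourier (R : realType) (f : R -> R[i]) (k : int) : R[i] :=
  inner f (fun x => expi (k%:~R * x)).

Definition L2 (R : realType) (f : R -> R[i]) : Prop :=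
  [/\ forall x, f (x + 2 * pi) = f x,
      measurable_fun (@period R) (fun x => complex.Re (f x)),
      measurable_fun (@period R) (fun x => complex.Im (f x)) &
      (\int[lebesgue_measure]_(x in @period R)
         (normc (f x) ^+ 2)%:E < +oo)%E].

Definition L2plus (R : realType) (f : R -> R[i]) : Prop :=
  L2 f /\ forall k : int, k < 0 -> fourier f k = 0.

(* [is_szego_proj f g] says that g is the image of f under the orthogonal
   projection of L^2 onto L^2_+, which determines g almost everywhere. *)
Definition is_szego_proj (R : realType) (f g : R -> R[i]) : Prop :=
  [/\ L2 f, L2plus g &
      forall h, L2plus h -> inner (fun x => f x - g x) h = 0].

Definition Hs_norm (R : realType) (s : R) (f : R -> R[i]) : \bar R :=
  ((\esum_(k in [set: int])
     ((1 + k%:~R ^+ 2) `^ s * normc (fourier f k) ^+ 2)%:E) `^ 2^-1)%E.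

Definition Hs (R : realType) (s : R) (f : R -> R[i]) : Prop :=
  L2 f /\ (Hs_norm s f < +oo)%E.

Definition Hsplus (R : realType) (s : R) (f : R -> R[i]) : Prop :=
  Hs s f /\ L2plus f.

Definition is_Hs_derivative (R : realType) (s : R) (u : R -> R -> R[i])
    (t : R) (v : R -> R[i]) : Prop :=
  Hs_norm s (fun x => (u (t + h) x - u t x) / h%:C - v x) @[h --> 0^']
    --> 0%E.

(* u is C^oo from R to H^s_+, with n-th derivative U n. *)
Definition Hsplus_smooth (R : realType) (s : R) (u : R -> R -> R[i])
    (U : nat -> R -> R -> R[i]) : Prop :=
  [/\ U 0%N = u,
      forall n t, Hsplus s (U n t) &
      forall n t, is_Hs_derivative s (U n) t (U n.+1 t)].

Definition Jfun (R : realType) (f : R -> R[i]) : R[i] :=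
  inner (fun x => f x ^+ 2) f.

Definition mass (R : realType) (f : R -> R[i]) : R[i] := inner f f.

Definition energy (R : realType) (f : R -> R[i]) : R[i] :=
  2^-1 * `|Jfun f| ^+ 2.

(* i v = 2 J Pi(|f|^2) + conj(J) f^2 as an equality in L^2, J = (f^2 | f). *)
Definition szego_rhs_eq (R : realType) (f v : R -> R[i]) : Prop :=
  exists2 p : R -> R[i],
    is_szego_proj (fun x => `|f x| ^+ 2) p &
    eq_torus (fun x => 'i%C * v x)
             (fun x => 2 * Jfun f * p x + (Jfun f)^*%C * f x ^+ 2).

Definition is_solution (R : realType) (s : R) (u : R -> R -> R[i])
    (u0 : R -> R[i]) : Prop :=
  eq_torus (u 0) u0 /\
  exists2 U : nat -> R -> R -> R[i],
    Hsplus_smooth s u U & forall t, szego_rhs_eq (u t) (U 1%N t).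

Definition calL1 (R : realType) (f : R -> R[i]) : Prop :=
  exists b c p : R[i], `|p| < 1 /\
    forall x, f x = b + c * expi x / (1 - p * expi x).

Definition unbounded_Hs (R : realType) (s : R) (u : R -> R -> R[i]) : Prop :=
  ereal_sup (range (fun t => Hs_norm s (u t))) = +oo%E.

(* The prefactor may differ at -oo and +oo: replacing u(t) by u(t + a) turns
   C exp(B |t|) into C exp(B a) exp(B |t|) at +oo and into
   C exp(- B a) exp(B |t|) at -oo, while the equation, mass, and energy are
   invariant under this translation. *)
Definition exp_growth_Hs (R : realType) (s : R) (u : R -> R -> R[i]) : Prop :=
  exists B Cm Cp : R, [/\ 0 < B, 0 < Cm, 0 < Cp,
    (Hs_norm s (u t) * ((Cm * expR (B * `|t|))^-1)%:E)%E @[t --> -oo%R]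
      --> 1%E &
    (Hs_norm s (u t) * ((Cp * expR (B * `|t|))^-1)%:E)%E @[t --> +oo%R]
      --> 1%E].

(* Main.v *)
Require Import Defs.
From mathcomp Require Import all_boot all_order all_algebra complex.
From mathcomp Require Import all_classical all_reals all_analysis.
From mathcomp Require Import measurable_realfun.
From mathcomp Require Import zify ring lra.
Import Order.TTheory GRing.Theory Num.Theory ComplexField.Normc.
Import numFieldNormedType.Exports.

(** The idea is that $\mathcal L(1)$ is invariant under the flow, which reduces
    the equation to an ordinary differential system for $(b, c, p)$, and that
    this system is integrable: everything is governed by the radius
    $\rho = 1 - |p|^2$, and the Sobolev norms blow up exactly when
    $\rho \to 0$.

    Reduction. For $s > 1/2$ the Fourier coefficients of an element of $H^s$ are
    summable, and such a function is almost everywhere the sum of its Fourier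
    series, by completeness of the trigonometric system ([fourier_eq0_ae]).
    Hence the coefficients $a_k(t)$, $k \geq 0$, solve an infinite differential
    system ([is_solution_system]). Define [p] by $p' = -i \bar J a_1$. The
    sequences $(a_{k+1})$ and $(a_{k+2} - p a_{k+1})$ then solve one and the
    same linear equation, whose operator is bounded on $\ell^1$; Gronwall's
    lemma gives uniqueness, so that the geometric form $a_{k+1} = c p^k$ of the
    initial data persists with $c \neq 0$ ([rank_one_propagates],
    [rank_one_system]).

    Integrability. The quantities $Q = |b|^2 + |c|^2/\rho$ (the mass),
    $M = |c|^2/\rho^2$ and $N = |J|^2$ are conserved, and $\rho'^2$ is a
    polynomial in $\rho$ with value $-(N - Q^3)^2/M^2$ at [0]
    ([rank_one_integrals], [rank_one_radius]). If $N \neq Q^3$, then $\rho$ is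
    bounded away from [0] ([radius_bounded_below]). If $N = Q^3$, then
    $w = 1/\rho$ satisfies $w'^2 = A w^2 + B w - C$ with $A, C > 0$, so that
    $w = \alpha e^{kt} + \beta e^{-kt} + \gamma$ with $k, \alpha, \beta > 0$
    ([radius_inverse_cosh]).

    Norms. The squared $H^s$ norm is
    $Q - M\rho + M\rho^2 \sum_k (1 + (k+1)^2)^s (1 - \rho)^k$
    ([rank_one_Hs_norm]). Comparing the weights with the coefficients of
    $(1 - q)^{-(2s+1)}$, an Abelian theorem shows that the sum is equivalent to
    $\Lambda \rho^{-(2s+1)}$ as $\rho \to 0$ ([weight_sum_asymptotics]). The norm
    is therefore bounded when $N \neq Q^3$, and grows like
    $e^{k(s - 1/2)|t|}$ when $N = Q^3$. Since $E = N/2$, the condition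
    $N = Q^3$ is the relation between energy and mass ([rank_one_dichotomy]). *)

Set Implicit Arguments.
Unset Strict Implicit.
Unset Printing Implicit Defensive.
Local Open Scope classical_set_scope.
Local Open Scope ring_scope.
Local Open Scope complex_scope.

(** * Complex numbers and complex series *)

Section ComplexNumbers.
Variable R : realType.
Implicit Types z w : R[i].

Lemma cReD z w : complex.Re (z + w) = complex.Re z + complex.Re w.
Proof. by case: z w => [a b] [c d]. Qed.

Lemma cImD z w : complex.Im (z + w) = complex.Im z + complex.Im w.
Proof. by case: z w => [a b] [c d]. Qed.

Lemma cReN z : complex.Re (- z) = - complex.Re z. Proof. by case: z. Qed.
Lemma cImN z : complex.Im (- z) = - complex.Im z. Proof. by case: z. Qed.

Lemma cReM z w : complex.Re (z * w) =
  complex.Re z * complex.Re w - complex.Im z * complex.Im w.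
Proof. by case: z w => [a b] [c d]. Qed.

Lemma cImM z w : complex.Im (z * w) =
  complex.Re z * complex.Im w + complex.Im z * complex.Re w.
Proof. by case: z w => [a b] [c d]. Qed.

Lemma cReJ z : complex.Re z^*%C = complex.Re z. Proof. by case: z. Qed.
Lemma cImJ z : complex.Im z^*%C = - complex.Im z. Proof. by case: z. Qed.

Definition cReImE := (cReD, cImD, cReN, cImN, cReM, cImM, cReJ, cImJ).

Lemma complexP z w :
  complex.Re z = complex.Re w -> complex.Im z = complex.Im w -> z = w.
Proof. by case: z w => [a b] [c d] /= -> ->. Qed.

Lemma cRe_sum (I : Type) (r : seq I) (P : pred I) (F : I -> R[i]) :
  complex.Re (\sum_(i <- r | P i) F i) = \sum_(i <- r | P i) complex.Re (F i).
Proof. by elim/big_rec2 : _ => // i x y _ <-; rewrite cReD. Qed.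

Lemma cIm_sum (I : Type) (r : seq I) (P : pred I) (F : I -> R[i]) :
  complex.Im (\sum_(i <- r | P i) F i) = \sum_(i <- r | P i) complex.Im (F i).
Proof. by elim/big_rec2 : _ => // i x y _ <-; rewrite cImD. Qed.

Lemma normc_ge0 z : 0 <= normc z.
Proof. by case: z => a b; exact: sqrtr_ge0. Qed.

Lemma normc_sqr z : normc z ^+ 2 = complex.Re z ^+ 2 + complex.Im z ^+ 2.
Proof. by case: z => a b /=; rewrite sqr_sqrtr// addr_ge0// sqr_ge0. Qed.

Lemma normc_conj z : normc z^*%C = normc z.
Proof. by case: z => a b /=; rewrite sqrrN. Qed.

Lemma normcX z n : normc (z ^+ n) = normc z ^+ n.
Proof. by elim: n => [|n IH]; rewrite ?expr0 ?normc1// !exprS normcM IH. Qed.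

Lemma Re_le_normc z : `|complex.Re z| <= normc z.
Proof.
case: z => a b /=; rewrite -[X in X <= _]sqrtr_sqr ler_wsqrtr//.
by rewrite lerDl sqr_ge0.
Qed.

Lemma Im_le_normc z : `|complex.Im z| <= normc z.
Proof.
case: z => a b /=; rewrite -[X in X <= _]sqrtr_sqr ler_wsqrtr//.
by rewrite lerDr sqr_ge0.
Qed.

Lemma normc_le_ReIm z : normc z <= `|complex.Re z| + `|complex.Im z|.
Proof.
rewrite -(@ler_pXn2r _ 2)// ?nnegrE ?normc_ge0 ?addr_ge0// normc_sqr sqrrD.
by rewrite !real_normK ?num_real// lerD2r lerDl mulrn_wge0// mulr_ge0.
Qed.

Lemma ler_normc_sum (I : Type) (r : seq I) (P : pred I) (F : I -> R[i]) :
  normc (\sum_(i <- r | P i) F i) <= \sum_(i <- r | P i) normc (F i).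
Proof.
elim/big_rec2 : _ => [|i x y _ h]; first by rewrite normc0.
by rewrite (le_trans (le_normcD _ _))// lerD2l.
Qed.

Lemma conjcD z w : (z + w)^*%C = z^*%C + w^*%C.
Proof. exact: rmorphD. Qed.

Lemma conjcM z w : (z * w)^*%C = z^*%C * w^*%C.
Proof. exact: rmorphM. Qed.

Lemma conjcN z : (- z)^*%C = - z^*%C.
Proof. exact: rmorphN. Qed.

Lemma conjcX z n : (z ^+ n)^*%C = z^*%C ^+ n.
Proof. exact: rmorphXn. Qed.

Lemma mulcJ z : z * z^*%C = (normc z ^+ 2)%:C.
Proof.
by rewrite normc_sqr; apply: complexP; rewrite !cReImE/= ?mulr0 ?subr0; ring.
Qed.

Lemma normCE z : `|z| = (normc z)%:C. Proof. by case: z. Qed.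

(** Componentwise, so that limits and series in [R[i]] reduce to real ones. *)
Definition ccvg (T : Type) (F : set_system T) (f : T -> R[i]) (l : R[i]) :=
  (complex.Re (f x) @[x --> F] --> complex.Re l) /\
  (complex.Im (f x) @[x --> F] --> complex.Im l).

Section ccvg.
Variables (T : Type) (F : set_system T).
Context {FF : ProperFilter F}.
Implicit Types (f g : T -> R[i]) (l m : R[i]).

Lemma ccvg_cst l : ccvg F (fun=> l) l.
Proof. by split; exact: cvg_cst. Qed.

Lemma ccvgD f g l m : ccvg F f l -> ccvg F g m -> ccvg F (fun x => f x + g x) (l + m).
Proof.
move=> [f1 f2] [g1 g2]; split; rewrite cReImE.
  by under eq_fun do rewrite cReD; exact: cvgD.
by under eq_fun do rewrite cImD; exact: cvgD.
Qed.

Lemma ccvgM f g l m : ccvg F f l -> ccvg F g m -> ccvg F (fun x => f x * g x) (l * m).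
Proof.
move=> [f1 f2] [g1 g2]; split; rewrite cReImE.
  by under eq_fun do rewrite cReM; apply: cvgB; exact: cvgM.
by under eq_fun do rewrite cImM; apply: cvgD; exact: cvgM.
Qed.

Lemma ccvgN f l : ccvg F f l -> ccvg F (fun x => - f x) (- l).
Proof.
move=> [f1 f2]; split; rewrite cReImE.
  by under eq_fun do rewrite cReN; exact: cvgN.
by under eq_fun do rewrite cImN; exact: cvgN.
Qed.

Lemma ccvgB f g l m : ccvg F f l -> ccvg F g m -> ccvg F (fun x => f x - g x) (l - m).
Proof. by move=> fl gm; apply: ccvgD => //; exact: ccvgN. Qed.

Lemma ccvgZ z f l : ccvg F f l -> ccvg F (fun x => z * f x) (z * l).
Proof. by apply: ccvgM; exact: ccvg_cst. Qed.

Lemma ccvgJ f l : ccvg F f l -> ccvg F (fun x => (f x)^*%C) l^*%C.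
Proof.
move=> [f1 f2]; split; rewrite cReImE.
  by under eq_fun do rewrite cReJ.
by under eq_fun do rewrite cImJ; exact: cvgN.
Qed.

Lemma ccvg_unique f l m : ccvg F f l -> ccvg F f m -> l = m.
Proof.
move=> [f1 f2] [g1 g2]; apply: complexP.
  exact: (cvg_unique (@Rhausdorff R) f1 g1).
exact: (cvg_unique (@Rhausdorff R) f2 g2).
Qed.

Lemma ccvg_normc0 f l : normc (f x - l) @[x --> F] --> 0 -> ccvg F f l.
Proof.
move=> fl; split; apply/subr_cvg0.
- apply/norm_cvg0P; apply: (squeeze_cvgr _ (@cvg_cst _ 0 _ F _) fl).
  by apply: nearW => x; rewrite normr_ge0 -cReN -cReD Re_le_normc.
- apply/norm_cvg0P; apply: (squeeze_cvgr _ (@cvg_cst _ 0 _ F _) fl).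
  by apply: nearW => x; rewrite normr_ge0 -cImN -cImD Im_le_normc.
Qed.

Lemma ccvg_normc f l : ccvg F f l -> normc (f x) @[x --> F] --> normc l.
Proof.
move=> [f1 f2].
have e z : normc z = Num.sqrt (complex.Re z * complex.Re z + complex.Im z * complex.Im z).
  by case: z => a b /=; rewrite !expr2.
rewrite e; under eq_fun do rewrite e.
apply: (continuous_cvg _ (@sqrt_continuous R _)).
by apply: cvgD; exact: cvgM.
Qed.

Lemma ccvg_sum (I : Type) (r : seq I) (f : I -> T -> R[i]) (l : I -> R[i]) :
  (forall i, ccvg F (f i) (l i)) ->
  ccvg F (fun x => \sum_(i <- r) f i x) (\sum_(i <- r) l i).
Proof.
move=> fl; elim: r => [|i r IH].
  rewrite big_nil; under eq_fun do rewrite big_nil; exact: ccvg_cst.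
by rewrite big_cons; under eq_fun do rewrite big_cons; exact: ccvgD.
Qed.

End ccvg.

Lemma ccvg_shiftS (f : nat -> R[i]) l :
  ccvg \oo (fun n => f n.+1) l <-> ccvg \oo f l.
Proof.
split=> -[h1 h2]; split.
- by move: h1; rewrite (cvg_shiftS (fun n => complex.Re (f n))).
- by move: h2; rewrite (cvg_shiftS (fun n => complex.Im (f n))).
- by rewrite (cvg_shiftS (fun n => complex.Re (f n))).
- by rewrite (cvg_shiftS (fun n => complex.Im (f n))).
Qed.

Definition csum (x : nat -> R[i]) (S : R[i]) :=
  ccvg \oo (fun n => \sum_(0 <= k < n) x k) S.

Lemma csum_unique x S S' : csum x S -> csum x S' -> S = S'.
Proof. exact: ccvg_unique. Qed.

Lemma eq_csum x y S : x =1 y -> csum x S -> csum y S.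
Proof. by move=> /funext ->. Qed.

Lemma csumD x y S S' : csum x S -> csum y S' -> csum (fun k => x k + y k) (S + S').
Proof.
move=> h h'; rewrite /csum; under eq_fun do rewrite big_split/=; exact: ccvgD.
Qed.

Lemma csumZ z x S : csum x S -> csum (fun k => z * x k) (z * S).
Proof.
move=> h; rewrite /csum; under eq_fun do rewrite -mulr_sumr; exact: ccvgZ.
Qed.

Lemma csumJ x S : csum x S -> csum (fun k => (x k)^*%C) S^*%C.
Proof.
move=> h; rewrite /csum; under eq_fun do rewrite -rmorph_sum/=; exact: ccvgJ.
Qed.

Lemma csumS x S : csum (fun k => x k.+1) S -> csum x (x 0%N + S).
Proof.
move=> h; apply/ccvg_shiftS.
under eq_fun do rewrite big_nat_recl//; by apply: ccvgD => //; exact: ccvg_cst.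
Qed.

(** Summing the bounds over finitely many parameters is how the $\ell^1$
    estimates of products of sequences are obtained. *)
Lemma csum_normc_le (K : nat) (x : nat -> nat -> R[i]) (S : nat -> R[i]) (B : R) :
  (forall k, csum (x k) (S k)) ->
  (forall n, \sum_(0 <= k < K) \sum_(0 <= l < n) normc (x k l) <= B) ->
  \sum_(0 <= k < K) normc (S k) <= B.
Proof.
move=> xS xB.
have h : \sum_(0 <= k < K) normc (\sum_(0 <= l < n) x k l) @[n --> \oo]
    --> \sum_(0 <= k < K) normc (S k).
  elim: K {xB} => [|K IH].
    by rewrite big_nil; under eq_fun do rewrite big_nil; exact: cvg_cst.
  rewrite big_nat_recr//=; under eq_fun do rewrite big_nat_recr//=.
  by apply: cvgD => //; apply: ccvg_normc; exact: xS.
apply: (cvgr_to_le h); apply: nearW => n; apply: le_trans (xB n).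
by apply: ler_sum => k _; exact: ler_normc_sum.
Qed.

End ComplexNumbers.

(** * Complex integrals over a period *)

Section ComplexIntegral.
Variable R : realType.
Local Notation mu := (@lebesgue_measure R).
Local Notation D := (@period R).
Implicit Types (f g : R -> R[i]) (z : R[i]).

Lemma measurable_period : measurable (D : set (measurableTypeR R)).
Proof. exact: measurable_itv. Qed.
Local Hint Resolve measurable_period : core.

Lemma mu_period : mu D = (2 * pi)%:E.
Proof.
change (mu (`[0%R, (2 * pi)%R]%classic : set R) = (2 * pi)%:E).
by rewrite lebesgue_measure_itv/= lte_fin mulr_gt0 ?pi_gt0// -EFinD subr0.
Qed.

Lemma aeS (P Q : R -> Prop) : (forall x, P x -> Q x) ->
  {ae mu, forall x, P x} -> {ae mu, forall x, Q x}.
Proof. by move=> PQ; apply: filterS => //; exact: (ae_filter_ringOfSetsType mu). Qed.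

Lemma aeS2 (P Q S : R -> Prop) : (forall x, P x -> Q x -> S x) ->
  {ae mu, forall x, P x} -> {ae mu, forall x, Q x} -> {ae mu, forall x, S x}.
Proof. by move=> PQ; apply: filterS2 => //; exact: (ae_filter_ringOfSetsType mu). Qed.

Lemma aeI (P Q : R -> Prop) : {ae mu, forall x, P x} ->
  {ae mu, forall x, Q x} -> {ae mu, forall x, P x /\ Q x}.
Proof. exact: aeS2. Qed.

Lemma integrable_period_restrict (h : R -> R) :
  mu.-integrable D (EFin \o h) -> mu.-integrable setT ((EFin \o h) \_ D).
Proof.
move=> hi; have H := (@integrable_mkcond _ _ _ mu D (EFin \o h) measurable_period).
by apply H.
Qed.

Definition cmeasurable f :=
  measurable_fun D (fun x => complex.Re (f x)) /\
  measurable_fun D (fun x => complex.Im (f x)).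

Definition cintegrable f :=
  mu.-integrable D (EFin \o (fun x => complex.Re (f x))) /\
  mu.-integrable D (EFin \o (fun x => complex.Im (f x))).

Lemma cmeasurableM f g : cmeasurable f -> cmeasurable g ->
  cmeasurable (fun x => f x * g x).
Proof.
move=> [f1 f2] [g1 g2]; split.
  by under eq_fun do rewrite cReM; apply: measurable_funB; exact: measurable_funM.
by under eq_fun do rewrite cImM; apply: measurable_funD; exact: measurable_funM.
Qed.

Lemma cmeasurableD f g : cmeasurable f -> cmeasurable g ->
  cmeasurable (fun x => f x + g x).
Proof.
move=> [f1 f2] [g1 g2]; split.
  by under eq_fun do rewrite cReD; exact: measurable_funD.
by under eq_fun do rewrite cImD; exact: measurable_funD.
Qed.

Lemma cmeasurableJ f : cmeasurable f -> cmeasurable (fun x => (f x)^*%C).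
Proof.
move=> [f1 f2]; split; first by under eq_fun do rewrite cReJ.
by under eq_fun do rewrite cImJ; exact: measurableT_comp.
Qed.

Lemma cmeasurable_cst z : cmeasurable (fun=> z).
Proof. by split; exact: measurable_cst. Qed.

Lemma cmeasurable_sum (I : Type) (r : seq I) (F : I -> R -> R[i]) :
  (forall i, cmeasurable (F i)) -> cmeasurable (fun x => \sum_(i <- r) F i x).
Proof.
move=> mF; elim: r => [|i r IH].
  by under eq_fun do rewrite big_nil; exact: cmeasurable_cst.
by under eq_fun do rewrite big_cons; exact: cmeasurableD.
Qed.

Lemma cintegrable_measurable f : cintegrable f -> cmeasurable f.
Proof.
move=> [f1 f2]; split; apply/measurable_EFinP.
  exact: measurable_int f1.
exact: measurable_int f2.
Qed.

Lemma measurable_normc f : cmeasurable f -> measurable_fun D (fun x => normc (f x)).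
Proof.
move=> [f1 f2].
have e z : normc z = Num.sqrt (complex.Re z * complex.Re z + complex.Im z * complex.Im z).
  by case: z => a b /=; rewrite !expr2.
under eq_fun do rewrite e.
apply: (@measurableT_comp _ _ _ _ _ _ (@Num.sqrt R)).
  by apply: continuous_measurable_fun; exact: sqrt_continuous.
by apply: measurable_funD; exact: measurable_funM.
Qed.

Lemma cintegrable_le f (g : R -> R) : cmeasurable f ->
  (forall x, D x -> normc (f x) <= g x) -> mu.-integrable D (EFin \o g) ->
  cintegrable f.
Proof.
move=> [f1 f2] fg ig; split.
  apply: (le_integrable _ _ _ ig) => //; first exact/measurable_EFinP.
  move=> x Dx; rewrite /= lee_fin (le_trans (Re_le_normc _))// (le_trans (fg _ Dx))//.
  exact: ler_norm.
apply: (le_integrable _ _ _ ig) => //; first exact/measurable_EFinP.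
move=> x Dx; rewrite /= lee_fin (le_trans (Im_le_normc _))// (le_trans (fg _ Dx))//.
exact: ler_norm.
Qed.

Lemma cintegrable_normc f : cintegrable f ->
  mu.-integrable D (EFin \o (fun x => normc (f x))).
Proof.
move=> fi; have [f1 f2] := fi.
have i1 := integrable_norm f1; have i2 := integrable_norm f2.
apply: (le_integrable _ _ _ (integrableD _ i1 i2)) => //.
  by apply/measurable_EFinP; apply: measurable_normc; exact: cintegrable_measurable.
move=> x Dx; rewrite /= lee_fin ger0_norm ?normc_ge0// [leRHS]ger0_norm ?addr_ge0//.
exact: normc_le_ReIm.
Qed.

Lemma cintegrable_normcZ f (M : R) : cintegrable f ->
  mu.-integrable D (EFin \o (fun x => M * normc (f x))).
Proof. by move=> fi; exact: (integrableZl _ M (cintegrable_normc fi)). Qed.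

Lemma cintegrable_bounded f (M : R) : cmeasurable f ->
  (forall x, D x -> normc (f x) <= M) -> cintegrable f.
Proof.
move=> mf fM; apply: (cintegrable_le mf fM).
apply: measurable_bounded_integrable => //.
- by rewrite [X in (X < _)%E](_ : _ = (2 * pi)%:E) ?ltry//; exact: mu_period.
- by exists `|M|; split; [exact: num_real|move=> y hy x _; exact: ltW].
Qed.

Lemma cintegrableM_bounded f g (M : R) : cintegrable f -> cmeasurable g ->
  (forall x, D x -> normc (g x) <= M) -> cintegrable (fun x => f x * g x).
Proof.
move=> fi mg gM.
apply: (@cintegrable_le _ (fun x => M * normc (f x))).
- by apply: cmeasurableM => //; exact: cintegrable_measurable.
- by move=> x Dx; rewrite normcM mulrC ler_wpM2r ?normc_ge0// gM.
- exact: cintegrable_normcZ.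
Qed.

Lemma cintegrableD f g : cintegrable f -> cintegrable g ->
  cintegrable (fun x => f x + g x).
Proof.
move=> [f1 f2] [g1 g2]; split.
- rewrite (_ : _ \o _ = (EFin \o (fun x => complex.Re (f x))) \+
     (EFin \o (fun x => complex.Re (g x)))); first exact: integrableD.
  by apply/funext => x /=; rewrite cReD.
- rewrite (_ : _ \o _ = (EFin \o (fun x => complex.Im (f x))) \+
     (EFin \o (fun x => complex.Im (g x)))); first exact: integrableD.
  by apply/funext => x /=; rewrite cImD.
Qed.

Lemma cintegrableZ z f : cintegrable f -> cintegrable (fun x => z * f x).
Proof.
move=> fi; under eq_fun do rewrite mulrC.
by apply: (@cintegrableM_bounded _ _ (normc z)) => //; exact: cmeasurable_cst.
Qed.

Lemma cintegralD f g : cintegrable f -> cintegrable g ->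
  cintegral (fun x => f x + g x) = cintegral f + cintegral g.
Proof.
move=> [f1 f2] [g1 g2]; apply: complexP => /=.
  by rewrite -RintegralD//; apply: eq_Rintegral => x _; rewrite cReD.
by rewrite -RintegralD//; apply: eq_Rintegral => x _; rewrite cImD.
Qed.

Lemma cintegralZ z f : cintegrable f ->
  cintegral (fun x => z * f x) = z * cintegral f.
Proof.
move=> [f1 f2]; apply: complexP; rewrite cReImE/=.
- rewrite -!RintegralZl//= -RintegralB//=; last 2 first.
  + exact: (integrableZl _ _ f1).
  + exact: (integrableZl _ _ f2).
  by apply: eq_Rintegral => x _; rewrite cReM.
- rewrite -!RintegralZl//= -RintegralD//=; last 2 first.
  + exact: (integrableZl _ _ f2).
  + exact: (integrableZl _ _ f1).
  by apply: eq_Rintegral => x _; rewrite cImM.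
Qed.

Lemma cintegralJ f : cintegrable f ->
  cintegral (fun x => (f x)^*%C) = (cintegral f)^*%C.
Proof.
move=> [f1 f2]; apply: complexP; rewrite cReImE/=.
  by apply: eq_Rintegral => x _; rewrite cReJ.
rewrite -mulN1r -RintegralZl//; apply: eq_Rintegral => x _.
by rewrite cImJ mulN1r.
Qed.

Lemma cintegrable_cst z : cintegrable (fun=> z).
Proof. by apply: (@cintegrable_bounded _ (normc z)) => //; exact: cmeasurable_cst. Qed.

Lemma cintegral0 : cintegral (fun=> 0 : R[i]) = 0.
Proof.
apply: complexP => /=; rewrite Rintegral_cst// mul0r//.
Qed.

Lemma cintegrable_sum (I : Type) (r : seq I) (F : I -> R -> R[i]) :
  (forall i, cintegrable (F i)) -> cintegrable (fun x => \sum_(i <- r) F i x).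
Proof.
move=> iF; elim: r => [|i r IH].
  by under eq_fun do rewrite big_nil; exact: cintegrable_cst.
by under eq_fun do rewrite big_cons; exact: cintegrableD.
Qed.

Lemma cintegral_sum (I : Type) (r : seq I) (F : I -> R -> R[i]) :
  (forall i, cintegrable (F i)) ->
  cintegral (fun x => \sum_(i <- r) F i x) = \sum_(i <- r) cintegral (F i).
Proof.
move=> iF; elim: r => [|i r IH].
  by under eq_fun do rewrite big_nil; rewrite big_nil cintegral0.
under eq_fun do rewrite big_cons; rewrite big_cons cintegralD ?IH//.
exact: cintegrable_sum.
Qed.

Lemma eq_torus_cintegral f g : cmeasurable f -> cmeasurable g -> eq_torus f g ->
  cintegral f = cintegral g.
Proof.
move=> [f1 f2] [g1 g2] fg; apply: complexP => /=; congr fine;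
  apply: ae_eq_integral => //; try exact/measurable_EFinP;
  by apply: aeS fg => x + Dx => /(_ Dx) /= ->.
Qed.

Let Rint_dominated (h_ : nat -> R -> R) (h g : R -> R) :
  (forall n, measurable_fun D (h_ n)) -> measurable_fun D h ->
  {ae mu, forall x, D x -> h_ n x @[n --> \oo] --> h x} ->
  mu.-integrable D (EFin \o g) ->
  {ae mu, forall x n, D x -> `|h_ n x| <= g x} ->
  (\int[mu]_(x in D) h_ n x) @[n --> \oo] --> \int[mu]_(x in D) h x.
Proof.
move=> mh_ mh h_h ig h_g.
have [||||| ih _ hc] := @dominated_convergence _ _ _ mu D measurable_period
    (fun n => EFin \o h_ n) (EFin \o h) (EFin \o g).
- by move=> n; apply/measurable_EFinP; exact: mh_.
- by apply/measurable_EFinP; exact: mh.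
- apply: aeS h_h => x hx Dx.
  by apply: cvg_EFin; [exact: nearW|exact: hx].
- exact: ig.
- by apply: aeS h_g => x hx n Dx; rewrite /= lee_fin hx.
- apply: (@fine_cvg _ _ _ _ (fun n => \int[mu]_(x in D) (EFin \o h_ n) x)%E).
  rewrite fineK//; exact: integrable_fin_num.
Qed.

Lemma cintegral_dominated (f_ : nat -> R -> R[i]) f (g : R -> R) :
  (forall n, cmeasurable (f_ n)) -> cmeasurable f ->
  {ae mu, forall x, D x -> ccvg \oo (f_ ^~ x) (f x)} ->
  mu.-integrable D (EFin \o g) ->
  {ae mu, forall x n, D x -> normc (f_ n x) <= g x} ->
  ccvg \oo (fun n => cintegral (f_ n)) (cintegral f).
Proof.
move=> mf_ mf f_f ig f_g; split => /=; apply: (Rint_dominated _ _ _ ig).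
- by move=> n; case: (mf_ n).
- by case: mf.
- by apply: aeS f_f => x h Dx; case: (h Dx).
- apply: aeS f_g => x h n Dx; exact: le_trans (Re_le_normc _) (h n Dx).
- by move=> n; case: (mf_ n).
- by case: mf.
- by apply: aeS f_f => x h Dx; case: (h Dx).
- apply: aeS f_g => x h n Dx; exact: le_trans (Im_le_normc _) (h n Dx).
Qed.

End ComplexIntegral.

(** * Fourier coefficients *)

Section Fourier.
Variable R : realType.
Local Notation mu := (@lebesgue_measure R).
Local Notation D := (@period R).
Implicit Types (f g v : R -> R[i]) (z : R[i]) (k : int).

Lemma expiD (x y : R) : expi (x + y) = expi x * expi y.
Proof. by apply: complexP; rewrite !cReImE/= ?cosD ?sinD//; ring. Qed.

Lemma expi0 : expi (0 : R) = 1.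
Proof. by apply: complexP; rewrite /= ?cos0 ?sin0. Qed.

Lemma expiN (x : R) : expi (- x) = (expi x)^*%C.
Proof. by apply: complexP; rewrite !cReImE/= ?cosN ?sinN. Qed.

Lemma normc_expi (x : R) : normc (expi x) = 1.
Proof. by rewrite /= cos2Dsin2 sqrtr1. Qed.

Lemma expi_natr (n : nat) (x : R) : expi (n%:R * x) = expi x ^+ n.
Proof.
elim: n => [|n IH]; first by rewrite mul0r expi0 expr0.
by rewrite -natr1 mulrDl mul1r expiD IH exprSr.
Qed.

Lemma expi_int_per (k : int) (x : R) : expi (k%:~R * (x + 2 * pi)) = expi (k%:~R * x).
Proof.
have h2 (n : nat) : expi (n%:R * (2 * pi) : R) = 1.
  rewrite expi_natr (_ : expi _ = 1) ?expr1n//.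
  by apply: complexP; rewrite /= mulr_natl ?cos2pi ?sin2pi.
rewrite mulrDr expiD (_ : expi (_ * (2 * pi)) = 1) ?mulr1//.
case: k => n; first exact: h2.
by rewrite NegzE rmorphN/= mulNr expiN h2 conjc1.
Qed.

Lemma cmeasurable_expi (k : int) : @cmeasurable R (fun x => expi (k%:~R * x)).
Proof.
split => /=.
  apply: (@measurableT_comp _ _ _ _ _ _ (@cos R)).
    by apply: continuous_measurable_fun; exact: continuous_cos.
  exact: mulrl_measurable.
apply: (@measurableT_comp _ _ _ _ _ _ (@sin R)).
  by apply: continuous_measurable_fun; exact: continuous_sin.
exact: mulrl_measurable.
Qed.

Lemma cintegrable_expi (k : int) : @cintegrable R (fun x => expi (k%:~R * x)).
Proof.
apply: (@cintegrable_bounded _ _ 1); first exact: cmeasurable_expi.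
by move=> x _; rewrite normc_expi.
Qed.

Lemma cintegrableM_expi f (k : int) : cintegrable f ->
  cintegrable (fun x => f x * expi (k%:~R * x)).
Proof.
move=> fi; apply: (@cintegrableM_bounded _ _ _ 1) => //.
  exact: cmeasurable_expi.
by move=> x _; rewrite normc_expi.
Qed.

Lemma cintegral_expi (k : int) :
  cintegral (fun x : R => expi (k%:~R * x)) = if k == 0 then (2 * pi)%:C else 0.
Proof.
have pi0 : (0 : R) < 2 * pi by rewrite mulr_gt0// pi_gt0.
case: eqVneq => [->|k0].
  under eq_fun do rewrite mul0r expi0.
  apply: complexP => /=; rewrite Rintegral_cst ?mul0r ?mul1r//;
    try exact: measurable_period.
  by rewrite [X in fine X](_ : _ = (2 * pi)%:E)//; exact: mu_period.
pose c := k%:~R : R.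
have c0 : c != 0 by rewrite /c intr_eq0.
have e2 : expi (c * (2 * pi)) = 1 by rewrite -[_ * _]add0r -[0](mulr0 c) -mulrDr expi_int_per mulr0 expi0.
have [cc ss] : cos (c * (2 * pi)) = 1 /\ sin (c * (2 * pi)) = 0.
  by have /(congr1 (@complex.Re R)) := e2; have /(congr1 (@complex.Im R)) := e2.
have ftc (F f : R -> R) : (forall x, is_derive (x : R) (1 : R) F (f x)) -> continuous f ->
    F (2 * pi) = F 0 -> \int[mu]_(x in D) f x = 0.
  move=> Ff cf F0; rewrite /Rintegral (@continuous_FTC2 _ f F)//.
  - by rewrite -EFinB F0 subrr.
  - exact: continuous_subspaceT.
  - split.
    + by move=> x _; exact: ex_derive.
    + apply: cvg_at_right_filter; apply: differentiable_continuous.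
      by apply/derivable1_diffP; exact: ex_derive.
    + apply: cvg_at_left_filter; apply: differentiable_continuous.
      by apply/derivable1_diffP; exact: ex_derive.
  - by move=> x _; rewrite derive1E derive_val.
apply: complexP => /=.
- apply: (ftc (fun x => c^-1 * sin (c * x))).
  + move=> x; apply: is_derive_eq; rewrite /GRing.scale/= -/c.
    by field.
  + move=> x; apply: (@continuous_comp R R R _ (@cos R)); last exact: continuous_cos.
    exact: mulrl_continuous.
  + by rewrite ss !mulr0 sin0 mulr0.
- apply: (ftc (fun x => - c^-1 * cos (c * x))).
  + move=> x; apply: is_derive_eq; rewrite /GRing.scale/= -/c.
    by field.
  + move=> x; apply: (@continuous_comp R R R _ (@sin R)); last exact: continuous_sin.
    exact: mulrl_continuous.
  + by rewrite cc !mulr0 cos0.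
Qed.

Lemma fourierE f k :
  fourier f k = ((2 * pi)^-1)%:C * cintegral (fun x => f x * expi ((- k)%:~R * x)).
Proof.
rewrite /fourier /inner; congr (_ * cintegral _); apply/funext => x.
by rewrite rmorphN/= mulNr expiN.
Qed.

Lemma fourierD f g k : cintegrable f -> cintegrable g ->
  fourier (fun x => f x + g x) k = fourier f k + fourier g k.
Proof.
move=> fi gi; rewrite !fourierE.
under [X in cintegral X]eq_fun do rewrite mulrDl.
by rewrite cintegralD ?mulrDr//; exact: cintegrableM_expi.
Qed.

Lemma fourierZ z f k : cintegrable f ->
  fourier (fun x => z * f x) k = z * fourier f k.
Proof.
move=> fi; rewrite !fourierE mulrCA.
under [X in cintegral X]eq_fun do rewrite -mulrA.
by rewrite cintegralZ//; exact: cintegrableM_expi.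
Qed.

Lemma eq_torus_inner f f' g g' : cmeasurable f -> cmeasurable f' ->
  cmeasurable g -> cmeasurable g' ->
  eq_torus f f' -> eq_torus g g' -> inner f g = inner f' g'.
Proof.
move=> mf mf' mg mg' ff gg; rewrite /inner; apply: congr1; apply: eq_torus_cintegral.
- by apply: cmeasurableM => //; exact: cmeasurableJ.
- by apply: cmeasurableM => //; exact: cmeasurableJ.
- by apply: aeS2 ff gg => x h1 h2 Dx; rewrite /= h1// h2.
Qed.

Lemma eq_torus_fourier f g k : cmeasurable f -> cmeasurable g -> eq_torus f g ->
  fourier f k = fourier g k.
Proof.
move=> mf mg fg; apply: eq_torus_inner => //; try exact: cmeasurable_expi.
by apply: aeS fg => x _ _.
Qed.

(** Termwise integration of a pointwise absolutely convergent series with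
    bounded sums. *)
Lemma csum_cintegral (F : nat -> R -> R[i]) f v (B : R) :
  (forall l, cmeasurable (F l)) -> cmeasurable f ->
  (forall x n, \sum_(0 <= l < n) normc (F l x) <= B) ->
  {ae mu, forall x, D x -> csum (F ^~ x) (f x)} -> cintegrable v ->
  csum (fun l => cintegral (fun x => F l x * v x)) (cintegral (fun x => f x * v x)).
Proof.
move=> mF mf FB Ff vi.
have mv := cintegrable_measurable vi.
have FB1 l x : normc (F l x) <= B.
  rewrite (le_trans _ (FB x l.+1))// big_nat_recr//= lerDr.
  by apply: sumr_ge0 => i _; exact: normc_ge0.
rewrite /csum (_ : (fun n => _) =
    (fun n => cintegral (fun x => (\sum_(0 <= l < n) F l x) * v x))); last first.
  apply/funext => n; rewrite -cintegral_sum.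
    by congr cintegral; apply/funext => x; rewrite mulr_suml.
  move=> l; under eq_fun do rewrite mulrC.
  by apply: cintegrableM_bounded => // x _; exact: FB1.
apply: (@cintegral_dominated _ _ _ (fun x => B * normc (v x))).
- by move=> n; apply: cmeasurableM => //; exact: cmeasurable_sum.
- exact: cmeasurableM.
- by apply: aeS Ff => x h Dx; apply: ccvgM; [exact: h|exact: ccvg_cst].
- exact: cintegrable_normcZ.
- apply: aeW => x n Dx; rewrite normcM ler_wpM2r ?normc_ge0//.
  exact: le_trans (ler_normc_sum _ _ _) (FB x n).
Qed.

End Fourier.

(** * Completeness of the trigonometric system *)

Section Completeness.
Variable R : realType.
Local Notation mu := (@lebesgue_measure R).
Local Notation D := (@period R).
Implicit Types (f g T : R -> R[i]) (z : R[i]) (k : int).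

Lemma ae_neq (a : R) : {ae mu, forall x, x != a}.
Proof.
exists [set a]; split; [exact: measurable_set1|exact: lebesgue_measure_set1|].
by move=> x /= /negP; rewrite negbK => /eqP.
Qed.

(** Orthogonality and stability under products both go by induction on the
    expression, so that no normal form of trigonometric polynomials is fixed. *)
Inductive trigpoly : (R -> R[i]) -> Prop :=
| trig_monomial z k : trigpoly (fun x => z * expi (k%:~R * x))
| trig_add f g : trigpoly f -> trigpoly g -> trigpoly (fun x => f x + g x).

Lemma trigpolyM f g : trigpoly f -> trigpoly g -> trigpoly (fun x => f x * g x).
Proof.
elim=> [z k|f1 f2 _ IH1 _ IH2] tg; last first.
  under eq_fun do rewrite mulrDl.
  by apply: trig_add; [exact: IH1|exact: IH2].
elim: tg => [w l|g1 g2 _ IH1 _ IH2].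
  rewrite (_ : (fun x => _) = (fun x => (z * w) * expi ((k + l)%:~R * x))).
    exact: trig_monomial.
  by apply/funext => x; rewrite rmorphD/= mulrDl expiD mulrACA.
under eq_fun do rewrite mulrDr.
exact: trig_add.
Qed.

Lemma trigpoly_cst z : trigpoly (fun=> z).
Proof.
rewrite (_ : (fun=> z) = (fun x => z * expi (0%:~R * x))).
  exact: trig_monomial.
by apply/funext => x; rewrite mul0r expi0 mulr1.
Qed.

Lemma trigpolyX f n : trigpoly f -> trigpoly (fun x => f x ^+ n).
Proof.
move=> tf; elim: n => [|n IH].
  by under eq_fun do rewrite expr0; exact: trigpoly_cst.
by under eq_fun do rewrite exprS; exact: trigpolyM.
Qed.

Lemma trigpoly_measurable T : trigpoly T -> cmeasurable T.
Proof.
elim=> [z k|f1 f2 _ IH1 _ IH2]; last exact: cmeasurableD.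
by apply: cmeasurableM; [exact: cmeasurable_cst|exact: cmeasurable_expi].
Qed.

Lemma trigpoly_orthogonal g T : cintegrable g ->
  (forall k, cintegral (fun x => g x * expi (k%:~R * x)) = 0) -> trigpoly T ->
  cintegrable (fun x => g x * T x) /\ cintegral (fun x => g x * T x) = 0.
Proof.
move=> gi g0; elim=> [z k|f1 f2 _ [i1 e1] _ [i2 e2]].
  under eq_fun do rewrite mulrCA.
  have h := cintegrableM_expi k gi.
  by rewrite cintegralZ// g0 mulr0; split => //; exact: cintegrableZ.
under eq_fun do rewrite mulrDr.
by rewrite cintegralD// e1 e2 addr0; split => //; exact: cintegrableD.
Qed.

Let bernoulli_ge (t : R) n : 0 <= t -> 1 + n%:R * t <= (1 + t) ^+ n.
Proof.
move=> t0; elim: n => [|n IH]; first by rewrite mul0r addr0 expr0.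
rewrite exprS -natr1; apply: (@le_trans _ _ ((1 + t) * (1 + n%:R * t))).
  have : 0 <= n%:R * t * t by rewrite !mulr_ge0.
  lra.
by rewrite ler_wpM2l// addr_ge0.
Qed.

Let bernoulli_le (t : R) n : 0 <= t <= 1 -> 1 - n%:R * t <= (1 - t) ^+ n.
Proof.
move=> /andP[t0 t1]; elim: n => [|n IH]; first by rewrite mul0r subr0 expr0.
rewrite exprS -natr1; apply: (@le_trans _ _ ((1 - t) * (1 - n%:R * t))).
  have : 0 <= n%:R * t * t by rewrite !mulr_ge0.
  lra.
by rewrite ler_wpM2l// subr_ge0.
Qed.

(** These polynomials separate the two halves of $[0, 1]$: they are the ones
    used in Brosowski and Deutsch's proof of the Stone-Weierstrass theorem. *)
Let steep n (y : R) := (1 - y ^+ n) ^+ (2 ^ n)%N.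

Let steep01 n y : 0 <= y <= 1 -> 0 <= steep n y <= 1.
Proof.
move=> /andP[y0 y1].
have h : 0 <= 1 - y ^+ n <= 1.
  by rewrite subr_ge0 exprn_ile1//= lerBlDr lerDl exprn_ge0.
by case/andP: h => h1 h2; rewrite exprn_ge0//= exprn_ile1.
Qed.

Let steep_lo y : 0 <= y < 2^-1 -> steep n y @[n --> \oo] --> (1 : R).
Proof.
move=> /andP[y0 y1].
have h : (1 - (2 * y) ^+ n) @[n --> \oo] --> (1 - 0 : R).
  apply: cvgB; first exact: cvg_cst.
  by apply: cvg_expr; rewrite ger0_norm; lra.
rewrite subr0 in h.
apply: (squeeze_cvgr _ h (@cvg_cst _ (1 : R) _ _ _)).
apply: nearW => n; have /andP[_ ->] : 0 <= steep n y <= 1 by apply: steep01; lra.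
rewrite andbT exprMn; apply: le_trans (bernoulli_le _ _); first by rewrite natrX.
by rewrite exprn_ge0// exprn_ile1//; lra.
Qed.

Let steep_hi y : 2^-1 < y <= 1 -> steep n y @[n --> \oo] --> (0 : R).
Proof.
move=> /andP[y0 y1]; have y2 : 0 < y by lra.
have h : (((2 * y)^-1) ^+ n) @[n --> \oo] --> (0 : R).
  apply: cvg_expr; rewrite ger0_norm ?invr_ge0; last lra.
  by rewrite invf_lt1; lra.
apply: (squeeze_cvgr _ (@cvg_cst _ (0 : R) _ _ _) h).
apply: nearW => n; have /andP[-> _] : 0 <= steep n y <= 1 by apply: steep01; lra.
rewrite /= exprVn -[leRHS]mul1r ler_pdivlMr ?exprn_gt0//; last lra.
have yn : 0 <= y ^+ n <= 1 by rewrite exprn_ge0 ?exprn_ile1//; lra.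
have h2 : (2 * y) ^+ n <= (1 + y ^+ n) ^+ (2 ^ n)%N.
  rewrite exprMn -natrX; apply: le_trans (bernoulli_ge _ _); last by case/andP: yn.
  by rewrite lerDr.
apply: (@le_trans _ _ (steep n y * (1 + y ^+ n) ^+ (2 ^ n)%N)).
  rewrite ler_wpM2l//.
  by have /andP[] : 0 <= steep n y <= 1 by apply: steep01; lra.
rewrite /steep -exprMn; apply: exprn_ile1; nra.
Qed.

(** The sign of $\sin(x/2)\sin((b-x)/2)$ tells whether $x \in (0, 2\pi)$ lies
    before or after [b], and this function is a trigonometric polynomial. *)
Let sep (b x : R) := 2^-1 - sin (x / 2) * sin ((b - x) / 2) / 2.

Let sepE b x : (sep b x)%:C =
  (2^-1 + cos (b / 2) / 4)%:C +
  ((- 8^-1)%:C * expi (- (b / 2)) * expi (1%:~R * x) +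
   (- 8^-1)%:C * expi (b / 2) * expi ((-1)%:~R * x)).
Proof.
have e1 : cos (x - b / 2) = cos (x / 2) * cos ((x - b) / 2) - sin (x / 2) * sin ((x - b) / 2).
  by rewrite -cosD; congr cos; field.
have e2 : cos (b / 2) = cos (x / 2) * cos ((x - b) / 2) + sin (x / 2) * sin ((x - b) / 2).
  by rewrite -cosB; congr cos; field.
have e3 : sin ((b - x) / 2) = - sin ((x - b) / 2) by rewrite -sinN -mulNr opprB.
have e4 : cos x * cos (b / 2) + sin x * sin (b / 2) = cos (x - b / 2) by rewrite cosB.
apply: complexP; rewrite !cReImE/= ?mul1r ?mulN1r ?cosN ?sinN ?mul0r ?subr0 ?addr0.
  rewrite /sep e3; rewrite e1 in e4; lra.
ring.
Qed.

Let sep01 b x : 0 <= sep b x <= 1.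
Proof.
have h : `|sin (x / 2) * sin ((b - x) / 2)| <= 1.
  by rewrite normrM mulr_ile1// sin_max.
by move: h; rewrite ler_norml /sep => /andP[]; lra.
Qed.

Let trig_steep b n : trigpoly (fun x => (steep n (sep b x))%:C).
Proof.
rewrite (_ : (fun x => _) =
    (fun x => (1 + (-1) * ((sep b x)%:C) ^+ n) ^+ (2 ^ n)%N)).
  apply: trigpolyX; apply: trig_add; first exact: trigpoly_cst.
  apply: trigpolyM; first exact: trigpoly_cst.
  apply: trigpolyX; under eq_fun do rewrite sepE.
  apply: trig_add; first exact: trigpoly_cst.
  by apply: trig_add; exact: trig_monomial.
by apply/funext => x; rewrite /steep rmorphXn/= rmorphB/= rmorphXn/= mulN1r.
Qed.

Let cut (b x : R) : R[i] := if x <= b then 1 else 0.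

Let cut_measurable b : cmeasurable (cut b).
Proof.
have m (u w : R) : measurable_fun D (fun x => if x <= b then u else w).
  apply: measurable_funTS; apply: measurable_fun_ifT => //.
  exact: measurable_fun_ler.
by split; rewrite /cut; under eq_fun do rewrite fun_if/=; exact: m.
Qed.

(** Dominated convergence along the trigonometric polynomials
    [steep n (sep b x)], which tend to [cut b x] off a negligible set when
    $0 < b < 2\pi$; otherwise [cut b] is almost everywhere constant
    on the period. *)
Let cut_orthogonal g b : cintegrable g ->
  (forall k, cintegral (fun x => g x * expi (k%:~R * x)) = 0) ->
  cintegral (fun x => g x * cut b x) = 0.
Proof.
move=> gi g0; have mg := cintegrable_measurable gi.
have mgc : cmeasurable (fun x => g x * cut b x) by exact: cmeasurableM.
have [b0|b0] := leP b 0.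
  rewrite -[RHS](@cintegral0 R); apply: eq_torus_cintegral => //.
  apply: aeS (ae_neq 0) => x x0; rewrite /period/= in_itv/= => /andP[x1 _].
  by rewrite /cut ifF ?mulr0//; lra.
have [b2|b2] := leP (2 * pi) b.
  rewrite -(g0 0); apply: eq_torus_cintegral => //.
    by apply: cmeasurableM => //; exact: cmeasurable_expi.
  apply: aeW => x; rewrite /period/= in_itv/= => /andP[_ x1].
  by rewrite /cut (le_trans x1 b2) mul0r expi0.
have [_ e0] := trigpoly_orthogonal gi g0 (trig_steep b 0).
apply: (@ccvg_unique _ _ \oo _ (fun n => cintegral (fun x => g x * (steep n (sep b x))%:C))).
- apply: (@cintegral_dominated _ _ _ (fun x => normc (g x))) => //.
  + by move=> n; apply: cmeasurableM => //; apply: trigpoly_measurable; exact: trig_steep.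
  + have := aeI (ae_neq 0) (aeI (ae_neq b) (ae_neq (2 * pi))).
    apply: aeS => x [x0 [xb xpi]]; rewrite /period/= in_itv/= => /andP[x1 x2].
    have {x0}x1 : 0 < x by rewrite lt_neqAle eq_sym x0.
    have {xpi}x2 : x < 2 * pi by rewrite lt_neqAle xpi.
    apply: ccvgM; first exact: ccvg_cst.
    split => /=; last by rewrite /cut fun_if if_same; exact: cvg_cst.
    have s1 : 0 < sin (x / 2) by apply: sin_gt0_pi; apply/andP; split; lra.
    have /andP[y0 y1] := sep01 b x.
    rewrite /cut; case: (ltgtP x b) => [h|h|/eqP]; last by rewrite (negbTE xb).
      have s2 : 0 < sin ((b - x) / 2) by apply: sin_gt0_pi; apply/andP; split; lra.
      apply: steep_lo; rewrite y0/= /sep; have := mulr_gt0 s1 s2; lra.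
    have s2 : 0 < sin ((x - b) / 2) by apply: sin_gt0_pi; apply/andP; split; lra.
    apply: steep_hi; rewrite y1 andbT /sep.
    rewrite (_ : (b - x) / 2 = - ((x - b) / 2)) ?sinN; last by lra.
    have := mulr_gt0 s1 s2; lra.
  + exact: cintegrable_normc.
  + apply: aeW => x n Dx; rewrite normcM ler_piMr ?normc_ge0//=.
    rewrite expr0n addr0 sqrtr_sqr ger0_norm.
      by case/andP: (steep01 n (sep01 b x)).
    by case/andP: (steep01 n (sep01 b x)).
- rewrite (_ : (fun n => _) = fun=> 0); first exact: ccvg_cst.
  apply/funext => n; exact: (trigpoly_orthogonal gi g0 (trig_steep b n)).2.
Qed.

(** Completeness of the trigonometric system: the indefinite integral of [g]
    vanishes identically, hence so does [g] almost everywhere by Lebesgue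
    differentiation. *)
Lemma fourier_eq0_ae g : cintegrable g -> (forall k, fourier g k = 0) ->
  {ae mu, forall x, D x -> g x = 0}.
Proof.
move=> gi g0; have mg := cintegrable_measurable gi.
have g1 k : cintegral (fun x => g x * expi (k%:~R * x)) = 0.
  have := g0 (- k); rewrite fourierE opprK => /eqP; rewrite mulf_eq0 => /orP[|/eqP//].
  rewrite eq_complex/= eqxx andbT invr_eq0 mulf_eq0 pnatr_eq0/=.
  by rewrite gt_eqF// pi_gt0.
have real_case (h : R -> R) : mu.-integrable D (EFin \o h) ->
    (forall b, \int[mu]_(x in D) (if x <= b then h x else 0) = 0) ->
    {ae mu, forall x, D x -> h x = 0}.
  move=> hi h0; pose hD := h \_ D.
  have hDi : mu.-integrable setT (EFin \o hD).
    rewrite /hD -restrict_EFin.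
    exact: integrable_period_restrict.
  have hDi1 (b : R) : mu.-integrable `]-oo, b] (EFin \o hD).
    by apply: integrableS hDi => //; exact: measurable_itv.
  have := FTC1Ny hDi1 (open_integrable_locally openT hDi).
  apply: aeS => x [_ dh] Dx.
  have : hD x = h x by rewrite /hD patchE mem_set.
  move=> <-; rewrite -dh (_ : (fun y => _) = cst 0) ?derive1_cst//.
  apply/funext => b; rewrite -(h0 b) Rintegral_mkcond [RHS]Rintegral_mkcond.
  apply: eq_Rintegral => y _; rewrite /hD !patchE.
  have -> : (y \in [set` `]-oo, b]]) = (y <= b) by rewrite mem_setE in_itv.
  by case: ifP; case: ifP.
have [g2 g3] := gi.
have re : {ae mu, forall x, D x -> complex.Re (g x) = 0}.
  apply: (real_case _ g2) => b.
  transitivity (complex.Re (cintegral (fun x => g x * cut b x))).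
    by apply: eq_Rintegral => x _; rewrite /cut; case: ifP => _; rewrite ?mulr1 ?mulr0.
  by rewrite cut_orthogonal.
have im : {ae mu, forall x, D x -> complex.Im (g x) = 0}.
  apply: (real_case _ g3) => b.
  transitivity (complex.Im (cintegral (fun x => g x * cut b x))).
    by apply: eq_Rintegral => x _; rewrite /cut; case: ifP => _; rewrite ?mulr1 ?mulr0.
  by rewrite cut_orthogonal.
by apply: aeS2 re im => x r0 i0 Dx; apply: complexP; rewrite ?r0 ?i0.
Qed.

End Completeness.

(** * Absolutely convergent Fourier series *)

Section FourierSeries.
Variable R : realType.
Local Notation mu := (@lebesgue_measure R).
Local Notation D := (@period R).
Implicit Types (f g v : R -> R[i]) (z : R[i]) (a : nat -> R[i]).

Lemma csum_exists a (B : R) :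
  (forall n, \sum_(0 <= k < n) normc (a k) <= B) -> exists S, csum a S.
Proof.
move=> aB.
have conv (h : nat -> R) : (forall k, `|h k| <= normc (a k)) ->
    cvgn (fun n => \sum_(0 <= k < n) h k).
  move=> ha; apply: normed_cvg.
  rewrite (_ : [normed _] = (fun n => \sum_(0 <= k < n) `|h k|))//.
  apply: nondecreasing_is_cvgn.
    by apply/nondecreasing_seqP => n; rewrite big_nat_recr//= lerDl.
  exists B => _ [n _ <-]; apply: le_trans (aB n).
  by apply: ler_sum => k _; exact: ha.
have c1 := conv _ (fun k => Re_le_normc (a k)).
have c2 := conv _ (fun k => Im_le_normc (a k)).
exists (limn (fun n => \sum_(0 <= k < n) complex.Re (a k)) +i*
        limn (fun n => \sum_(0 <= k < n) complex.Im (a k))).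
by split => /=; [under eq_fun do rewrite cRe_sum|under eq_fun do rewrite cIm_sum].
Qed.

Lemma csum_finite a n : (forall l, (n <= l)%N -> a l = 0) ->
  csum a (\sum_(0 <= l < n) a l).
Proof.
move=> a0; have h m : (n <= m)%N -> \sum_(0 <= l < m) a l = \sum_(0 <= l < n) a l.
  move=> nm; rewrite (big_cat_nat _ nm)//=.
  rewrite [X in _ + X](_ : _ = 0) ?addr0// big_nat_cond big1// => i.
  by move=> /andP[/andP[+ _] _]; exact: a0.
split; apply: (cvg_near_cst _).
  by exists n => // m /= nm; rewrite h.
by exists n => // m /= nm; rewrite h.
Qed.

Lemma csum_single z m : csum (fun l => if l == m then z else 0) z.
Proof.
have := @csum_finite (fun l => if l == m then z else 0) m.+1.
rewrite big_nat_recr//= eqxx [X in X + _](_ : _ = 0) ?add0r; last first.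
  rewrite big_nat_cond big1// => i /andP[/andP[_ +] _].
  by case: eqVneq => // ->; rewrite ltnn.
by apply=> l; case: eqVneq => // ->; rewrite ltnn.
Qed.

Lemma L2_measurable f : L2 f -> cmeasurable f.
Proof. by case=> _ f1 f2 _. Qed.

Lemma L2_sqr_integrable f : L2 f ->
  mu.-integrable D (EFin \o (fun x => normc (f x) ^+ 2)).
Proof.
move=> fL; have mf := L2_measurable fL; case: fL => _ _ _ foo.
apply/integrableP; split.
  by apply/measurable_EFinP; apply: measurable_funX; exact: measurable_normc.
apply: le_lt_trans foo; rewrite le_eqVlt; apply/orP; left; apply/eqP.
by apply: eq_integral => x _; rewrite /= ger0_norm// sqr_ge0.
Qed.

Lemma cintegrable_L2M f g : L2 f -> L2 g -> cintegrable (fun x => f x * g x).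
Proof.
move=> fL gL; have if2 := L2_sqr_integrable fL; have ig2 := L2_sqr_integrable gL.
apply: (@cintegrable_le _ _ (fun x => normc (f x) ^+ 2 + normc (g x) ^+ 2)).
- by apply: cmeasurableM; exact: L2_measurable.
- move=> x _; rewrite normcM.
  have := normc_ge0 (f x); have := normc_ge0 (g x); nra.
- rewrite (_ : _ \o _ = (EFin \o (fun x => normc (f x) ^+ 2)) \+
     (EFin \o (fun x => normc (g x) ^+ 2)))//.
  by apply: integrableD => //; exact: measurable_period.
Qed.

Lemma L2_expi k : @L2 R (fun x => expi (k%:~R * x)).
Proof.
have [m1 m2] := cmeasurable_expi R k.
split => //; first by move=> x; exact: expi_int_per.
under eq_integral do rewrite normc_expi expr1n.
rewrite integral_cst ?mul1e; last exact: measurable_period.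
by rewrite [X in (X < _)%E](_ : _ = (2 * pi)%:E) ?ltry//; exact: mu_period.
Qed.

Lemma cintegrable_L2 f : L2 f -> cintegrable f.
Proof.
move=> fL; have := cintegrable_L2M fL (L2_expi 0).
by under eq_fun do rewrite mul0r expi0 mulr1.
Qed.

Lemma L2J f : L2 f -> L2 (fun x => (f x)^*%C).
Proof.
move=> fL; have [m1 m2] := cmeasurableJ (L2_measurable fL); case: fL => fp _ _ foo.
split => //; first by move=> x; rewrite fp.
by under eq_integral do rewrite normc_conj.
Qed.

Lemma fourier_expi k l : fourier (fun x : R => expi (k%:~R * x)) l = (k == l)%:R.
Proof.
rewrite fourierE.
under [X in cintegral X]eq_fun do rewrite -expiD -mulrDl -rmorphD/=.
rewrite cintegral_expi subr_eq0; case: ifP => _; last by rewrite mulr0.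
rewrite -rmorphM/= mulVf ?rmorph1// mulf_neq0 ?pnatr_eq0//.
by rewrite gt_eqF// pi_gt0.
Qed.

Lemma L2plus_expi (k : nat) : @L2plus R (fun x => expi (k%:~R * x)).
Proof.
split; first exact: L2_expi.
by move=> l l0; rewrite fourier_expi; case: eqVneq => // kl; move: l0; rewrite -kl.
Qed.

Lemma fourierJ f k : cintegrable f ->
  fourier (fun x => (f x)^*%C) k = (fourier f (- k))^*%C.
Proof.
move=> fi; rewrite !fourierE conjcM conjc_real -cintegralJ; last exact: cintegrableM_expi.
under [X in _ = _ * cintegral X]eq_fun do rewrite conjcM -expiN -mulNr -rmorphN.
by rewrite opprK.
Qed.

(** Fourier coefficients of a product whose first factor is the sum of an
    absolutely convergent trigonometric series with frequencies [m]. *)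
Lemma csum_fourierM f v a (m : nat -> int) (B : R) k :
  cmeasurable f -> cintegrable v ->
  (forall n, \sum_(0 <= l < n) normc (a l) <= B) ->
  {ae mu, forall x, D x -> csum (fun l => a l * expi ((m l)%:~R * x)) (f x)} ->
  csum (fun l => a l * fourier v (k - m l)) (fourier (fun x => f x * v x) k).
Proof.
move=> mf vi aB fa; rewrite fourierE.
under [X in cintegral X]eq_fun do rewrite -mulrA.
have vk := cintegrableM_expi (- k) vi.
have := @csum_cintegral _ (fun l x => a l * expi ((m l)%:~R * x)) f _ B _ mf _ fa vk.
move=> h; apply: (eq_csum _ (csumZ ((2 * pi)^-1)%:C (h _ _))).
- move=> l.
  have -> : (fun x => a l * expi ((m l)%:~R * x) * (v x * expi ((- k)%:~R * x))) =
      (fun x => a l * (v x * expi ((- (k - m l))%:~R * x))).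
    apply/funext => x; rewrite opprB rmorphD/= mulrDl expiD; ring.
  by rewrite cintegralZ ?fourierE 1?mulrCA//; exact: cintegrableM_expi.
- move=> l; apply: cmeasurableM; first exact: cmeasurable_cst.
  exact: cmeasurable_expi.
- by move=> x n; under eq_bigr do rewrite normcM normc_expi mulr1.
Qed.

Lemma cmeasurable_fourier_series a (S : R -> R[i]) :
  (forall x, csum (fun l => a l * expi (l%:Z%:~R * x)) (S x)) -> cmeasurable S.
Proof.
move=> aS.
have mp n : cmeasurable (fun x => \sum_(0 <= l < n) a l * expi (l%:Z%:~R * x)).
  apply: cmeasurable_sum => l; apply: cmeasurableM; first exact: cmeasurable_cst.
  exact: cmeasurable_expi.
split; apply: measurable_fun_cvg.
- by move=> n; exact: (mp n).1.
- by move=> x _; exact: (aS x).1.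
- by move=> n; exact: (mp n).2.
- by move=> x _; exact: (aS x).2.
Qed.

Lemma fourier_csum f a (B : R) : cmeasurable f ->
  (forall n, \sum_(0 <= l < n) normc (a l) <= B) ->
  {ae mu, forall x, D x -> csum (fun l => a l * expi (l%:Z%:~R * x)) (f x)} ->
  forall k : int, fourier f k = if k is Posz l then a l else 0.
Proof.
move=> mf aB fa k.
have vi : cintegrable (fun x : R => expi (0%:Z%:~R * x)) by exact: cintegrable_expi.
have := csum_fourierM k mf vi aB fa.
rewrite (_ : (fun x => f x * _) = f); last first.
  by apply/funext => x; rewrite mul0r expi0 mulr1.
move=> h; apply: (csum_unique h); apply: eq_csum (csum_single _ `|k|%N) => l.
rewrite fourier_expi [_ == k - _]eq_sym subr_eq0; case: k {h} => n /=.
  by rewrite eqz_nat [n == l]eq_sym; case: eqVneq => [->|_]; rewrite ?mulr1 ?mulr0.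
by rewrite mulr0 if_same.
Qed.

Definition is_expansion f a (B : R) := [/\ L2 f,
  forall n, \sum_(0 <= l < n) normc (a l) <= B &
  {ae mu, forall x, D x -> csum (fun l => a l * expi (l%:Z%:~R * x)) (f x)}].

(** The sum of the Fourier series has the same coefficients as the function,
    so that the two agree almost everywhere by completeness. *)
Lemma L2plus_expansion f (B : R) : L2plus f ->
  (forall n, \sum_(0 <= l < n) normc (fourier f l%:Z) <= B) ->
  is_expansion f (fun l => fourier f l%:Z) B.
Proof.
move=> [fL f0] fB; pose a l := fourier f l%:Z; split => //.
have fi := cintegrable_L2 fL.
have aB x n : \sum_(0 <= l < n) normc (a l * expi (l%:Z%:~R * x)) <= B.
  by under eq_bigr do rewrite normcM normc_expi mulr1.
have /choice[S aS] : forall x, exists S, csum (fun l => a l * expi (l%:Z%:~R * x)) S.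
  by move=> x; apply: csum_exists; exact: aB.
have mS : cmeasurable S := cmeasurable_fourier_series aS.
have SB x : normc (S x) <= B.
  apply: (cvgr_to_le (ccvg_normc (aS x))); apply: nearW => n.
  exact: le_trans (ler_normc_sum _ _ _) (aB x n).
have Si : cintegrable S by apply: (cintegrable_bounded mS) => x _; exact: SB.
have Sk k : fourier S k = fourier f k.
  have := @fourier_csum S a B mS fB; move=> ->; last by apply: aeW => x _; exact: aS.
  by case: k => // n; rewrite f0.
have : {ae mu, forall x, D x -> f x + (-1) * S x = 0}.
  apply: fourier_eq0_ae; first by apply: cintegrableD => //; exact: cintegrableZ.
  move=> k; rewrite fourierD//; last exact: cintegrableZ.
  by rewrite fourierZ// Sk mulN1r subrr.
apply: aeS => x h Dx; have /eqP := h Dx; rewrite mulN1r subr_eq0 => /eqP ->.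
exact: aS.
Qed.

Section expansion.
Variables (f : R -> R[i]) (a : nat -> R[i]) (B : R).
Hypothesis fa : is_expansion f a B.

Let fL : L2 f. Proof. by case: fa. Qed.
Let mf := L2_measurable fL.
Let aB : forall n, \sum_(0 <= l < n) normc (a l) <= B. Proof. by case: fa. Qed.
Let fE : {ae mu, forall x, D x -> csum (fun l => a l * expi (l%:Z%:~R * x)) (f x)}.
Proof. by case: fa. Qed.

Lemma fourier_expansion (k : int) : fourier f k = if k is Posz l then a l else 0.
Proof. exact: (fourier_csum mf aB fE). Qed.

(** A Cauchy product: the terms of index $l > k$ drop out because [f] has no
    negative frequency. *)
Lemma fourier_sqr (k : nat) :
  fourier (fun x => f x ^+ 2) k = \sum_(0 <= l < k.+1) a l * a (k - l)%N.
Proof.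
under [X in fourier X]eq_fun do rewrite expr2.
have h := csum_fourierM k mf (cintegrable_L2 fL) aB fE.
rewrite (csum_unique h (csum_finite _ (n := k.+1))).
  rewrite big_nat_cond [RHS]big_nat_cond; apply: eq_bigr => l /andP[/andP[_ lk] _].
  by rewrite subzn// fourier_expansion.
move=> l kl; rewrite fourier_expansion.
have : k%:Z - l%:Z < 0 by rewrite subr_lt0 ltz_nat.
by case: (_ - _) => // n _; rewrite mulr0.
Qed.

Lemma normc_sqrE : (fun x => `|f x| ^+ 2 : R[i]) = (fun x => (f x)^*%C * f x).
Proof. by apply/funext => x; rewrite sqr_normc mulrC. Qed.

Lemma csum_fourier_normc_sqr (k : nat) :
  csum (fun l => (a l)^*%C * a (k + l)%N) (fourier (fun x => `|f x| ^+ 2) k).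
Proof.
rewrite normc_sqrE.
have fJE : {ae mu, forall x, D x ->
    csum (fun l => (a l)^*%C * expi ((- l%:Z)%:~R * x)) (f x)^*%C}.
  apply: aeS fE => x h Dx; apply: eq_csum (csumJ (h Dx)) => l.
  by rewrite conjcM -expiN rmorphN mulNr.
have aJB n : \sum_(0 <= l < n) normc (a l)^*%C <= B.
  by under eq_bigr do rewrite normc_conj.
have := csum_fourierM k (cmeasurableJ mf) (cintegrable_L2 fL) aJB fJE.
by apply: eq_csum => l; rewrite opprK -PoszD fourier_expansion.
Qed.

Lemma csum_Jfun :
  csum (fun l => a l * (fourier (fun x => `|f x| ^+ 2) l)^*%C) (Jfun f).
Proof.
have ffi := cintegrable_L2M (L2J fL) fL.
have e : Jfun f = fourier (fun x => f x * ((f x)^*%C * f x)) 0.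
  rewrite /Jfun /inner fourierE oppr0.
  by under [X in _ = _ * cintegral X]eq_fun do
    rewrite mul0r expi0 mulr1 mulrA mulrAC -expr2.
have wJ : (fun x => ((f x)^*%C * f x)^*%C) = (fun x => (f x)^*%C * f x).
  by apply/funext => x; rewrite conjcM conjcK mulrC.
have wl (l : nat) : fourier (fun x => (f x)^*%C * f x) (0 - l%:Z) =
    (fourier (fun x => (f x)^*%C * f x) l)^*%C.
  by have := fourierJ (- l%:Z) ffi; rewrite opprK wJ sub0r.
rewrite e normc_sqrE; have h := csum_fourierM 0 mf ffi aB fE.
by apply: eq_csum h => l; rewrite wl.
Qed.

Lemma mass_fourier : mass f = fourier (fun x => `|f x| ^+ 2) 0.
Proof.
rewrite normc_sqrE /mass /inner fourierE oppr0.
by under [X in _ = _ * cintegral X]eq_fun do rewrite mul0r expi0 mulr1 mulrC.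
Qed.

End expansion.

End FourierSeries.

(** * Sobolev norms *)

Section Sobolev.
Variable R : realType.
Implicit Types (f g v : R -> R[i]) (s : R).

Definition weight s (k : nat) : R := (1 + k%:R ^+ 2) `^ s.

Lemma weight_gt0 s k : 0 < weight s k.
Proof. by rewrite powR_gt0// ltr_pwDl// sqr_ge0. Qed.

Lemma esum_int (e : int -> \bar R) : (forall k, 0 <= e k)%E ->
  (forall k, k < 0 -> e k = 0%E) ->
  \esum_(k in [set: int]) e k = (\sum_(0 <= k <oo) e (Posz k))%E.
Proof.
move=> e0 en; rewrite nneseries_esumT; last by move=> n; exact: e0.
rewrite -(@esum_image _ _ _ setT Posz e); last by move=> x y _ _ [].
rewrite [RHS]esum_mkcond; apply: eq_esum => k _; case: ifPn => //.
case: k => n; last by move=> _; rewrite en.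
by rewrite notin_setE => /(_ (ex_intro2 _ _ n I erefl)).
Qed.

Lemma Hs_normE s f : (forall k : int, k < 0 -> fourier f k = 0) ->
  Hs_norm s f =
  ((\sum_(0 <= k <oo) (weight s k * normc (fourier f k%:Z) ^+ 2)%:E) `^ 2^-1)%E.
Proof.
move=> f0; rewrite /Hs_norm esum_int//.
- by move=> k; rewrite lee_fin mulr_ge0 ?powR_ge0// sqr_ge0.
- by move=> k k0; rewrite f0// normc0 expr0n mulr0.
Qed.

Lemma Hs_norm_lty_bound s f : L2plus f -> (Hs_norm s f < +oo)%E ->
  exists2 N, 0 <= N & Hs_norm s f = N%:E.
Proof.
move=> fL foo; have N0 : (0 <= Hs_norm s f)%E by exact: poweR_ge0.
exists (fine (Hs_norm s f)); first exact: fine_ge0.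
by rewrite fineK// ge0_fin_numE.
Qed.

Lemma Hs_norm_partial s f N : L2plus f -> 0 <= N -> (Hs_norm s f <= N%:E)%E ->
  forall n, \sum_(0 <= k < n) weight s k * normc (fourier f k%:Z) ^+ 2 <= N ^+ 2.
Proof.
move=> [_ f0] N0 fN n; rewrite Hs_normE// in fN.
set S := (\sum_(0 <= k <oo) _)%E in fN.
have pos k : (0 <= (weight s k * normc (fourier f k%:Z) ^+ 2)%:E)%E.
  by rewrite lee_fin mulr_ge0 ?sqr_ge0// ltW// weight_gt0.
have S0 : (0 <= S)%E by exact: nneseries_ge0.
have h : (\sum_(0 <= k < n) (weight s k * normc (fourier f k%:Z) ^+ 2)%:E <= S)%E.
  exact: nneseries_lim_ge.
have : (S <= (N ^+ 2)%:E)%E.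
  case: S fN S0 {h} => [r| |]; last by [].
    rewrite poweR_EFin !lee_fin => /[swap] r0; rewrite powR12_sqrt// => rN.
    by rewrite -(sqr_sqrtr r0) ler_pXn2r ?nnegrE.
  by rewrite poweRyr ?invr_neq0// leye_eq.
by move=> /(le_trans h); rewrite sumEFin lee_fin.
Qed.

Lemma Hs_norm_cvg s f S : L2plus f ->
  \sum_(0 <= k < n) weight s k * normc (fourier f k%:Z) ^+ 2 @[n --> \oo] --> S ->
  Hs_norm s f = (Num.sqrt S)%:E.
Proof.
move=> [_ f0] h; rewrite Hs_normE//.
have -> : (\sum_(0 <= k <oo) (weight s k * normc (fourier f k%:Z) ^+ 2)%:E)%E = S%:E.
  apply/cvg_lim => //; rewrite (_ : (fun n => _) = EFin \o
    (fun n => \sum_(0 <= k < n) weight s k * normc (fourier f k%:Z) ^+ 2)).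
    by apply/fine_cvgP; split; [exact: nearW|exact: h].
  by apply/funext => n /=; rewrite sumEFin.
have S0 : 0 <= S.
  apply: (cvgr_to_ge h); apply: nearW => n; apply: sumr_ge0 => k _.
  by rewrite mulr_ge0 ?sqr_ge0// ltW// weight_gt0.
by rewrite poweR_EFin powR12_sqrt.
Qed.

(** For $a > 1$ the terms $k^{-a}$ telescope against $k^{1-a}$, which follows
    from $-\ln(1 - x) \geq x$. *)
Lemma weight_inv_bound s : 2^-1 < s ->
  exists2 Z, 0 <= Z & forall n, \sum_(0 <= k < n) (weight s k)^-1 <= Z.
Proof.
move=> s2; pose a := 2 * s - 1; have a0 : 0 < a by rewrite /a; lra.
have w1 k : (weight s k.+1)^-1 <= k.+1%:R `^ (- (2 * s)).
  rewrite powRN lef_pV2 ?posrE ?weight_gt0 ?powR_gt0// powRrM.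
  apply: ge0_ler_powR; rewrite ?nnegrE ?powR_ge0//; first lra.
  by rewrite powR_mulrn// lerDr.
have tel k : a * k.+2%:R `^ (- (2 * s)) <= k.+1%:R `^ (- a) - k.+2%:R `^ (- a).
  have p1 : 0 < k.+1%:R :> R by []. have p2 : 0 < k.+2%:R :> R by [].
  have -> : k.+2%:R `^ (- (2 * s)) = k.+2%:R `^ (- a) * k.+2%:R^-1 :> R.
    rewrite -powR_inv1// -powRD; last by rewrite pnatr_eq0 implybT.
    by congr (_ `^ _); rewrite /a; lra.
  have -> : k.+1%:R `^ (- a) = k.+2%:R `^ (- a) * (k.+1%:R / k.+2%:R) `^ (- a) :> R.
    rewrite -powRM ?divr_ge0//; congr (_ `^ _); field.
    by rewrite gt_eqF.
  rewrite mulrCA -[X in _ <= _ - X]mulr1 -mulrBr ler_wpM2l ?powR_ge0//.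
  have q0 : 0 < k.+1%:R / k.+2%:R :> R by rewrite divr_gt0.
  have qE : k.+1%:R / k.+2%:R = 1 + - k.+2%:R^-1 :> R.
    have q (y : R) : 0 < y -> y / (y + 1) = 1 + - (y + 1)^-1.
      by move=> y0; field; rewrite gt_eqF// addr_gt0.
    by rewrite -[k.+2%:R]natr1 q.
  have lnq : ln (k.+1%:R / k.+2%:R : R) <= - k.+2%:R^-1.
    by rewrite qE le_ln1Dx// ltrN2 invf_lt1// ltr1n.
  rewrite /powR gt_eqF// lerBrDr addrC.
  apply: le_trans (expR_ge1Dx _); rewrite lerD2l mulNr -mulrN ler_wpM2l//; first exact: ltW.
  by rewrite lerNr.
have bnd n : \sum_(0 <= k < n.+2) (weight s k)^-1 <=
    2 + a^-1 * (1 - n.+1%:R `^ (- a)).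
  elim: n => [|n IH].
    rewrite big_nat_recr//= big_nat1 powR1 subrr mulr0 addr0.
    have -> : weight s 0 = 1 by rewrite /weight expr0n addr0 powR1.
    by rewrite invr1 lerD2l; apply: le_trans (w1 0%N) _; rewrite powR1.
  rewrite big_nat_recr//=.
  apply: le_trans (lerD IH (w1 n.+1)) _; rewrite -addrA lerD2l.
  have := tel n; rewrite -ler_pdivlMl// => h; rewrite -lerBrDl.
  apply: le_trans h _; rewrite -mulrBr ler_wpM2l ?invr_ge0//; [exact: ltW|lra].
exists (2 + a^-1); first by rewrite addr_ge0// invr_ge0 ltW.
move=> n; apply: (@le_trans _ _ (\sum_(0 <= k < n.+2) (weight s k)^-1)).
  rewrite big_nat_recr//= big_nat_recr//= -addrA lerDl.
  by rewrite addr_ge0// invr_ge0 ltW// weight_gt0.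
apply: le_trans (bnd n) _; rewrite lerD2l ler_piMr ?invr_ge0//; exact: ltW.
Qed.

(** The Wiener algebra contains $H^s$: in place of the Cauchy-Schwarz
    inequality, $2 |a_k| \leq w_k |a_k|^2 + w_k^{-1}$. *)
Lemma weighted_summable s : 2^-1 < s -> exists2 Z, 0 <= Z &
  forall (a : nat -> R[i]) M,
  (forall n, \sum_(0 <= k < n) weight s k * normc (a k) ^+ 2 <= M) ->
  forall n, \sum_(0 <= k < n) normc (a k) <= M + Z.
Proof.
move=> s2; have [Z Z0 hZ] := weight_inv_bound s2; exists Z => // a M aM n.
have amgm (w x : R) : 0 < w -> 0 <= x -> x <= w * x ^+ 2 + w^-1.
  move=> w0 x0.
  have -> : w * x ^+ 2 + w^-1 = w^-1 * (w * x - 1) ^+ 2 + 2 * x.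
    by field; rewrite gt_eqF.
  have : 0 <= w^-1 * (w * x - 1) ^+ 2 by rewrite mulr_ge0 ?sqr_ge0// invr_ge0 ltW.
  lra.
apply: (le_trans _ (lerD (aM n) (hZ n))).
rewrite -big_split; apply: ler_sum => k _.
exact: amgm (weight_gt0 s k) (normc_ge0 _).
Qed.

Lemma Hs_normc_fourier_le s f N k : 0 <= s -> L2plus f -> 0 <= N ->
  (Hs_norm s f <= N%:E)%E -> normc (fourier f k%:Z) <= N.
Proof.
move=> s0 fL N0 fN; rewrite -(@ler_pXn2r _ 2)// ?nnegrE ?normc_ge0//.
apply: le_trans (Hs_norm_partial fL N0 fN k.+1); rewrite big_nat_recr//=.
rewrite -[leLHS]add0r lerD//.
  by apply: sumr_ge0 => i _; rewrite mulr_ge0 ?sqr_ge0// ltW// weight_gt0.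
rewrite ler_peMl ?sqr_ge0// -[leLHS](powRr0 (1 + k%:R ^+ 2)) /weight ler_powR//.
by rewrite lerDl sqr_ge0.
Qed.

End Sobolev.

(** * Time derivatives *)

Section ComplexDerivative.
Variable R : realType.
Implicit Types (f g : R -> R[i]) (t : R) (v w : R[i]).

Definition cderiv f t v :=
  is_derive t (1 : R) (fun x => complex.Re (f x)) (complex.Re v) /\
  is_derive t (1 : R) (fun x => complex.Im (f x)) (complex.Im v).

Lemma cderiv_eq f t v w : cderiv f t v -> v = w -> cderiv f t w.
Proof. by move=> h <-. Qed.

Lemma cderiv_cst z t : cderiv (fun=> z) t 0.
Proof. by split; exact: is_derive_cst. Qed.

Lemma cderivD f g t v w : cderiv f t v -> cderiv g t w ->
  cderiv (fun x => f x + g x) t (v + w).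
Proof.
move=> [f1 f2] [g1 g2]; split; rewrite cReImE.
  by under eq_fun do rewrite cReD; exact: is_deriveD.
by under eq_fun do rewrite cImD; exact: is_deriveD.
Qed.

Lemma cderivM f g t v w : cderiv f t v -> cderiv g t w ->
  cderiv (fun x => f x * g x) t (v * g t + f t * w).
Proof.
move=> [f1 f2] [g1 g2]; split; rewrite !cReImE.
  under eq_fun do rewrite cReM; apply: is_derive_eq.
  by rewrite /GRing.scale/=; ring.
under eq_fun do rewrite cImM; apply: is_derive_eq.
by rewrite /GRing.scale/=; ring.
Qed.

Lemma cderivJ f t v : cderiv f t v -> cderiv (fun x => (f x)^*%C) t v^*%C.
Proof.
move=> [f1 f2]; split; rewrite cReImE.
  by under eq_fun do rewrite cReJ.
by under eq_fun do rewrite cImJ; exact: is_deriveN.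
Qed.

Lemma cderivZ z f t v : cderiv f t v -> cderiv (fun x => z * f x) t (z * v).
Proof.
move=> fv; apply: cderiv_eq (cderivM (cderiv_cst z t) fv) _.
by rewrite mul0r add0r.
Qed.

Lemma cderivN f t v : cderiv f t v -> cderiv (fun x => - f x) t (- v).
Proof.
by move=> /(cderivZ (-1)); under eq_fun do rewrite mulN1r; rewrite mulN1r.
Qed.

Lemma cderivB f g t v w : cderiv f t v -> cderiv g t w ->
  cderiv (fun x => f x - g x) t (v - w).
Proof. by move=> fv gw; apply: cderivD => //; exact: cderivN. Qed.

Lemma cderiv_ccvg f t v : cderiv f t v -> ccvg (nbhs t) f (f t).
Proof.
by move=> [f1 f2]; split; apply: differentiable_continuous;
  apply/derivable1_diffP; exact: ex_derive.
Qed.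

Lemma cderiv_sum (I : Type) (r : seq I) (F : I -> R -> R[i]) t (V : I -> R[i]) :
  (forall i, cderiv (F i) t (V i)) ->
  cderiv (fun x => \sum_(i <- r) F i x) t (\sum_(i <- r) V i).
Proof.
move=> FV; elim: r => [|i r IH].
  rewrite big_nil; under eq_fun do rewrite big_nil; exact: cderiv_cst.
by rewrite big_cons; under eq_fun do rewrite big_cons; exact: cderivD.
Qed.

Lemma cderiv0_cst f : (forall t, cderiv f t 0) -> forall t u, f t = f u.
Proof.
move=> f0 t u; apply: complexP.
  by apply: (@is_derive_0_is_cst _ (fun x => complex.Re (f x))) => x; case: (f0 x).
by apply: (@is_derive_0_is_cst _ (fun x => complex.Im (f x))) => x; case: (f0 x).
Qed.

Lemma cRe_divr z (h : R) : complex.Re (z / h%:C) = complex.Re z / h.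
Proof. by rewrite -fmorphV cReM/= mulr0 subr0. Qed.

Lemma cIm_divr z (h : R) : complex.Im (z / h%:C) = complex.Im z / h.
Proof. by rewrite -fmorphV cImM/= mulr0 add0r. Qed.

Lemma cderiv_quotient f t v :
  ccvg 0^' (fun h => (f (t + h) - f t) / h%:C) v -> cderiv f t v.
Proof.
have key (g : R -> R) (l : R) : (g (t + h) - g t) / h @[h --> 0^'] --> l ->
    is_derive t (1 : R) g l.
  move=> gl; have h1 : h^-1 *: ((g \o shift t) (h *: (1 : R)) - g t) @[h --> 0^'] --> l.
    apply: cvg_trans gl; apply: near_eq_cvg; apply: nearW => h /=.
    by rewrite /GRing.scale/= mulr1 [t + h]addrC mulrC.
  by apply: DeriveDef; [apply/cvg_ex; exists l|exact/cvg_lim].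
move=> [h1 h2]; split; apply: key.
  apply: cvg_trans h1; apply: near_eq_cvg; apply: nearW => h.
  by rewrite cRe_divr cReD cReN.
apply: cvg_trans h2; apply: near_eq_cvg; apply: nearW => h.
by rewrite cIm_divr cImD cImN.
Qed.

End ComplexDerivative.

Section SobolevDerivative.
Variable R : realType.
Implicit Types (f g v : R -> R[i]) (s t : R).

Lemma L2Z z f : L2 f -> L2 (fun x => z * f x).
Proof.
move=> fL; have [m1 m2] := cmeasurableM (cmeasurable_cst z) (L2_measurable fL).
case: fL (L2_sqr_integrable fL) => fp _ _ _ fi.
split => //; first by move=> x; rewrite fp.
have h := integrableZl (@measurable_period R) (normc z ^+ 2) fi.
apply: le_lt_trans (integrable_lty (@measurable_period R) h).
rewrite le_eqVlt; apply/orP; left; apply/eqP.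
by apply: eq_integral => x _; rewrite normcM exprMn EFinM.
Qed.

Lemma L2D f g : L2 f -> L2 g -> L2 (fun x => f x + g x).
Proof.
move=> fL gL; have [m1 m2] := cmeasurableD (L2_measurable fL) (L2_measurable gL).
have fi := L2_sqr_integrable fL; have gi := L2_sqr_integrable gL.
case: fL gL => fp _ _ _ [gp _ _ _].
split => //; first by move=> x; rewrite fp gp.
have mD := @measurable_period R.
have h := integrableD mD (integrableZl mD 2 fi) (integrableZl mD 2 gi).
apply: le_lt_trans (integrable_lty mD h).
apply: ge0_le_integral => //.
- by move=> x _; rewrite lee_fin sqr_ge0.
- by apply/measurable_EFinP; apply: measurable_funX; exact: measurable_normc.
- exact: measurable_int h.
- move=> x _; rewrite /= lee_fin.
  have := le_normcD (f x) (g x); have := normc_ge0 (f x + g x).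
  set n := normc (f x + g x); set p := normc (f x); set q := normc (g x).
  move=> n0 npq; have : n ^+ 2 <= (p + q) ^+ 2.
    by rewrite ler_pXn2r ?nnegrE// (le_trans n0).
  have := sqr_ge0 (p - q); lra.
Qed.

Lemma L2plus_lin z f g : L2plus f -> L2plus g -> L2plus (fun x => z * f x + g x).
Proof.
move=> [fL f0] [gL g0]; split; first by apply: L2D => //; exact: L2Z.
have fi := cintegrable_L2 fL; have gi := cintegrable_L2 gL.
move=> k k0; rewrite fourierD//; last exact: cintegrableZ.
by rewrite fourierZ// f0// g0// mulr0 addr0.
Qed.

Section derivative.
Variables (s : R) (u : R -> R -> R[i]) (v : R -> R[i]) (t : R).
Hypotheses (s0 : 0 <= s) (uL : forall t, L2plus (u t)) (vL : L2plus v).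
Hypothesis uv : is_Hs_derivative s u t v.

Let w h x := (u (t + h) x - u t x) / h%:C - v x.

Let wE h : w h = (fun x => (h%:C)^-1 * u (t + h) x + ((- (h%:C)^-1) * u t x + (-1) * v x)).
Proof. by apply/funext => x; rewrite /w; ring. Qed.

Let v1L : L2plus (fun x => (-1) * v x).
Proof.
rewrite (_ : (fun x => _) = (fun x => (-2) * v x + v x)); first exact: L2plus_lin.
by apply/funext => x; ring.
Qed.

Let wL h : L2plus (w h).
Proof. by rewrite wE; do 2 apply: L2plus_lin => //. Qed.

Let fourier_w h k : fourier (w h) k =
  (fourier (u (t + h)) k - fourier (u t) k) / h%:C - fourier v k.
Proof.
have L2i f : L2plus f -> cintegrable f by case=> fL _; exact: cintegrable_L2.
have [i1 i2 i3] := And3 (L2i _ (uL (t + h))) (L2i _ (uL t)) (L2i _ vL).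
have Z z f : cintegrable f -> cintegrable (fun x => z * f x) by exact: cintegrableZ.
rewrite wE fourierD; [|exact: Z|by apply: cintegrableD; exact: Z].
by rewrite fourierD ?fourierZ//; [ring|exact: Z|exact: Z].
Qed.

Let near_w (e : R) : 0 < e -> \forall h \near 0^', (Hs_norm s (w h) <= e%:E)%E.
Proof.
move=> e0; have /fine_cvgP[wfin /cvgrPdist_le/(_ _ e0)] := uv.
apply: filterS2 wfin => h h1; rewrite sub0r normrN => /= h2.
by rewrite -(fineK h1) lee_fin (le_trans _ h2)// ler_norm.
Qed.

(** A single coefficient is dominated by the $H^s$ norm, so that it inherits
    the convergence of the difference quotients. *)
Lemma fourier_cderiv (k : nat) : cderiv (fun t => fourier (u t) k) t (fourier v k).
Proof.
apply: cderiv_quotient; apply: ccvg_normc0; apply/cvgr0Pnorm_le => e e0.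
near=> h; rewrite ger0_norm ?normc_ge0// -fourier_w.
apply: (@Hs_normc_fourier_le _ s) => //; first exact: ltW.
by near: h; exact: near_w.
Unshelve. all: by end_near. Qed.

(** From $u(t + h) = u(t) + h v + h w(h)$ with $w(h)$ of norm at most [1] for
    small [h]; the factor [3] comes from $(x+y+z)^2 \leq 3(x^2+y^2+z^2)$. *)
Lemma Hs_locally_bounded N0 N1 :
  (forall n, \sum_(0 <= k < n) weight s k * normc (fourier (u t) k%:Z) ^+ 2 <= N0) ->
  (forall n, \sum_(0 <= k < n) weight s k * normc (fourier v k%:Z) ^+ 2 <= N1) ->
  \forall t' \near t, forall n, \sum_(0 <= k < n)
    weight s k * normc (fourier (u t') k%:Z) ^+ 2 <= 3 * (N0 + N1 + 1).
Proof.
move=> hN0 hN1.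
have : \forall h \near 0^', forall n, \sum_(0 <= k < n)
    weight s k * normc (fourier (u (t + h)) k%:Z) ^+ 2 <= 3 * (N0 + N1 + 1).
  near=> h; move=> n.
  have hw : (Hs_norm s (w h) <= 1%:E)%E by near: h; exact: near_w.
  have h1 : `|h| <= 1 by near: h; exact: dnbhs0_le.
  have h0 : h%:C != 0.
    by rewrite eq_complex/= eqxx andbT; near: h; exact: nbhs_dnbhs_neq.
  have := Hs_norm_partial (wL h) ler01 hw n; rewrite expr1n => hN2.
  pose S g := \sum_(0 <= k < n) weight s k * normc (fourier g k%:Z) ^+ 2.
  apply: (@le_trans _ _ (3 * (S (u t) + S v + S (w h)))); last first.
    by rewrite ler_wpM2l//; apply: lerD hN2; apply: lerD (hN1 n); exact: hN0.
  rewrite /S -!big_split mulr_sumr; apply: ler_sum => k _.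
  have -> : fourier (u (t + h)) k = fourier (u t) k + h%:C * fourier v k +
      h%:C * fourier (w h) k by rewrite fourier_w; field.
  set x := fourier (u t) k; set y := fourier v k; set z := fourier (w h) k.
  set W := weight s k; have W0 : 0 < W by exact: weight_gt0.
  change (W * normc (x + h%:C * y + h%:C * z) ^+ 2 <=
    3 * (W * normc x ^+ 2 + W * normc y ^+ 2 + W * normc z ^+ 2)).
  rewrite (_ : 3 * _ = W * (3 * (normc x ^+ 2 + normc y ^+ 2 + normc z ^+ 2))); last ring.
  rewrite ler_pM2l//.
  have hn (q : R[i]) : normc (h%:C * q) <= normc q.
    by rewrite normcM/= expr0n addr0 sqrtr_sqr ler_piMl ?normc_ge0.
  have n1 := normc_ge0 (x + h%:C * y + h%:C * z).
  have n2 : normc (x + h%:C * y + h%:C * z) <= normc x + normc y + normc z.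
    apply: le_trans (le_normcD _ _) _; apply: lerD (hn z).
    by apply: le_trans (le_normcD _ _) _; rewrite lerD2l.
  have : normc (x + h%:C * y + h%:C * z) ^+ 2 <= (normc x + normc y + normc z) ^+ 2.
    by rewrite ler_pXn2r ?nnegrE// (le_trans n1).
  have := sqr_ge0 (normc x - normc y); have := sqr_ge0 (normc x - normc z).
  have := sqr_ge0 (normc y - normc z); lra.
move=> H.
have H0 : forall n, \sum_(0 <= k < n)
    weight s k * normc (fourier (u t) k%:Z) ^+ 2 <= 3 * (N0 + N1 + 1).
  move=> n; apply: le_trans (hN0 n) _.
  have p0 : 0 <= N0 by have := hN0 0%N; rewrite big_nil.
  have p1 : 0 <= N1 by have := hN1 0%N; rewrite big_nil.
  lra.
have : \forall h \near 0, forall n, \sum_(0 <= k < n)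
    weight s k * normc (fourier (u (t + h)) k%:Z) ^+ 2 <= 3 * (N0 + N1 + 1).
  move: H; rewrite !nearE => /nbhs_ballP[e /= e0 He]; apply/nbhs_ballP.
  exists e => //= h hb; have [->|h0] := eqVneq h 0; first by rewrite addr0.
  exact: He.
move=> /nbhs_ballP[e /= e0 He]; apply/nbhs_ballP; exists e => //= t' tb n.
have := He (t' - t); rewrite (_ : t + (t' - t) = t'); last ring.
apply.
by rewrite /ball/= sub0r opprB.
Unshelve. all: by end_near. Qed.

End derivative.
End SobolevDerivative.

(** * The equation on Fourier coefficients *)

Section SzegoSystem.
Variable R : realType.
Implicit Types (a v A : R -> nat -> R[i]) (J : R -> R[i]).

(** The equation read on the Fourier coefficients [a t k] of the solution,
    [A t k] being those of its squared modulus. *)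
Record szego_system (s : R) a v J A : Prop := SzegoSystem {
  sys_deriv : forall t k, cderiv (a ^~ k) t (v t k);
  sys_eq : forall t k, 'i%C * v t k =
    2 * J t * A t k + (J t)^*%C * \sum_(0 <= l < k.+1) a t l * a t (k - l)%N;
  sys_A : forall t k, csum (fun l => (a t l)^*%C * a t (k + l)%N) (A t k);
  sys_J : forall t, csum (fun l => a t l * (A t l)^*%C) (J t);
  sys_bound : forall T, exists M, forall t, `|t| <= T -> forall n,
    \sum_(0 <= k < n) weight s k * normc (a t k) ^+ 2 <= M }.

(** The near-covering form of compactness of $[-T, T]$, applied with the bound
    as the parameter that tends to infinity. *)
Lemma locally_bounded_compact (P : R -> R -> Prop) (T : R) :
  (forall t M M', P t M -> M <= M' -> P t M') ->
  (forall t : R, exists M, \forall t' \near t, P t' M) ->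
  exists M, forall t, `|t| <= T -> P t M.
Proof.
move=> Pmono Ploc.
have cK : @compact R [set` `[-T, T]] by exact: segment_compact.
have H := (@compact_near_coveringP R [set` `[-T, T]]).1 cK R (pinfty_nbhs R)
  (fun M t => P t M) _.
case: H => [x _|M [_ hM]].
  have [M hM] := Ploc x.
  near=> t' M' => /=.
  apply: (Pmono _ M); first by near: t'.
  by near: M'; apply: nbhs_pinfty_ge; exact: num_real.
exists (M + 1) => t tT; apply: (hM (M + 1)); first by rewrite ltrDl.
by rewrite /= in_itv/= -ler_norml.
Unshelve. all: by end_near. Qed.

(** Testing the projection against $e^{ikx}$, $k \geq 0$, shows that it has the
    same coefficients as the squared modulus; compactness of $[-T, T]$ makes
    the $H^s$ bounds locally uniform in time. *)
Lemma is_solution_system s u u0 : 2^-1 < s -> is_solution s u u0 ->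
  exists v J A, szego_system s (fun t k => fourier (u t) k%:Z) v J A /\
    forall t, [/\ L2plus (u t), J t = Jfun (u t) & A t 0%N = mass (u t)].
Proof.
move=> s2 [_ [U [U0 Uplus Uderiv] Ueq]]; subst u.
have s0 : 0 <= s by lra.
have UL n t : L2plus (U n t) by case: (Uplus n t).
have Ubound n t : exists M, forall m,
    \sum_(0 <= k < m) weight s k * normc (fourier (U n t) k%:Z) ^+ 2 <= M.
  have [[_ foo] _] := Uplus n t.
  have [N N0 NE] := Hs_norm_lty_bound (UL n t) foo.
  by exists (N ^+ 2); apply: (Hs_norm_partial (UL n t) N0); rewrite NE.
have [Z Z0 hZ] := weighted_summable s2.
have exp t : exists B, is_expansion (U 0%N t) (fun l => fourier (U 0%N t) l%:Z) B.
  have [M hM] := Ubound 0%N t; exists (M + Z).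
  by apply: L2plus_expansion => //; exact: hZ.
exists (fun t k => fourier (U 1%N t) k%:Z), (fun t => Jfun (U 0%N t)),
  (fun t k => fourier (fun x => `|U 0%N t x| ^+ 2) k%:Z).
split; last first.
  by move=> t; have [B hB] := exp t; split => //; rewrite mass_fourier.
split.
- by move=> t k; apply: (@fourier_cderiv _ s) => //; exact: Uderiv.
- move=> t k; have [B hB] := exp t.
  have [p [fL pL hp] heq] := Ueq t.
  have UL2 : L2 (U 0%N t) by case: (UL 0%N t).
  have vL2 : L2 (U 1%N t) by case: (UL 1%N t).
  have pL2 : L2 p by case: pL.
  have sqi : cintegrable (fun x => U 0%N t x ^+ 2).
    by under eq_fun do rewrite expr2; exact: cintegrable_L2M.
  have pE : fourier p k%:Z = fourier (fun x => `|U 0%N t x| ^+ 2) k%:Z.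
    have := hp _ (L2plus_expi _ k); rewrite -/(fourier _ _).
    under [X in fourier X]eq_fun do rewrite -mulN1r.
    have fi := cintegrable_L2 fL; have pi := cintegrable_L2 pL2.
    rewrite fourierD ?fourierZ//; last exact: cintegrableZ.
    by rewrite mulN1r => /eqP; rewrite subr_eq0 => /eqP.
  have vi := cintegrable_L2 vL2; have pi := cintegrable_L2 pL2.
  have Jpi := cintegrableZ (2 * Jfun (U 0%N t)) pi.
  have Jsi := cintegrableZ (Jfun (U 0%N t))^*%C sqi.
  rewrite -fourierZ// (eq_torus_fourier _ _ _ heq).
  + by rewrite fourierD// !fourierZ// pE (fourier_sqr hB).
  + by apply: cintegrable_measurable; exact: cintegrableZ.
  + by apply: cintegrable_measurable; exact: cintegrableD.

- by move=> t k; have [B hB] := exp t; exact: (csum_fourier_normc_sqr hB).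
- by move=> t; have [B hB] := exp t; exact: (csum_Jfun hB).
- move=> T; apply: (@locally_bounded_compact (fun t M => forall n,
    \sum_(0 <= k < n) weight s k * normc (fourier (U 0%N t) k) ^+ 2 <= M)).
    by move=> t M M' h MM n; exact: le_trans (h n) MM.
  move=> t; have [M0 h0] := Ubound 0%N t; have [M1 h1] := Ubound 1%N t.
  exists (3 * (M0 + M1 + 1)); apply: Hs_locally_bounded h0 h1 => //.
Qed.

Section system.
Variables (s : R) (a v : R -> nat -> R[i]) (J : R -> R[i]) (A : R -> nat -> R[i]).
Hypotheses (s2 : 2^-1 < s) (sys : szego_system s a v J A).

Lemma sys_l1_bound T : exists2 B, 0 <= B & forall t, `|t| <= T -> forall n,
  \sum_(0 <= k < n) normc (a t k) <= B.
Proof.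
have [Z Z0 hZ] := weighted_summable s2; have [M hM] := sys_bound sys T.
exists (`|M| + Z); first by rewrite addr_ge0.
move=> t tT n; apply: le_trans (hZ _ _ (hM t tT) n) _.
by rewrite lerD2r ler_norm.
Qed.

(** Young's inequality: the correlation of two summable sequences is
    summable. *)
Lemma sys_A_bound T : exists2 B, 0 <= B & forall t, `|t| <= T -> forall n,
  \sum_(0 <= k < n) normc (A t k) <= B.
Proof.
have [B B0 hB] := sys_l1_bound T; exists (B * B); first exact: mulr_ge0.
move=> t tT n; apply: (csum_normc_le (sys_A sys t)) => m.
rewrite exchange_big/=; under eq_bigr do under eq_bigr do rewrite normcM normc_conj.
under eq_bigr do rewrite -mulr_sumr.
apply: (@le_trans _ _ (\sum_(0 <= l < m) normc (a t l) * B)); last first.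
  by rewrite -mulr_suml ler_wpM2r// hB.
apply: ler_sum => l _; rewrite ler_wpM2l ?normc_ge0//.
apply: le_trans (hB t tT (n + l)%N).
rewrite (big_cat_nat _ (leq_addl n l))//= -[leLHS]add0r lerD//.
  by apply: sumr_ge0 => k _; exact: normc_ge0.
by rewrite -{2}[l]add0n big_addn addnK.
Qed.

End system.
End SzegoSystem.

(** * Gronwall's lemma for summable sequences *)

Section Gronwall.
Variable R : realType.
Implicit Types (y z : R -> nat -> R[i]).

Lemma cderiv_opp (f : R -> R[i]) t v : cderiv f (- t) v ->
  cderiv (fun x => f (- x)) t (- v).
Proof.
have key (g : R -> R) (l : R) : is_derive (- t) (1 : R) g l ->
    is_derive t (1 : R) (fun x => g (- x)) (- l).
  move=> gl; have h := @is_derive1_comp _ g (fun x => - x) t _ _ gl (is_deriveN (is_derive_id t (1 : R))).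
  by apply: is_derive_eq; rewrite mulrN1.
by move=> [f1 f2]; split; rewrite cReImE; apply: key.
Qed.

Lemma phase_exists (z : R[i]) : exists2 w : R[i], normc w <= 1 & w * z = (normc z)%:C.
Proof.
have [->|z0] := eqVneq z 0.
  by exists 0; rewrite ?normc0 ?mul0r.
have n0 : (normc z)%:C != 0 :> R[i].
  rewrite eq_complex/= eqxx andbT; apply/eqP => /eq0_normc /eqP; exact/negP.
exists (z^*%C / (normc z)%:C).
  by rewrite normcM normcV normc_conj /= expr0n addr0 sqrtr_sqr ger0_norm ?normc_ge0// mulfV//;
    move: n0; rewrite eq_complex/= eqxx andbT.
have e : z^*%C * z = (normc z)%:C * (normc z)%:C by rewrite mulrC mulcJ expr2 rmorphM.
by rewrite mulrAC e mulfK.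
Qed.

(** Gronwall's lemma in $\ell^1$. The norm at time [t] is tested against
    fixed phases, which reduces the step to finitely many real functions; the
    bound is halved at each step with respect to the weight $e^{2C(t - t_0)}$. *)
Lemma gronwall_l1 y z t0 T (B C : R) :
  (forall t k, cderiv (y ^~ k) t (z t k)) ->
  (forall t, t0 <= t <= T -> forall K, \sum_(0 <= k < K) normc (y t k) <= B) ->
  (forall t, t0 <= t <= T -> forall N,
    (forall K, \sum_(0 <= k < K) normc (y t k) <= N) ->
    forall K, \sum_(0 <= k < K) normc (z t k) <= C * N) ->
  (forall k, y t0 k = 0) ->
  forall t, t0 <= t <= T -> forall k, y t k = 0.
Proof.
move=> yz yB zC y0.
wlog C0 : C zC / 0 < C.
  move=> H; apply: (H (`|C| + 1)); last by rewrite ltr_wpDl.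
  move=> t tT N yN K; apply: le_trans (zC t tT N yN K) _.
  have N0 : 0 <= N by have := yN 0%N; rewrite big_nil.
  by rewrite ler_wpM2r// (le_trans (ler_norm C))// lerDl.
pose e t := expR (2 * C * (t - t0)).
have step M : (forall t, t0 <= t <= T -> forall K, \sum_(0 <= k < K) normc (y t k) <= M * e t) ->
    forall t, t0 <= t <= T -> forall K, \sum_(0 <= k < K) normc (y t k) <= M / 2 * e t.
  move=> H t /andP[t0t tT] K.
  have M0 : 0 <= M.
    have /H/(_ 0%N) : t0 <= t0 <= T by rewrite lexx (le_trans t0t).
    by rewrite big_nil /e subrr mulr0 expR0 mulr1.
  have [->|tne] := eqVneq t t0.
    rewrite big1_seq ?mulr_ge0 ?invr_ge0 ?expR_ge0// => k _.
    by rewrite y0 normc0.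
  have t0lt : t0 < t by rewrite lt_neqAle eq_sym tne.
  have /choice[w wP] : forall k, exists w : R[i], normc w <= 1 /\ w * y t k = (normc (y t k))%:C.
    by move=> k; have [w w1 w2] := phase_exists (y t k); exists w.
  pose phi x := complex.Re (\sum_(0 <= k < K) w k * y x k).
  pose dphi x := complex.Re (\sum_(0 <= k < K) w k * z x k).
  have phi' x : is_derive x (1 : R) phi (dphi x).
    have [] := @cderiv_sum _ _ (index_iota 0 K) (fun k x => w k * y x k) x
      (fun k => w k * z x k) _ => // k; exact: cderivZ.
  pose psi x := M / 2 * e x - phi x.
  have e' x : is_derive x (1 : R) e (2 * C * e x).
    rewrite /e; apply: is_derive_eq.
    by rewrite /GRing.scale/= subr0 !mulr1 mulrC.
  have psi' x : is_derive x (1 : R) psi (M / 2 * (2 * C * e x) - dphi x).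
    by rewrite /psi; apply: is_derive_eq.
  have psic : {within `[t0, t], continuous psi}.
    apply: continuous_subspaceT => x; apply: differentiable_continuous.
    by apply/derivable1_diffP; exact: ex_derive.
  have [c] := MVT t0lt (fun x _ => psi' x) psic.
  rewrite in_itv/= => /andP[c1 c2] psiE.
  have cT : t0 <= c <= T by rewrite (ltW c1) (le_trans (ltW c2)).
  have dphi_le : dphi c <= C * (M * e c).
    apply: le_trans (ler_norm _) _; apply: le_trans (Re_le_normc _) _.
    apply: le_trans (ler_normc_sum _ _ _) _.
    apply: le_trans (zC c cT _ (H c cT) K); apply: ler_sum => k _.
    by rewrite normcM ler_piMl ?normc_ge0//; case: (wP k).
  have : 0 <= psi t - psi t0.
    rewrite psiE mulr_ge0 ?subr_ge0 ?(ltW t0lt)//; lra.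
  have phi0 : phi t0 = 0.
    by rewrite /phi big1_seq// => k _; rewrite y0 mulr0.
  have phit : phi t = \sum_(0 <= k < K) normc (y t k).
    rewrite /phi; under eq_bigr do rewrite (wP _).2.
    by rewrite cRe_sum.
  rewrite /psi phi0 phit subr0 /e subrr mulr0 expR0 mulr1; lra.
have all n t : t0 <= t <= T -> forall K, \sum_(0 <= k < K) normc (y t k) <= B / 2 ^+ n * e t.
  elim: n t => [|n IH] t tT K.
    apply: le_trans (yB t tT K) _; rewrite expr0 divr1 ler_peMr//.
      by have := yB t tT 0%N; rewrite big_nil.
    rewrite -expR0 ler_expR !mulr_ge0 ?(ltW C0)// subr_ge0.
    by case/andP: tT.
  by rewrite exprSr invfM mulrA; apply: step.
move=> t tT k; apply: eq0_normc; apply/eqP; rewrite eq_le normc_ge0 andbT.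
have h n : normc (y t k) <= B * e t * (2^-1) ^+ n.
  have := all n t tT k.+1; rewrite big_nat_recr//= => h.
  rewrite exprVn mulrAC; apply: le_trans h; rewrite lerDr.
  by apply: sumr_ge0 => j _; exact: normc_ge0.
have l : B * e t * (2^-1) ^+ n @[n --> \oo] --> B * e t * (0 : R).
  apply: cvgM; first exact: cvg_cst.
  by apply: cvg_expr; rewrite ger0_norm ?invr_ge0// invf_lt1// ltr1n.
rewrite mulr0 in l.
by apply: (cvgr_to_ge l); apply: nearW.
Qed.

(** Times before [t0] are reached by reversing the direction of time. *)
Lemma gronwall_l1_global y z t0 (B C : R -> R) :
  (forall t k, cderiv (y ^~ k) t (z t k)) ->
  (forall T t, `|t| <= T -> forall K, \sum_(0 <= k < K) normc (y t k) <= B T) ->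
  (forall T t, `|t| <= T -> forall N,
    (forall K, \sum_(0 <= k < K) normc (y t k) <= N) ->
    forall K, \sum_(0 <= k < K) normc (z t k) <= C T * N) ->
  (forall k, y t0 k = 0) -> forall t k, y t k = 0.
Proof.
move=> yz yB zC y0 t k.
have [t0t|tt0] := leP t0 t.
  have bd x : t0 <= x <= t -> `|x| <= `|t0| + `|t|.
    move=> /andP[h1 h2]; rewrite ler_norml.
    have := ler_norm t; have := ler_norm (- t0); rewrite normrN.
    have := normr_ge0 t; have := normr_ge0 t0; move=> *; apply/andP; split; lra.
  apply: (@gronwall_l1 y z t0 t (B (`|t0| + `|t|)) (C (`|t0| + `|t|))) => //; last first.
  - by rewrite t0t lexx.
  - by move=> x /bd xT; exact: (zC _ _ xT).
  - by move=> x /bd xT; exact: (yB _ _ xT).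
have bd x : - t0 <= x <= - t -> `|- x| <= `|t0| + `|t|.
  move=> /andP[h1 h2]; rewrite ler_norml.
  have := ler_norm t0; have := ler_norm (- t); rewrite normrN.
  have := normr_ge0 t; have := normr_ge0 t0; move=> *; apply/andP; split; lra.
have := @gronwall_l1 (fun x => y (- x)) (fun x k => - z (- x) k) (- t0) (- t)
  (B (`|t0| + `|t|)) (C (`|t0| + `|t|)) _ _ _ _ (- t) _ k.
rewrite !opprK; apply => //.
- by move=> x j; exact: (@cderiv_opp (y ^~ j) x _ (yz (- x) j)).
- by move=> x /bd xT; exact: (yB _ _ xT).
- move=> x /bd xT N yN K; under eq_bigr do rewrite normcN.
  exact: (zC _ _ xT).
- by rewrite lexx andbT lerN2 ltW.
Qed.
End Gronwall.

(** * Continuity of the coefficient J *)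

Section RankOne.
Variable R : realType.

(** Locally uniform smallness of the tails reduces the continuity of the sum to
    that of a partial sum. *)
Lemma ccvg_csum_uniform (x : R -> nat -> R[i]) (S : R -> R[i]) (t0 : R) :
  (forall t, csum (x t) (S t)) -> (forall l, ccvg (nbhs t0) (x ^~ l) (x t0 l)) ->
  (forall e, 0 < e -> exists n, \forall t \near t0, forall m,
     \sum_(n <= l < n + m) normc (x t l) <= e) ->
  ccvg (nbhs t0) S (S t0).
Proof.
move=> xS xc xu; apply: ccvg_normc0; apply/cvgr0Pnorm_le => e e0.
have e3 : 0 < e / 3 by rewrite divr_gt0.
have [n hn] := xu _ e3.
have tail t : (forall m, \sum_(n <= l < n + m) normc (x t l) <= e / 3) ->
    normc (S t - \sum_(0 <= l < n) x t l) <= e / 3.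
  move=> h; have c : ccvg \oo (fun N => \sum_(0 <= l < N) x t l - \sum_(0 <= l < n) x t l)
      (S t - \sum_(0 <= l < n) x t l) by apply: ccvgB; [exact: xS|exact: ccvg_cst].
  apply: (cvgr_to_le (ccvg_normc c)); exists n => // N /= nN.
  rewrite (big_cat_nat _ nN)//= addrAC subrr add0r.
  by apply: le_trans (ler_normc_sum _ _ _) _; rewrite -(subnKC nN).
have P : ccvg (nbhs t0) (fun t => \sum_(0 <= l < n) x t l - \sum_(0 <= l < n) x t0 l)
    (\sum_(0 <= l < n) x t0 l - \sum_(0 <= l < n) x t0 l).
  by apply: ccvgB; [apply: ccvg_sum|exact: ccvg_cst].
have P0 := @ccvg_normc _ _ _ (nbhs_pfilter t0) _ _ P; rewrite subrr normc0 in P0.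
move/cvgrPdist_le/(_ _ e3) : P0 => P'.
have hn0 := nbhs_singleton hn.
near=> t; rewrite ger0_norm ?normc_ge0//.
have -> : S t - S t0 = (S t - \sum_(0 <= l < n) x t l) +
    ((\sum_(0 <= l < n) x t l - \sum_(0 <= l < n) x t0 l) +
     - (S t0 - \sum_(0 <= l < n) x t0 l)) by ring.
have t1 : normc (S t - \sum_(0 <= l < n) x t l) <= e / 3.
  by apply: tail; near: t.
have t2 : normc (S t0 - \sum_(0 <= l < n) x t0 l) <= e / 3 by exact: tail.
have t3 : normc (\sum_(0 <= l < n) x t l - \sum_(0 <= l < n) x t0 l) <= e / 3.
  rewrite -[leLHS]ger0_norm ?normc_ge0// -normrN -sub0r; near: t; exact: P'.
apply: le_trans (le_normcD _ _) _.
apply: le_trans (lerD t1 (le_trans (le_normcD _ _) (lerD t3 _))) _; first by rewrite normcN.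
lra.
Unshelve. all: by end_near. Qed.

Section system.
Variables (s : R) (a v : R -> nat -> R[i]) (J : R -> R[i]) (A : R -> nat -> R[i]).
Hypotheses (s2 : 2^-1 < s) (sys : szego_system s a v J A).

Let a_cont l t : ccvg (nbhs t) (a ^~ l) (a t l).
Proof. by have := cderiv_ccvg (sys_deriv sys t l). Qed.

(** The weights give the decay of the coefficients locally uniformly in time. *)
Let a_small T (e : R) : 0 < e -> exists n, forall t, `|t| <= T ->
  forall l, (n <= l)%N -> normc (a t l) <= e.
Proof.
move=> e0; have [M hM] := sys_bound sys T.
pose n := (Num.truncn (M / e ^+ 2)).+1.
exists n => t tT l nl.
have M0 : 0 <= M by have := hM t tT 0%N; rewrite big_nil.
have l1 : M / e ^+ 2 <= l%:R.
  by apply: le_trans (ltW (truncnS_gt _)) _; rewrite ler_nat.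
have wl : l%:R <= weight s l.
  apply: (@le_trans _ _ ((1 + l%:R ^+ 2) `^ 2^-1)).
    rewrite powR12_sqrt ?addr_ge0 ?sqr_ge0// -[leLHS]ger0_norm// -sqrtr_sqr.
    by rewrite ler_wsqrtr// lerDr.
  by apply: ler_powR; [rewrite lerDl sqr_ge0|exact: ltW].
have := hM t tT l.+1; rewrite big_nat_recr//= => h.
have h1 : weight s l * normc (a t l) ^+ 2 <= M.
  apply: le_trans h; rewrite lerDr; apply: sumr_ge0 => i _.
  by rewrite mulr_ge0 ?sqr_ge0// ltW// weight_gt0.
rewrite -(@ler_pXn2r _ 2)// ?nnegrE ?normc_ge0 ?(ltW e0)//.
have l0 : 0 < l%:R :> R by rewrite ltr0n; apply: leq_trans nl.
rewrite -(ler_pM2l l0); apply: le_trans (_ : M <= _).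
  by apply: le_trans h1; rewrite ler_wpM2r ?sqr_ge0.
by rewrite -ler_pdivrMr ?exprn_gt0.
Qed.

Let near_bounded (t0 : R) : \forall t \near t0, `|t| <= `|t0| + 1.
Proof.
near=> t; have : `|t0 - t| <= 1 by near: t; exact: cvgr_dist_le.
have := ler_normB t0 (t0 - t); rewrite opprB addrC subrK; lra.
Unshelve. all: by end_near. Qed.

Lemma sys_A_cont k t0 : ccvg (nbhs t0) (A ^~ k) (A t0 k).
Proof.
apply: (ccvg_csum_uniform (fun t => sys_A sys t k)).
  by move=> l; apply: ccvgM; [apply: ccvgJ|]; exact: a_cont.
move=> e e0; have [B B0 hB] := sys_l1_bound s2 sys (`|t0| + 1).
have B1 : 0 < B + 1 by rewrite ltr_wpDl.
have [n hn] := @a_small (`|t0| + 1) (e / (B + 1)) (divr_gt0 e0 B1).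
exists n; apply: filterS (near_bounded t0) => t tT m.
apply: (@le_trans _ _ (\sum_(n <= l < n + m) e / (B + 1) * normc (a t (k + l)%N))).
  apply: ler_sum_nat => l /andP[nl _].
  by rewrite normcM normc_conj ler_wpM2r ?normc_ge0// hn.
rewrite -mulr_sumr -mulrA ler_piMr ?(ltW e0)// mulrC ler_pdivrMr// mul1r.
apply: le_trans (_ : B <= _); last by rewrite lerDl.
apply: le_trans (hB t tT (n + m + k)%N).
rewrite (big_cat_nat _ (leq_addl (n + m) k))//= -[leLHS]add0r lerD//.
  by apply: sumr_ge0 => i _; exact: normc_ge0.
have -> : \sum_(k <= i < n + m + k) normc (a t i) =
    \sum_(0 <= i < n + m) normc (a t (i + k)%N).
  by rewrite -{1}[k]add0n big_addn addnK.
rewrite [leRHS](big_cat_nat _ (leq_addr m n))//=.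
rewrite -[leLHS]add0r lerD//; first by apply: sumr_ge0 => i _; exact: normc_ge0.
by apply: ler_sum => i _; rewrite addnC.
Qed.

(** Continuity of [J] is what allows the ratio of the geometric sequence to be
    defined as a primitive. *)
Lemma sys_J_cont t0 : ccvg (nbhs t0) J (J t0).
Proof.
apply: (ccvg_csum_uniform (sys_J sys)).
  by move=> l; apply: ccvgM; [|apply: ccvgJ]; [exact: a_cont|exact: sys_A_cont].
move=> e e0; have [B B0 hB] := sys_A_bound s2 sys (`|t0| + 1).
have B1 : 0 < B + 1 by rewrite ltr_wpDl.
have [n hn] := @a_small (`|t0| + 1) (e / (B + 1)) (divr_gt0 e0 B1).
exists n; apply: filterS (near_bounded t0) => t tT m.
apply: (@le_trans _ _ (\sum_(n <= l < n + m) e / (B + 1) * normc (A t l))).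
  apply: ler_sum_nat => l /andP[nl _].
  by rewrite normcM normc_conj ler_wpM2r ?normc_ge0// hn.
rewrite -mulr_sumr -mulrA ler_piMr ?(ltW e0)// mulrC ler_pdivrMr// mul1r.
apply: le_trans (_ : B <= _); last by rewrite lerDl.
apply: le_trans (hB t tT (n + m)%N).
rewrite [leRHS](big_cat_nat _ (leq_addr m n))//= -[leLHS]add0r lerD//.
by apply: sumr_ge0 => i _; exact: normc_ge0.
Qed.

Lemma sys_J_bound T : exists2 B, 0 <= B & forall t, `|t| <= T -> normc (J t) <= B.
Proof.
have [B B0 hB] := sys_l1_bound s2 sys T; have [B' B0' hB'] := sys_A_bound s2 sys T.
exists (B * B'); first exact: mulr_ge0.
move=> t tT; have := @csum_normc_le _ 1 (fun _ l => a t l * (A t l)^*%C) (fun=> J t) (B * B').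
rewrite big_nat1; apply; first by move=> _; exact: (sys_J sys).
move=> n; rewrite big_nat1.
apply: (@le_trans _ _ (\sum_(0 <= l < n) normc (a t l) * B')); last first.
  by rewrite -mulr_suml ler_wpM2r// hB.
apply: ler_sum => l _; rewrite normcM normc_conj ler_wpM2l ?normc_ge0//.
apply: le_trans (hB' t tT l.+1); rewrite big_nat_recr//= lerDr.
by apply: sumr_ge0 => j _; exact: normc_ge0.
Qed.

End system.
End RankOne.

(** * Uniqueness for the linearised equation *)

Section Primitive.
Variable R : realType.
Local Notation mu := (@lebesgue_measure R).

Lemma primitive_exists (f : R -> R) : continuous f ->
  exists F : R -> R, forall x : R, is_derive x (1 : R) F (f x).
Proof.
move=> cf; pose F T x := \int[mu]_(t in `[- T, x]) f t.
have fi a b : mu.-integrable `[a, b] (EFin \o f).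
  apply: continuous_compact_integrable; first exact: segment_compact.
  exact: continuous_subspaceT.
pose G x := if 0 <= x then \int[mu]_(t in `]0, x]) f t else - \int[mu]_(t in `]x, 0]) f t.
exists G => x; pose T : R := `|x| + 1.
have T0 : - T < 0 by rewrite oppr_lt0 ltr_wpDl.
have GE y : - T < y -> G y = F T y - F T 0.
  move=> Ty; rewrite /G /F; case: leP => y0.
    by rewrite Rintegral_itvB//= bnd_simp ltW.
  by rewrite -[RHS]opprB Rintegral_itvB//= bnd_simp ltW.
have xT : - T < x.
  by rewrite ltrNl (le_lt_trans (ler_norm _))// normrN ltrDl.
have [dF FE] : derivable (F T) x 1 /\ derive1 (F T) x = f x.
  by apply: (@continuous_FTC1_closed _ _ _ _ (x + 1)) => //; [rewrite ltrDl|exact: cf].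
have dG : is_derive x (1 : R) (fun y => F T y - F T 0) (f x).
  have h : is_derive x (1 : R) (F T) (f x) by apply: DeriveDef => //; rewrite -derive1E.
  by apply: is_derive_eq; rewrite subr0.
apply: (near_eq_is_derive _ dG).
near=> y; rewrite GE//; near: y; exact: lt_nbhsr.
Unshelve. all: by end_near. Qed.

Lemma cprimitive_exists (f : R -> R[i]) (z : R[i]) :
  (forall t, ccvg (nbhs t) f (f t)) ->
  exists F : R -> R[i], F 0 = z /\ forall t, cderiv F t (f t).
Proof.
move=> cf.
have [F1 h1] := @primitive_exists (fun x => complex.Re (f x)) (fun x => (cf x).1).
have [F2 h2] := @primitive_exists (fun x => complex.Im (f x)) (fun x => (cf x).2).
exists (fun t => (F1 t +i* F2 t) - (F1 0 +i* F2 0) + z); split.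
  by rewrite subrr add0r.
move=> t; have h : cderiv (fun t => F1 t +i* F2 t) t (f t) by split; [exact: h1|exact: h2].
apply: cderiv_eq (cderivD (cderivB h (cderiv_cst _ _)) (cderiv_cst _ _)) _.
by rewrite subr0 addr0.
Qed.
End Primitive.

Section RankOneSystem.
Variable R : realType.
Variables (s : R) (a v : R -> nat -> R[i]) (J : R -> R[i]) (A : R -> nat -> R[i]).
Hypotheses (s2 : 2^-1 < s) (sys : szego_system s a v J A).

Let convol_le (K : nat) (p q : nat -> R) N : (forall l, 0 <= p l) ->
  (forall n, \sum_(0 <= l < n) q l <= N) ->
  \sum_(0 <= k < K) \sum_(0 <= l < k) p l * q (k.-1 - l)%N <=
  (\sum_(0 <= l < K) p l) * N.
Proof.
move=> p0 qN; elim: K p p0 => [|K IH] p p0; first by rewrite !big_nil mul0r.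
rewrite big_nat_recl// big_nil add0r [X in X * N]big_nat_recl//= mulrDl.
under eq_bigr do rewrite big_nat_recl//= subn0.
rewrite big_split/= -mulr_sumr; apply: lerD; first by rewrite ler_wpM2l.
apply: le_trans (IH (fun l => p l.+1) (fun l => p0 l.+1)).
apply: ler_sum => k _; rewrite le_eqVlt; apply/orP; left; apply/eqP.
by rewrite big_nat_cond [RHS]big_nat_cond; apply: eq_bigr => l _; rewrite subnS -predn_sub.
Qed.

(** Both the shifted sequence $(a_{k+1})$ and its defect from being geometric
    solve this linear equation, whose operator is bounded on $\ell^1$. *)
Definition linearised (y z Y : R -> nat -> R[i]) :=
  [/\ forall t k, cderiv (y ^~ k) t (z t k),
      forall t k, csum (fun l => (a t l)^*%C * y t (k + l)%N) (Y t k) &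
      forall t k, 'i%C * z t k = 2 * J t * Y t k + (J t)^*%C *
        (2 * a t 0%N * y t k + \sum_(0 <= l < k) a t l.+1 * y t (k.-1 - l)%N)].

(** The right-hand side is bounded in $\ell^1$ by a multiple of [y], by Young's
    inequality, so that Gronwall's lemma applies. *)
Lemma linearised_unique y z Y t0 : linearised y z Y ->
  (forall T, exists B, forall t, `|t| <= T -> forall n, \sum_(0 <= k < n) normc (y t k) <= B) ->
  (forall k, y t0 k = 0) -> forall t k, y t k = 0.
Proof.
move=> [yz yY zE] /choice[By hBy] y0.
have /choice[C hC] : forall T, exists C, forall t, `|t| <= T -> forall N,
    (forall K, \sum_(0 <= k < K) normc (y t k) <= N) ->
    forall K, \sum_(0 <= k < K) normc (z t k) <= C * N.
  move=> T; have [B B0 hB] := sys_l1_bound s2 sys T.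
  have [j j0 hj] := sys_J_bound s2 sys T.
  exists (2 * j * B + j * (2 * B + B)) => t tT N yN K.
  have N0 : 0 <= N by have := yN 0%N; rewrite big_nil.
  have aB l : normc (a t l) <= B.
    apply: le_trans (hB t tT l.+1); rewrite big_nat_recr//= lerDr.
    by apply: sumr_ge0 => i _; exact: normc_ge0.
  have n2 : normc (2 : R[i]) = 2.
    by rewrite (_ : 2 = (2 : R)%:C) /= ?expr0n ?addr0 ?sqrtr_sqr ?ger0_norm// rmorphMn/= rmorph1.
  have zle k : normc (z t k) <= 2 * j * normc (Y t k) +
      j * (2 * B * normc (y t k) + \sum_(0 <= l < k) normc (a t l.+1) * normc (y t (k.-1 - l)%N)).
    have -> : normc (z t k) = normc ('i%C * z t k).
      by rewrite normcM /= expr0n expr1n add0r sqrtr1 mul1r.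
    rewrite zE; apply: le_trans (le_normcD _ _) _; apply: lerD.
      rewrite !normcM n2 ler_wpM2r ?normc_ge0// ler_wpM2l//; exact: hj.
    rewrite normcM normc_conj ler_pM ?normc_ge0 ?hj//.
    apply: le_trans (le_normcD _ _) _; apply: lerD.
      by rewrite !normcM n2 ler_wpM2r ?normc_ge0// ler_wpM2l.
    apply: le_trans (ler_normc_sum _ _ _) _.
    by apply: ler_sum => l _; rewrite normcM.
  apply: (@le_trans _ _ (\sum_(0 <= k < K) (2 * j * normc (Y t k) +
      j * (2 * B * normc (y t k) +
        \sum_(0 <= l < k) normc (a t l.+1) * normc (y t (k.-1 - l)%N))))).
    by apply: ler_sum => k _; exact: zle.
  rewrite big_split/= -!mulr_sumr big_split/= -mulr_sumr [leRHS]mulrDl.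
  apply: lerD.
    rewrite -mulrA ler_wpM2l ?mulr_ge0//.
    apply: (csum_normc_le (yY t)) => m; rewrite exchange_big/=.
    under eq_bigr do under eq_bigr do rewrite normcM normc_conj.
    under eq_bigr do rewrite -mulr_sumr.
    apply: (@le_trans _ _ (\sum_(0 <= l < m) normc (a t l) * N)); last first.
      by rewrite -mulr_suml ler_wpM2r// hB.
    apply: ler_sum => l _; rewrite ler_wpM2l ?normc_ge0//.
    apply: le_trans (yN (K + l)%N).
    rewrite [leRHS](big_cat_nat _ (leq_addl K l))//= -[leLHS]add0r lerD//.
      by apply: sumr_ge0 => k _; exact: normc_ge0.
    by rewrite -{2}[l]add0n big_addn addnK.
  rewrite -mulrA ler_wpM2l// [leRHS]mulrDl; apply: lerD; first by rewrite ler_wpM2l ?mulr_ge0.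
  apply: le_trans (convol_le K (fun l => normc_ge0 (a t l.+1)) yN) _.
  rewrite ler_wpM2r//; apply: le_trans (hB t tT K.+1).
  by rewrite [leRHS]big_nat_recl//= lerDr normc_ge0.
exact: (gronwall_l1_global yz hBy hC y0).
Qed.

End RankOneSystem.

(** * Invariance of L(1) *)

Section RankOneSolution.
Variable R : realType.

Lemma csum_geometric (z : R[i]) : normc z < 1 -> csum (fun l => z ^+ l) (1 - z)^-1.
Proof.
move=> z1; have z0 : 1 - z != 0.
  rewrite subr_eq0; apply/eqP => e; move: z1; rewrite -e normc1 ltxx//.
apply: ccvg_normc0.
have e n : normc (\sum_(0 <= l < n) z ^+ l - (1 - z)^-1) =
    normc (1 - z)^-1 * normc z ^+ n.
  have -> : \sum_(0 <= l < n) z ^+ l - (1 - z)^-1 = - ((1 - z)^-1 * z ^+ n).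
    rewrite big_mkord; have := subrX1 z n; rewrite -opprB -[in RHS]opprB mulNr => /oppr_inj h.
    by apply: (mulfI z0); rewrite mulrBr -h mulfV// mulrN mulrA mulfV// mul1r; ring.
  by rewrite normcN normcM normcX.
under eq_fun do rewrite e.
have h : normc (1 - z)^-1 * normc z ^+ n @[n --> \oo] --> normc (1 - z)^-1 * 0.
  apply: cvgM; first exact: cvg_cst.
  by apply: cvg_expr; rewrite ger0_norm ?normc_ge0.
by rewrite mulr0 in h.
Qed.

Lemma convol_split (x : nat -> R[i]) k :
  \sum_(0 <= l < k.+2) x l * x (k.+1 - l)%N =
  2 * x 0%N * x k.+1 + \sum_(0 <= l < k) x l.+1 * x (k - l)%N.
Proof.
rewrite big_nat_recl// big_nat_recr//= subn0 subnn.
under eq_bigr do rewrite subSS.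
by ring.
Qed.

Variables (s : R) (a v : R -> nat -> R[i]) (J : R -> R[i]) (A : R -> nat -> R[i]).
Hypotheses (s2 : 2^-1 < s) (sys : szego_system s a v J A).

Lemma linearised_shift : linearised a J (fun t k => a t k.+1) (fun t k => v t k.+1)
  (fun t k => A t k.+1).
Proof.
split.
- by move=> t k; exact: (sys_deriv sys t k.+1).
- by move=> t k; exact: (sys_A sys t k.+1).
- move=> t k; rewrite (sys_eq sys) convol_split; congr (_ + _ * (_ + _)).
  rewrite big_nat_cond [RHS]big_nat_cond; apply: eq_bigr => l /andP[/andP[_ lk] _].
  by congr (_ * a t _); lia.
Qed.

Lemma shift_bound T : exists B, forall t, `|t| <= T -> forall n,
  \sum_(0 <= k < n) normc (a t k.+1) <= B.
Proof.
have [B B0 hB] := sys_l1_bound s2 sys T; exists B => t tT n.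
apply: le_trans (hB t tT n.+1).
by rewrite [leRHS]big_nat_recl//= lerDr normc_ge0.
Qed.

Variables (c0 p0 : R[i]).
Hypotheses (c00 : c0 != 0) (init : forall k, a 0 k.+1 = c0 * p0 ^+ k).

(** If $a_{k+1} = c p^k$ with $c \neq 0$, then the equations for $a_1$ and $a_2$ force
    $p' = -i \bar J a_1$. Conversely, for [p] defined by this equation, the
    defect $a_{k+2} - p a_{k+1}$ solves the linearised equation and vanishes at
    time [0], hence always. *)
Lemma rank_one_propagates : exists p : R -> R[i],
  [/\ p 0 = p0, forall t, cderiv p t (- 'i%C * ((J t)^*%C * a t 1%N)) &
    forall t k, a t k.+1 = a t 1%N * p t ^+ k].
Proof.
have [p [pz p']] : exists F : R -> R[i], F 0 = p0 /\
    forall t, cderiv F t (- 'i%C * ((J t)^*%C * a t 1%N)).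
  apply: cprimitive_exists => t; apply: ccvgZ; apply: ccvgM.
    by apply: ccvgJ; exact: (sys_J_cont s2 sys).
  exact: cderiv_ccvg (sys_deriv sys t 1%N).
exists p; split => //.
have lin : linearised a J (fun t k => a t k.+2 - p t * a t k.+1)
   (fun t k => v t k.+2 - ((- 'i%C * ((J t)^*%C * a t 1%N)) * a t k.+1 + p t * v t k.+1))
   (fun t k => A t k.+2 - p t * A t k.+1).
  split.
  - move=> t k; apply: cderivB; first exact: (sys_deriv sys t k.+2).
    exact: (cderivM (p' t) (sys_deriv sys t k.+1)).
  - move=> t k; have h1 := sys_A sys t k.+2; have h2 := csumZ (- p t) (sys_A sys t k.+1).
    rewrite -mulNr; apply: eq_csum (csumD h1 h2) => l.
    by rewrite !addSn; ring.
  - move=> t k.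
    have e1 := sys_eq sys t k.+2; have e2 := sys_eq sys t k.+1.
    rewrite convol_split big_nat_recr//= in e1; rewrite convol_split in e2.
    have e3 : \sum_(0 <= l < k) a t l.+1 * (a t (k.-1 - l).+2 - p t * a t (k.-1 - l).+1) =
       \sum_(0 <= l < k) a t l.+1 * a t (k.+1 - l)%N - p t * \sum_(0 <= l < k) a t l.+1 * a t (k - l)%N.
      rewrite mulr_sumr -sumrB big_nat_cond [RHS]big_nat_cond.
      apply: eq_bigr => l /andP[/andP[_ lk] _].
      have -> : (k.-1 - l).+2 = (k.+1 - l)%N by lia.
      have -> : (k.-1 - l).+1 = (k - l)%N by lia.
      by ring.
    rewrite e3; move: e1; rewrite subSnn => e1.
    have -> : 'i%C * (v t k.+2 - (- 'i%C * ((J t)^*%C * a t 1%N) * a t k.+1 + p t * v t k.+1)) =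
       'i%C * v t k.+2 + 'i%C ^+ 2 * ((J t)^*%C * a t 1%N * a t k.+1) - p t * ('i%C * v t k.+1) by ring.
    by rewrite e1 e2 sqr_i; ring.
have bnd T : exists B, forall t, `|t| <= T -> forall n,
    \sum_(0 <= k < n) normc (a t k.+2 - p t * a t k.+1) <= B.
  have [B hB] := shift_bound T.
  have [M hM] : exists M, forall t, `|t| <= T -> normc (p t) <= M.
    apply: (@locally_bounded_compact _ (fun t M => normc (p t) <= M)).
      by move=> t M M'; exact: le_trans.
    move=> t; exists (normc (p t) + 1).
    have h := @ccvg_normc _ _ _ (nbhs_pfilter t) _ _ (cderiv_ccvg (p' t)).
    by move/cvgr_le : h; apply; rewrite ltrDl.
  exists (B + M * B) => t tT n.
  apply: (@le_trans _ _ (\sum_(0 <= k < n) normc (a t k.+2) + normc (p t) * \sum_(0 <= k < n) normc (a t k.+1))).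
    rewrite mulr_sumr -big_split; apply: ler_sum => k _.
    by apply: le_trans (le_normcD _ _) _; rewrite normcN normcM.
  apply: lerD.
    apply: le_trans (hB t tT n.+1).
    by rewrite [leRHS]big_nat_recl//= lerDr normc_ge0.
  apply: ler_pM => //; [exact: normc_ge0| |exact: hM|exact: hB].
  by apply: sumr_ge0 => i _; exact: normc_ge0.
have g0 k : a 0 k.+2 - p 0 * a 0 k.+1 = 0.
  by rewrite !init pz exprS; ring.
have g := linearised_unique s2 sys lin bnd g0.
move=> t; elim=> [|k IH]; first by rewrite expr0 mulr1.
have /eqP := g t k; rewrite subr_eq0 => /eqP ->.
by rewrite IH exprS; ring.
Qed.

(** If $a_1$ vanished at one time, then so would the whole shifted sequence,
    and by uniqueness it would vanish at time [0]. *)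
Lemma rank_one_neq0 t : a t 1%N != 0.
Proof.
have [p [_ _ ap]] := rank_one_propagates.
apply/eqP => c0t.
have z k : a t k.+1 = 0 by rewrite ap c0t mul0r.
have := linearised_unique s2 sys linearised_shift shift_bound z 0 0%N.
by rewrite init expr0 mulr1; apply/eqP.
Qed.

(** Summing geometric series turns the equations for the coefficients into an
    ordinary differential system for [b], [c] and [p]. The bound $|p| < 1$
    persists because the coefficients stay summable while $c \neq 0$. *)
Theorem rank_one_system : exists p : R -> R[i], p 0 = p0 /\ forall t,
  let b := a t 0%N in let c := a t 1%N in
  let r := 1 - p t * (p t)^*%C in
  [/\ forall k, a t k.+1 = c * p t ^+ k, c != 0, normc (p t) < 1,
      A t 0%N = b * b^*%C + c * c^*%C / r &
      J t = b * (b * b^*%C + c * c^*%C / r) + c / r * (b * c^*%C + c * c^*%C * (p t)^*%C / r)]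
  /\
  [/\ cderiv (a ^~ 0%N) t (- 'i%C * (2 * J t * A t 0%N + (J t)^*%C * b ^+ 2)),
      cderiv (a ^~ 1%N) t (- 'i%C * (2 * J t * (b^*%C * c + c * c^*%C * p t / r) +
         2 * (J t)^*%C * b * c)) &
      cderiv p t (- 'i%C * ((J t)^*%C * c))].
Proof.
have [p [pz p' ap]] := rank_one_propagates; exists p; split => // t b c r.
have c_neq0 : c != 0 := rank_one_neq0 t.
have p1 : normc (p t) < 1.
  rewrite ltNge; apply/negP => p1.
  have [B hB] := shift_bound `|t|.
  have cp : 0 < normc c.
    rewrite lt_neqAle normc_ge0 andbT eq_sym; apply/eqP => /eq0_normc /eqP; exact/negP.
  pose K := (Num.truncn (B / normc c)).+1.
  have : \sum_(0 <= k < K) normc c <= B.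
    apply: le_trans (hB t (lexx _) K); apply: ler_sum => k _.
    by rewrite ap normcM normcX ler_peMr ?normc_ge0// exprn_ege1.
  rewrite sumr_const_nat subn0 -mulr_natl -ler_pdivlMr// leNgt => /negP; apply.
  exact: truncnS_gt.
have q1 : normc (p t * (p t)^*%C) < 1.
  by rewrite normcM normc_conj mulr_ilt1 ?normc_ge0.
have r0 : r != 0.
  rewrite /r subr_eq0; apply/eqP => e; move: q1; rewrite -e normc1 ltxx//.
have geo := csum_geometric q1.
have A0 : A t 0%N = b * b^*%C + c * c^*%C / r.
  apply: (csum_unique (sys_A sys t 0%N)).
  rewrite [b * _]mulrC; apply: (@csumS _ (fun l => (a t l)^*%C * a t (0 + l)%N)).
  apply: eq_csum (csumZ (c * c^*%C) geo) => l.
  by rewrite add0n ap conjcM conjcX exprMn -/c; ring.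
have AS k : A t k.+1 = p t ^+ k * (b^*%C * c + c * c^*%C * p t / r).
  apply: (csum_unique (sys_A sys t k.+1)).
  have -> : p t ^+ k * (b^*%C * c + c * c^*%C * p t / r) =
      (a t 0%N)^*%C * a t (k.+1 + 0)%N + (p t ^+ k.+1 * (c * c^*%C)) * r^-1.
    by rewrite addn0 ap exprS -/b -/c; field.
  apply: (@csumS _ (fun l => (a t l)^*%C * a t (k.+1 + l)%N)).
  apply: eq_csum (csumZ (p t ^+ k.+1 * (c * c^*%C)) geo) => l.
  by rewrite addSn (ap t l) (ap t (k + l.+1)%N) conjcM conjcX exprMn addnS !exprS exprD -/c; ring.
have JE : J t = b * (b * b^*%C + c * c^*%C / r) + c / r * (b * c^*%C + c * c^*%C * (p t)^*%C / r).
  apply: (csum_unique (sys_J sys t)).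
  have rJ : r^*%C = r by rewrite /r conjcD conjcN conjcM conjcK conjc1 mulrC.
  have -> : b * (b * b^*%C + c * c^*%C / r) + c / r * (b * c^*%C + c * c^*%C * (p t)^*%C / r) =
      a t 0%N * (A t 0%N)^*%C + (c * (b * c^*%C + c * c^*%C * (p t)^*%C / r)) * r^-1.
    rewrite A0 conjcD !conjcM !conjcK conjc_inv rJ -/b; field.
    exact: r0.
  apply: (@csumS _ (fun l => a t l * (A t l)^*%C)).
  apply: eq_csum (csumZ (c * (b * c^*%C + c * c^*%C * (p t)^*%C / r)) geo) => l.
  rewrite AS ap !(conjcM, conjcD, conjcX, conjcK) conjc_inv rJ exprMn -/c; field.
  exact: r0.
have mi x : x = - 'i%C * ('i%C * x) :> R[i].
  by rewrite mulrA mulNr -expr2 sqr_i opprK mul1r.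
split; split => //.
- apply: cderiv_eq (sys_deriv sys t 0%N) _.
  by rewrite [LHS]mi (sys_eq sys) big_nat1 subn0 -expr2.
- apply: cderiv_eq (sys_deriv sys t 1%N) _.
  rewrite [LHS]mi (sys_eq sys) convol_split big_nil AS expr0 -/b -/c; ring.
Qed.

End RankOneSolution.

(** * Conserved quantities of the finite-dimensional system *)

Section MoreDerivatives.
Variable R : realType.

Lemma cderiv_real (g : R -> R) (t dg : R) : is_derive t (1 : R) g dg ->
  cderiv (fun x => (g x)%:C) t dg%:C.
Proof. by move=> gd; split => //=; exact: is_derive_cst. Qed.

Lemma cderivV (f : R -> R[i]) t v : (forall x, f x != 0) -> cderiv f t v ->
  cderiv (fun x => (f x)^-1) t (- v / f t ^+ 2).
Proof.
move=> f0 fv; have [f1 f2] := fv.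
pose n x := complex.Re (f x) ^+ 2 + complex.Im (f x) ^+ 2.
have n0 x : n x != 0.
  rewrite /n -normc_sqr expf_neq0//; apply/eqP => /eq0_normc /eqP; apply/negP; exact: f0.
have fV x : (f x)^-1 = (f x)^*%C * ((n x)^-1)%:C.
  apply: (mulfI (f0 x)); rewrite mulfV// mulrA mulcJ normc_sqr -/(n x).
  by rewrite fmorphV mulfV//; apply/eqP => -[/eqP]; apply/negP.
have dn : exists dn, is_derive t (1 : R) n dn.
  by eexists; rewrite /n; exact: is_deriveD.
have [dn' hn] := dn.
have dV : is_derive t (1 : R) (fun x => (n x)^-1) (- (n t) ^- 2 *: dn').
  exact: is_deriveV.
have h := cderivM (cderivJ fv) (cderiv_real dV).
have {}h : exists w, cderiv (fun x => (f x)^-1) t w.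
  by eexists; under eq_fun do rewrite fV; exact: h.
have [w hw] := h.
(* the value is forced by $f \cdot f^{-1} = 1$ *)
have h1 := cderivM fv hw.
have h2 : cderiv (fun x => f x * (f x)^-1) t 0.
  by under eq_fun do rewrite mulfV//; exact: cderiv_cst.
have uniq (g : R -> R[i]) x y : cderiv g t x -> cderiv g t y -> x = y.
  move=> [g1 g2] [g3 g4]; apply: complexP.
    by rewrite -(@derive_val _ _ _ _ _ _ _ g1) -(@derive_val _ _ _ _ _ _ _ g3).
  by rewrite -(@derive_val _ _ _ _ _ _ _ g2) -(@derive_val _ _ _ _ _ _ _ g4).
apply: cderiv_eq hw _; have e := uniq _ _ _ h1 h2.
apply: (mulfI (f0 t)); move/eqP: e; rewrite addr_eq0 => /eqP e.
by rewrite -[LHS]opprK -e; field; exact: f0.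
Qed.

End MoreDerivatives.

(** Here $\bar b, \bar c, \bar p, \bar J$ are replaced with independent functions
    [b_], [c_], [p_], [J_], so that every identity below is one between rational
    functions. Only [xi] and [eta], conjugate to each other, enter the equation
    for the radius [r]. *)
Section Integrals.
Variable R : realType.
Local Notation I := ('i%C : R[i]).
Variables b b_ c c_ p p_ : R -> R[i].
Variables r Q M J J_ : R -> R[i].
Hypothesis rE : forall t, r t = 1 - p t * p_ t.
Hypothesis QE : forall t, Q t = b t * b_ t + c t * c_ t / r t.
Hypothesis ME : forall t, M t = c t * c_ t / r t ^+ 2.
Hypothesis JE : forall t,
  J t = b t * Q t + c t / r t * (b t * c_ t + c t * c_ t * p_ t / r t).
Hypothesis JE_ : forall t,
  J_ t = b_ t * Q t + c_ t / r t * (b_ t * c t + c_ t * c t * p t / r t).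
Hypothesis r0 : forall t, r t != 0.
Hypothesis db : forall t, cderiv b t (- I * (2 * J t * Q t + J_ t * b t ^+ 2)).
Hypothesis db_ : forall t, cderiv b_ t (I * (2 * J_ t * Q t + J t * b_ t ^+ 2)).
Hypothesis dc : forall t, cderiv c t (- I * (2 * J t * (b_ t * c t + c t * c_ t * p t / r t) +
  2 * J_ t * b t * c t)).
Hypothesis dc_ : forall t, cderiv c_ t (I * (2 * J_ t * (b t * c_ t + c_ t * c t * p_ t / r t) +
  2 * J t * b_ t * c_ t)).
Hypothesis dp : forall t, cderiv p t (- I * (J_ t * c t)).
Hypothesis dp_ : forall t, cderiv p_ t (I * (J t * c_ t)).

Let xi t := J_ t * (c t * p_ t).
Let eta t := J t * (c_ t * p t).

Lemma deriv_r t : cderiv r t (I * (xi t - eta t)).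
Proof.
have -> : r = (fun t => 1 - p t * p_ t) by apply/funext.
apply: cderiv_eq (cderivB (cderiv_cst 1 t) (cderivM (dp t) (dp_ t))) _.
by rewrite /xi /eta; ring.
Qed.

Lemma deriv_rV t : cderiv (fun t => (r t)^-1) t (- (I * (xi t - eta t)) / r t ^+ 2).
Proof. exact: cderivV (deriv_r t). Qed.

Lemma M_cst t : M t = M 0.
Proof.
apply: cderiv0_cst => {}t.
have -> : M = (fun t => c t * c_ t * ((r t)^-1 * (r t)^-1)).
  by apply/funext => u; rewrite ME expr2 invfM.
apply: cderiv_eq (cderivM (cderivM (dc t) (dc_ t)) (cderivM (deriv_rV t) (deriv_rV t))) _.
rewrite /xi /eta; have := r0 t; rewrite !rE; move: (J t) (J_ t) => j j_ h.
by field.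
Qed.

Lemma Q_cst t : Q t = Q 0.
Proof.
apply: cderiv0_cst => {}t.
have -> : Q = (fun t => b t * b_ t + c t * c_ t / r t) by apply/funext.
apply: cderiv_eq (cderivD (cderivM (db t) (db_ t)) (cderivM (cderivM (dc t) (dc_ t)) (deriv_rV t))) _.
rewrite /xi /eta !JE !JE_ !QE; have := r0 t; rewrite !rE => h.
by field.
Qed.

(** With [M] and [Q] constant, [J] is a polynomial in the parameters, which keeps
    its derivative manageable. *)
Lemma J_alt t : J t = b t * (Q 0 + M 0 * r t) + M 0 * (c t * p_ t).
Proof. by rewrite -(Q_cst t) -(M_cst t) JE ME; field; exact: r0. Qed.

Lemma J_alt_ t : J_ t = b_ t * (Q 0 + M 0 * r t) + M 0 * (c_ t * p t).
Proof. by rewrite -(Q_cst t) -(M_cst t) JE_ ME; field; exact: r0. Qed.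

Let lam t := - Q 0 ^+ 2 + 2 * Q 0 * M 0 * r t + 2 * M 0 ^+ 2 * r t +
  2 * (J t * b_ t + J_ t * b t).

(** The factor [lam] is invariant under conjugation, which is why $|J|$ is
    conserved. *)
Lemma deriv_J t : cderiv J t (- I * (lam t * J t)).
Proof.
have JF : J = (fun t => b t * (Q 0 + M 0 * r t) + M 0 * (c t * p_ t)).
  by apply/funext => u; exact: J_alt.
have h := cderivD (cderivM (db t) (cderivD (cderiv_cst (Q 0) t) (cderivZ (M 0) (deriv_r t))))
  (cderivZ (M 0) (cderivM (dc t) (dp_ t))).
rewrite {1}JF; apply: cderiv_eq h _.
rewrite /lam -!(Q_cst t) -!(M_cst t) /xi /eta !JE !JE_ !QE !ME.
by have := r0 t; rewrite !rE => h; field.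
Qed.

Lemma deriv_J_ t : cderiv J_ t (I * (lam t * J_ t)).
Proof.
have JF : J_ = (fun t => b_ t * (Q 0 + M 0 * r t) + M 0 * (c_ t * p t)).
  by apply/funext => u; exact: J_alt_.
have h := cderivD (cderivM (db_ t) (cderivD (cderiv_cst (Q 0) t) (cderivZ (M 0) (deriv_r t))))
  (cderivZ (M 0) (cderivM (dc_ t) (dp t))).
rewrite {1}JF; apply: cderiv_eq h _.
rewrite /lam -!(Q_cst t) -!(M_cst t) /xi /eta !JE !JE_ !QE !ME.
by have := r0 t; rewrite !rE => h; field.
Qed.

Let N t := J t * J_ t.

Lemma N_cst t : N t = N 0.
Proof.
apply: cderiv0_cst => {}t.
by apply: cderiv_eq (cderivM (deriv_J t) (deriv_J_ t)) _; ring.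
Qed.

Lemma xi_eta_mul t : xi t * eta t = N 0 * (M 0 * r t ^+ 2 * (1 - r t)).
Proof.
rewrite -(N_cst t) -(M_cst t) /xi /eta /N ME; move: (J t) (J_ t) => j j_.
by have := r0 t; rewrite !rE => h; field.
Qed.

Lemma xi_eta_add t : M 0 * (xi t + eta t) =
  N 0 - Q 0 ^+ 3 - Q 0 ^+ 2 * M 0 * r t + M 0 ^+ 2 * (M 0 + Q 0) * r t ^+ 2.
Proof.
rewrite -(N_cst t) /xi /eta /N -!(M_cst t) -!(Q_cst t) !JE !JE_ !QE !ME.
by have := r0 t; rewrite !rE => h; field.
Qed.

Lemma deriv_deriv_r t : cderiv (fun t => I * (xi t - eta t)) t
  ((xi t + eta t) * (Q 0 ^+ 2 - 2 * M 0 * (Q 0 + M 0) * r t) +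
   2 * N 0 * M 0 * (2 * r t - 3 * r t ^+ 2)).
Proof.
have h := cderivZ I (cderivB (cderivM (deriv_J_ t) (cderivM (dc t) (dp_ t)))
  (cderivM (deriv_J t) (cderivM (dc_ t) (dp t)))).
apply: cderiv_eq h _.
have i2 : I * I = -1 by rewrite -expr2 sqr_i.
set C1 := 2 * J t * _ + _; set C2 := 2 * J_ t * _ + _.
transitivity (I * I * (lam t * J_ t * (c t * p_ t) + J_ t * (- C1 * p_ t + c t * (J t * c_ t)) -
  (- (lam t * J t * (c_ t * p t)) + J t * (C2 * p t - c_ t * (J_ t * c t))))).
  by rewrite /xi /eta; ring.
rewrite i2 /lam /C1 /C2 -!(N_cst t) -!(Q_cst t) -!(M_cst t) /xi /eta /N !QE !ME.
by have := r0 t; rewrite !rE => r0t; move: (J t) (J_ t) => j j_; field.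
Qed.

(** Since $(\xi - \eta)^2 = (\xi + \eta)^2 - 4 \xi \eta$, the square of $r'$ is a
    polynomial in [r] whose coefficients are conserved. *)
Theorem rank_one_integrals t :
  [/\ Q t = Q 0, M t = M 0 & J t * J_ t = J 0 * J_ 0] /\
  [/\ cderiv r t (I * (xi t - eta t)),
      xi t * eta t = J 0 * J_ 0 * (M 0 * r t ^+ 2 * (1 - r t)),
      M 0 * (xi t + eta t) = J 0 * J_ 0 - Q 0 ^+ 3 - Q 0 ^+ 2 * M 0 * r t +
        M 0 ^+ 2 * (M 0 + Q 0) * r t ^+ 2 &
      cderiv (fun t => I * (xi t - eta t)) t
        ((xi t + eta t) * (Q 0 ^+ 2 - 2 * M 0 * (Q 0 + M 0) * r t) +
         2 * (J 0 * J_ 0) * M 0 * (2 * r t - 3 * r t ^+ 2))].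
Proof.
split; split; [exact: Q_cst|exact: M_cst|exact: N_cst|exact: deriv_r|
  exact: xi_eta_mul|exact: xi_eta_add|exact: deriv_deriv_r].
Qed.

End Integrals.

(** * The equation for the radius *)

Section RealODE.
Variable R : realType.

Lemma is_derive_exp_growth (f : R -> R) (k : R) :
  (forall t : R, is_derive t (1 : R) f (k * f t)) ->
  forall t, f t = f 0 * expR (k * t).
Proof.
move=> f' t; pose h x := f x * expR (- (k * x)).
have h' (x : R) : is_derive x (1 : R) h 0.
  rewrite /h; have fx := f' x; apply: is_derive_eq.
  by rewrite /GRing.scale/=; ring.
have := @is_derive_0_is_cst _ h t 0 h'.
rewrite /h mulr0 oppr0 expR0 mulr1 => <-.
by rewrite -mulrA -expRD addNr expR0 mulr1.
Qed.

Section radius.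
Variables (rho g G : R -> R) (M Q N : R).
Hypotheses (M0 : 0 < M) (Q0 : 0 < Q) (N0 : 0 <= N).
Hypothesis rho01 : forall t, 0 < rho t <= 1.
Hypothesis drho : forall t : R, is_derive t (1 : R) rho (g t).
Hypothesis dg : forall t : R, is_derive t (1 : R) g (G t).
Let X t := N - Q ^+ 3 - Q ^+ 2 * M * rho t + M ^+ 2 * (M + Q) * rho t ^+ 2.
Hypothesis gE : forall t,
  g t ^+ 2 = 4 * N * M * rho t ^+ 2 * (1 - rho t) - X t ^+ 2 / M ^+ 2.
Hypothesis GE : forall t, G t = X t / M * (Q ^+ 2 - 2 * M * (Q + M) * rho t) +
  2 * N * M * (2 * rho t - 3 * rho t ^+ 2).

(** The polynomial equal to $\rho'^2$ takes at [0] the value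
    $-(N - Q^3)^2 / M^2$, so that $\rho$ cannot approach [0] when
    $N \neq Q^3$. *)
Lemma radius_bounded_below : N <> Q ^+ 3 -> exists2 d, 0 < d & forall t, d <= rho t.
Proof.
move=> D0; pose D := N - Q ^+ 3.
have Dn : 0 < `|D| by rewrite normr_gt0 subr_eq0; apply/eqP.
pose K := 4 * N * M ^+ 3 + 1.
have K1 : 1 <= K by rewrite /K lerDr !mulr_ge0 ?exprn_ge0 ?(ltW M0).
pose L := K + Q ^+ 2 * M + M ^+ 2 * (M + Q).
have L0 : 0 < L.
  have : 0 < Q ^+ 2 * M by rewrite mulr_gt0// exprn_gt0.
  have : 0 < M ^+ 2 * (M + Q) by rewrite mulr_gt0 ?exprn_gt0// addr_gt0.
  rewrite /L; lra.
exists (`|D| / L); first by rewrite divr_gt0.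
move=> t; rewrite ler_pdivrMr//.
have /andP[r0 r1] := rho01 t; set x := rho t in r0 r1 *.
have X2 : X t ^+ 2 <= (K * x) ^+ 2.
  have h : X t ^+ 2 = (4 * N * M * x ^+ 2 * (1 - x) - g t ^+ 2) * M ^+ 2.
    by rewrite gE -/x; field; rewrite gt_eqF.
  have n1 : 0 <= 4 * N * M ^+ 3 by rewrite !mulr_ge0 ?exprn_ge0 ?(ltW M0).
  have n2 : 0 <= g t ^+ 2 * M ^+ 2 by rewrite mulr_ge0 ?sqr_ge0.
  have n3 : 0 <= 4 * N * M ^+ 3 * (x ^+ 2 * x) by rewrite !mulr_ge0 ?exprn_ge0 ?(ltW M0) ?(ltW r0).
  have n4 : 4 * N * M ^+ 3 * x ^+ 2 <= K ^+ 2 * x ^+ 2.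
    rewrite ler_wpM2r ?sqr_ge0// expr2 (le_trans (_ : _ <= K))//.
      by rewrite /K lerDl.
    by rewrite ler_peMr// (le_trans ler01).
  rewrite exprMn; apply: le_trans n4; rewrite h.
  rewrite (_ : _ * _ = 4 * N * M ^+ 3 * x ^+ 2 - 4 * N * M ^+ 3 * (x ^+ 2 * x) - g t ^+ 2 * M ^+ 2); last ring.
  lra.
have XK : `|X t| <= K * x.
  rewrite -(@ler_pXn2r _ 2)// ?nnegrE ?mulr_ge0 ?(ltW r0)//; last by rewrite (le_trans ler01).
  by rewrite real_normK ?num_real.
have -> : D = X t + (Q ^+ 2 * M * x - M ^+ 2 * (M + Q) * x ^+ 2) by rewrite /X -/x /D; ring.
apply: le_trans (ler_normD _ _) _.
have h1 : 0 <= Q ^+ 2 * M * x by rewrite !mulr_ge0 ?(ltW M0) ?(ltW Q0) ?(ltW r0).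
have h2 : 0 <= M ^+ 2 * (M + Q) * x ^+ 2.
  by rewrite !mulr_ge0 ?addr_ge0 ?(ltW M0) ?(ltW Q0) ?(ltW r0).
have h3 : M ^+ 2 * (M + Q) * x ^+ 2 <= M ^+ 2 * (M + Q) * x.
  rewrite ler_wpM2l//; first by rewrite !mulr_ge0 ?addr_ge0 ?(ltW M0) ?(ltW Q0).
  by rewrite expr2 ler_piMr// ltW.
have h4 : `|Q ^+ 2 * M * x - M ^+ 2 * (M + Q) * x ^+ 2| <=
    Q ^+ 2 * M * x + M ^+ 2 * (M + Q) * x.
  by rewrite ler_norml; apply/andP; split; lra.
rewrite /L; have := lerD XK h4; lra.
Qed.

(** In the critical case $N = Q^3$ the inverse [w] of the radius satisfies
    $w'^2 = A w^2 + B w - C$, and hence $w'' = A w + B/2$. *)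
Hypothesis NQ : N = Q ^+ 3.
Let A := Q ^+ 3 * (4 * M - Q).
Let B := 2 * Q ^+ 2 * M * (M - Q).
Let C := M ^+ 2 * (M + Q) ^+ 2.

Let w t := (rho t)^-1.
Let w' t := - (g t * w t ^+ 2).

Let rho_neq0 t : rho t != 0.
Proof. by have /andP[h _] := rho01 t; rewrite gt_eqF. Qed.

Let w0 t : 0 < w t.
Proof. by have /andP[h _] := rho01 t; rewrite invr_gt0. Qed.

Let dw (t : R) : is_derive t (1 : R) w (w' t).
Proof.
have h := drho t; have h0 := rho_neq0 t.
apply: (is_derive_eq (is_deriveV h0 h)).
by rewrite /GRing.scale/= /w' /w; field.
Qed.

Let w'_sqr t : w' t ^+ 2 = A * w t ^+ 2 + B * w t - C.
Proof.
have -> : w' t ^+ 2 = g t ^+ 2 * w t ^+ 4 by rewrite /w'; ring.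
rewrite gE /X NQ /A /B /C /w; have := rho_neq0 t; have M1 : M != 0 by rewrite gt_eqF.
by move=> h; field; rewrite M1 h.
Qed.

Let dw' (t : R) : is_derive t (1 : R) w' (A * w t + B / 2).
Proof.
have h1 := dg t; have h2 := dw t.
have h : is_derive t (1 : R) w' (- (G t * w t ^+ 2 + 2 * g t * w t * w' t)).
  have w'E : w' = fun t => - (g t * (w t * w t)).
    by apply/funext => x; rewrite /w' expr2.
  by rewrite {1}w'E; apply: is_derive_eq; rewrite /GRing.scale/=; ring.
apply: (is_derive_eq h).
have -> : 2 * g t * w t * w' t = - 2 * (g t ^+ 2 * w t ^+ 3) by rewrite /w'; ring.
rewrite gE GE /X NQ /A /B /w; have := rho_neq0 t; have M1 : M != 0 by rewrite gt_eqF.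
by move=> h0; field; rewrite M1 h0.
Qed.

(** If $Q \geq 4M$ then $A, B \leq 0 < C$ and $w'^2$ would be negative. *)
Let A0 : 0 < A.
Proof.
rewrite /A pmulr_rgt0 ?exprn_gt0// subr_gt0 ltNge; apply/negP => QM.
have h := w'_sqr 0; have := sqr_ge0 (w' 0); rewrite h leNgt => /negP; apply.
have a1 : A * w 0 ^+ 2 <= 0.
  by rewrite mulr_le0_ge0 ?sqr_ge0// /A pmulr_rle0 ?exprn_gt0// subr_le0.
have b1 : B * w 0 <= 0.
  apply: mulr_le0_ge0; last exact: ltW.
  rewrite /B pmulr_rle0 ?subr_le0; last by rewrite !mulr_gt0// exprn_gt0.
  have := M0; lra.
have c1 : 0 < C by rewrite /C mulr_gt0 ?exprn_gt0// addr_gt0.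
lra.
Qed.

(** With $k^2 = A$, both $w' \pm k(w + B/2A)$ are pure exponentials. Their
    constant product is negative, so that neither coefficient in [w] vanishes
    and the two have the same sign, which is that of [w]. *)
Lemma radius_inverse_cosh : exists k al be ga : R, [/\ 0 < k, 0 < al, 0 < be &
  forall t, (rho t)^-1 = al * expR (k * t) + be * expR (- k * t) + ga].
Proof.
pose k := Num.sqrt A; have k0 : 0 < k by rewrite sqrtr_gt0.
have k2 : k ^+ 2 = A by rewrite sqr_sqrtr// ltW.
have kn : k != 0 by rewrite gt_eqF.
have An : A != 0 by rewrite gt_eqF.
pose sh t := w t + B / (2 * A).
pose f1 t := w' t + k * sh t; pose f2 t := w' t - k * sh t.
have f1' (t : R) : is_derive t (1 : R) f1 (k * f1 t).
  have h1 := dw t; have h2 := dw' t; rewrite /f1 /sh; apply: is_derive_eq.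
  have kA : k * (k * (w t + B / (2 * A))) = A * w t + B / 2.
    by rewrite mulrA -expr2 k2; field; exact: An.
  by rewrite [RHS]mulrDr kA /GRing.scale/=; ring.
have f2' (t : R) : is_derive t (1 : R) f2 (- k * f2 t).
  have h1 := dw t; have h2 := dw' t; rewrite /f2 /sh; apply: is_derive_eq.
  have kA : k * (k * (w t + B / (2 * A))) = A * w t + B / 2.
    by rewrite mulrA -expr2 k2; field; exact: An.
  by rewrite [RHS]mulrBr [- k * (k * _)]mulNr kA /GRing.scale/=; ring.
have e1 := is_derive_exp_growth f1'; have e2 := is_derive_exp_growth f2'.
have prod t : f1 t * f2 t = - C - B ^+ 2 / (4 * A).
  have -> : f1 t * f2 t = w' t ^+ 2 - k ^+ 2 * sh t ^+ 2 by rewrite /f1 /f2; ring.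
  by rewrite k2 w'_sqr /sh; field; exact: An.
have neg t : f1 t * f2 t < 0.
  rewrite prod; have c1 : 0 < C by rewrite /C mulr_gt0 ?exprn_gt0// addr_gt0.
  have : 0 <= B ^+ 2 / (4 * A) by rewrite divr_ge0 ?sqr_ge0// mulr_ge0// ltW.
  lra.
have wE t : w t = f1 0 / (2 * k) * expR (k * t) + (- f2 0 / (2 * k)) * expR (- k * t) + (- (B / (2 * A))).
  rewrite (_ : _ / _ * _ = f1 t / (2 * k)); last by rewrite (e1 t); ring.
  rewrite (_ : _ / _ * expR (- k * t) = - f2 t / (2 * k)); last by rewrite (e2 t); ring.
  by rewrite /f1 /f2 /sh; field; rewrite kn An.
have f10 : 0 < f1 0.
  rewrite ltNge; apply/negP => h1.
  have h2 : f1 0 < 0.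
    by rewrite lt_neqAle h1 andbT; apply/eqP => e; have := neg 0; rewrite e mul0r ltxx.
  have h3 : 0 < f2 0 by rewrite -(nmulr_rlt0 _ h2).
  (* otherwise the inverse of the radius becomes negative *)
  pose al := - f1 0 / (2 * k); pose T := (`|B / (2 * A)| + 1) / (al * k).
  have al0 : 0 < al by rewrite divr_gt0 ?oppr_gt0// mulr_gt0.
  have ak : 0 < al * k by rewrite mulr_gt0.
  have := w0 T; rewrite wE ltNge => /negP; apply.
  have b1 : 0 <= f2 0 / (2 * k) * expR (- k * T).
    by rewrite mulr_ge0 ?expR_ge0// divr_ge0 ?mulr_ge0// ltW.
  have b2 : al * (1 + k * T) <= al * expR (k * T).
    by rewrite ler_wpM2l ?(ltW al0)// expR_ge1Dx.
  have b3 : al * (k * T) = `|B / (2 * A)| + 1 by rewrite /T; field; rewrite kn gt_eqF.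
  have b4 := ler_norm (- (B / (2 * A))); rewrite normrN in b4.
  rewrite (_ : f1 0 / (2 * k) = - al); last by rewrite /al; field.
  lra.
have f20 : 0 < - f2 0 by rewrite oppr_gt0 -(pmulr_rlt0 _ f10).
exists k, (f1 0 / (2 * k)), (- f2 0 / (2 * k)), (- (B / (2 * A))); split => //.
  by rewrite divr_gt0// mulr_gt0.
by rewrite divr_gt0// mulr_gt0.
Qed.

End radius.
End RealODE.

(** * Weighted geometric sums near the unit circle *)

Section WeightSeries.
Variable R : realType.
Implicit Types (e : nat -> R) (C K q x : R).

(** Ratio test for coefficients of at most polynomial growth. *)
Definition tame e C := (forall i, 0 <= e i) /\
  forall i, e i.+1 <= (1 + C / i.+1%:R) * e i.

Lemma tame_cvg e C K : 0 <= C -> tame e C -> 0 <= K < 1 -> cvgn (pseries e K).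
Proof.
move=> C0 [e0 eC] /andP[K0 K1].
pose th := (1 + K) / 2; have th1 : 0 < 1 - th by rewrite /th; lra.
pose n0 := (Num.truncn (C / ((1 - K) / 2))).+1.
pose x i := e i * K ^+ i.
have x0 i : 0 <= x i by rewrite mulr_ge0// exprn_ge0.
have xS i : (n0 <= i)%N -> (1 - th) * x i <= x i - x i.+1.
  move=> ni; rewrite mulrBl mul1r lerD2l lerN2 /x exprS mulrCA mulrA.
  apply: (@le_trans _ _ (K * (1 + C / i.+1%:R) * e i * K ^+ i)).
    by rewrite ler_wpM2r ?exprn_ge0// -mulrA ler_wpM2l.
  rewrite mulrA; rewrite ler_wpM2r ?exprn_ge0// ler_wpM2r//.
  have : C / i.+1%:R <= (1 - K) / 2.
    rewrite ler_pdivrMr ?ltr0n// -ler_pdivrMl; last by rewrite divr_gt0// subr_gt0.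
    rewrite mulrC; apply: le_trans (ltW (truncnS_gt _)) _.
    by rewrite ler_nat (leq_trans ni).
  move=> h; apply: (@le_trans _ _ (K + 1 * (C / i.+1%:R))).
    rewrite mulrDr mulr1 lerD2l ler_wpM2r ?divr_ge0//; exact: ltW.
  by rewrite mul1r /th; move: (C / _) h => z; lra.
have bnd n : (1 - th) * \sum_(n0 <= i < n) x i <= x n0.
  have h m : (1 - th) * \sum_(n0 <= i < n0 + m) x i <= x n0 - x (n0 + m)%N.
    elim: m => [|m IH]; first by rewrite addn0 big_geq// mulr0 subrr.
    rewrite addnS big_nat_recr ?leq_addr//= mulrDr.
    have := xS (n0 + m)%N (leq_addr _ _); lra.
  have [nn|nn] := leqP n n0; first by rewrite big_geq// mulr0.
  by rewrite -(subnKC (ltnW nn)); apply: le_trans (h _) _; rewrite lerBlDr lerDl.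
rewrite (_ : pseries e K = (fun n => \sum_(0 <= i < n) x i)); last by [].
apply: nondecreasing_is_cvgn.
  by apply/nondecreasing_seqP => n; rewrite big_nat_recr//= lerDl.
exists (\sum_(0 <= i < n0) x i + x n0 / (1 - th)) => _ [n _ <-].
apply: (@le_trans _ _ (\sum_(0 <= i < n0) x i + \sum_(n0 <= i < n) x i)).
  have [nn|nn] := leqP n n0.
    rewrite [X in _ <= _ + X]big_geq// addr0 [leRHS](big_cat_nat _ nn)//= lerDl.
    exact: sumr_ge0.
  by rewrite -(big_cat_nat _ (ltnW nn)).
by rewrite lerD2l ler_pdivlMr// mulrC.
Qed.

Lemma tame_diffs e C : 0 <= C -> tame e C -> tame (pseries_diffs e) (1 + 2 * C).
Proof.
move=> C0 [e0 eC]; split=> [i|i]; rewrite /pseries_diffs; first by rewrite mulr_ge0.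
have h := eC i.+1; set y := i.+1%:R : R.
have y1 : 1 <= y by rewrite ler1n.
have y0 : 0 < y by rewrite (lt_le_trans ltr01).
have e2 : i.+2%:R = y + 1 :> R by rewrite natr1.
rewrite e2 in h *; apply: (@le_trans _ _ ((y + 1) * ((1 + C / (y + 1)) * e i.+1))).
  by rewrite ler_wpM2l// addr_ge0// ltW.
rewrite !mulrA ler_wpM2r//.
rewrite (_ : (y + 1) * (1 + C / (y + 1)) = y + 1 + C); last by field; rewrite gt_eqF// addr_gt0.
rewrite (_ : (1 + (1 + 2 * C) / y) * y = y + 1 + 2 * C); last by field; rewrite gt_eqF.
lra.
Qed.

Variable s : R.
Hypothesis s2 : 2^-1 < s.
Let a := 2 * s + 1.
Let a0 : 0 < a. Proof. by have := s2; rewrite /a; lra. Qed.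

(** The coefficients of $(1 - q)^{-a}$. *)
Fixpoint bin_coeff (k : nat) : R :=
  if k is j.+1 then bin_coeff j * ((a + j%:R) / j.+1%:R) else 1.
Let c := bin_coeff.

Let c0 k : 0 < c k.
Proof.
elim: k => [|k IH] /=; first exact: ltr01.
by rewrite mulr_gt0// divr_gt0 ?ltr0n// ltr_pwDl.
Qed.

Let diffs_c k : pseries_diffs c k = (a + k%:R) * c k.
Proof.
by rewrite /pseries_diffs /c /= mulrCA [_ * (_ / _)]mulrC divfK ?pnatr_eq0// mulrC.
Qed.

Let tame_c : tame c a.
Proof.
split=> [i|i]; first exact: ltW.
rewrite /c /= mulrC ler_wpM2r ?(ltW (c0 i))//.
by rewrite ler_pdivrMr ?ltr0n// mulrDl mul1r divfK ?pnatr_eq0// addrC lerD2r ler_nat.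
Qed.

Let cvg_c q : 0 <= q < 1 -> cvgn (pseries c q).
Proof. by apply: tame_cvg tame_c; exact: ltW. Qed.

Let F q := limn (pseries c q).

(** From $k c_k = (a + k - 1) c_{k-1}$ comes $(1 - q) F'(q) = a F(q)$, which
    identifies [F] as $(1 - q)^{-a}$. *)
Let dF q : 0 <= q < 1 -> is_derive q (1 : R) F (a / (1 - q) * F q).
Proof.
move=> /andP[q0 q1]; pose K := (1 + q) / 2.
have K1 : 0 <= K < 1 by rewrite /K; apply/andP; split; lra.
have C1 : 0 <= 1 + 2 * a by rewrite addr_ge0// mulr_ge0// ltW.
have C2 : 0 <= 1 + 2 * (1 + 2 * a) by rewrite addr_ge0// mulr_ge0.
have t1 := tame_diffs (ltW a0) tame_c; have t2 := tame_diffs C1 t1.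
have cd : cvgn (pseries (pseries_diffs c) q) by apply: (tame_cvg C1 t1); rewrite q0.
have h : is_derive q (1 : R) F (limn (pseries (pseries_diffs c) q)).
  apply: (@pseries_snd_diffs _ c K q).
  - exact: cvg_c.
  - exact: tame_cvg t1 K1.
  - exact: tame_cvg t2 K1.
  - by rewrite !ger0_norm ?q0//; [rewrite /K; lra|case/andP: K1].
apply: (is_derive_eq h).
have q1n : 1 - q != 0 by rewrite gt_eqF// subr_gt0.
apply: (mulfI q1n); rewrite mulrA mulrCA mulfV// mulr1.
set G := limn (pseries (pseries_diffs c) q).
have hG : pseries (pseries_diffs c) q @ \oo --> G by exact: cd.
have hF : pseries c q @ \oo --> F q by apply: cvg_c; rewrite q0.
have t0 : pseries_diffs c n * q ^+ n @[n --> \oo] --> (0 : R).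
  exact: (@cvg_series_cvg_0 _ _ (fun n => pseries_diffs c n * q ^+ n) cd).
have ev n : (1 - q) * pseries (pseries_diffs c) q n =
    a * pseries c q n - (if n is m.+1 then q * (pseries_diffs c m * q ^+ m) else 0).
  rewrite /pseries /series/=; elim: n => [|n IH]; first by rewrite !big_nil !mulr0 subr0.
  rewrite big_nat_recr//= [in RHS]big_nat_recr//= mulrDr IH.
  case: n IH => [|m] _.
    by rewrite !expr0 !mulr1 diffs_c /c /=; ring.
  have e1 : m.+1%:R * c m.+1 = (a + m%:R) * c m by exact: diffs_c.
  rewrite !diffs_c exprS -e1 -natr1; ring.
have l1 : (1 - q) * pseries (pseries_diffs c) q n.+1 @[n --> \oo] --> (1 - q) * G.
  apply: cvgM; first exact: cvg_cst.
  by have := hG; rewrite -(cvg_shiftS (pseries (pseries_diffs c) q)).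
have l2 : a * pseries c q n.+1 - q * (pseries_diffs c n * q ^+ n) @[n --> \oo] -->
    a * F q - q * 0.
  apply: cvgB; apply: cvgM; [exact: cvg_cst| |exact: cvg_cst|exact: t0].
  by have := hF; rewrite -(cvg_shiftS (pseries c q)).
rewrite mulr0 subr0 in l2.
have l1E : (fun n => (1 - q) * pseries (pseries_diffs c) q n.+1) =
    (fun n => a * pseries c q n.+1 - q * (pseries_diffs c n * q ^+ n)).
  by apply/funext => n; rewrite ev.
by rewrite l1E in l1; exact: (cvg_unique (@Rhausdorff R) l1 l2).
Qed.

Let F_closed q : 0 <= q < 1 -> F q * (1 - q) `^ a = 1.
Proof.
move=> /andP[q0 q1].
pose H x := F x * expR (a * ln (1 - x)).
have F0 : F 0 = 1.
  apply/cvg_lim => //; apply: (cvg_near_cst _); exists 1%N => // n /= n1.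
  rewrite /pseries /series/= big_ltn// expr0 mulr1 big_nat_cond big1 ?addr0//.
  by move=> i /andP[/andP[i0 _] _]; rewrite expr0n gtn_eqF// mulr0.
have dH x : 0 <= x < 1 -> is_derive x (1 : R) H 0.
  move=> x01; have h := dF x01; have x1 : 0 < 1 - x by case/andP: x01; lra.
  have hl : is_derive x (1 : R) (fun y => ln (1 - y)) (- (1 - x)^-1).
    have h1 : is_derive x (1 : R) (fun y => 1 - y) (-1).
      have := is_deriveB (is_derive_cst (1 : R) x (1 : R)) (is_derive_id x (1 : R)).
      by rewrite sub0r.
    have h2 := @is_derive1_comp _ (@ln R) (fun y => 1 - y) x _ _ (is_derive1_ln x1) h1.
    by apply: is_derive_eq; rewrite mulrN1.
  rewrite /H; apply: is_derive_eq.
  rewrite /GRing.scale/=; field; rewrite gt_eqF//.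
have -> : F q * (1 - q) `^ a = H q by rewrite /H /powR gt_eqF ?subr_gt0.
have -> : 1 = H 0 by rewrite /H F0 subr0 ln1 mulr0 expR0 mulr1.
have [->//|qn] := eqVneq q 0.
have qp : 0 < q by rewrite lt_neqAle eq_sym qn.
have Hc : {within `[0, q], continuous H}.
  apply: derivable_within_continuous => x; rewrite in_itv/= => /andP[x0 xq].
  have := dH x; rewrite x0 (le_lt_trans xq q1) => /(_ isT) h; exact: ex_derive.
have hd x : x \in `]0, q[%R -> is_derive x (1 : R) H ((fun=> 0 : R) x).
  by rewrite in_itv/= => /andP[x0 xq]; apply: dH; rewrite (ltW x0) (lt_trans xq).
have [y _ /eqP] := MVT qp hd Hc.
by rewrite mul0r subr_eq0 => /eqP.
Qed.

Let d k := weight s k.+1.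

Let d0 k : 0 < d k. Proof. exact: weight_gt0. Qed.

Let theta k := ln (d k) - ln (c k).

(** The ratios $d_{k+1}/d_k$ and $c_{k+1}/c_k$ agree up to $O(k^{-2})$. The error
    is written as a telescoping difference so that [theta] becomes monotone
    after adding or subtracting [ka / k.+1]. *)
Let theta_step : exists2 ka, 0 <= ka &
  forall k, `|theta k.+1 - theta k| <= ka * (k.+1%:R^-1 - k.+2%:R^-1).
Proof.
have s0 : 0 < s by have := s2; lra.
pose ka1 := s + 9 * s + 4 * s ^+ 2.
have ka10 : 0 <= ka1 by rewrite /ka1 !addr_ge0 ?mulr_ge0 ?sqr_ge0 ?(ltW s0).
exists (2 * ka1); first by rewrite mulr_ge0.
move=> k; set m := k.+1%:R : R.
have m1 : 1 <= m by rewrite ler1n.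
have m0 : 0 < m by rewrite (lt_le_trans ltr01).
have mn : m != 0 by rewrite gt_eqF.
have em : k.+2%:R = m + 1 :> R by rewrite natr1.
have mm : 0 < 1 + m ^+ 2 by rewrite ltr_pwDl// sqr_ge0.
pose X := (2 * m + 1) / (1 + m ^+ 2); pose Y := 2 * s / m.
have X0 : 0 <= X by rewrite divr_ge0 ?(ltW mm)// addr_ge0// mulr_ge0// ltW.
have Y0 : 0 <= Y by rewrite divr_ge0 ?(ltW m0)// mulr_ge0// ltW.
have step_d : ln (d k.+1) - ln (d k) = s * ln (1 + X).
  rewrite /d /weight !ln_powR -mulrBr; congr (_ * _).
  rewrite -ln_div ?posrE ?ltr_pwDl ?sqr_ge0//; congr ln.
  by rewrite em -/m /X; field; rewrite gt_eqF.
have step_c : ln (c k.+1) - ln (c k) = ln (1 + Y).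
  have -> : c k.+1 = c k * (1 + Y).
    change (c k * ((a + k%:R) / m) = c k * (1 + Y)); congr (_ * _).
    by rewrite /Y /a (_ : k%:R = m - 1); [field|rewrite /m -natr1 addrK].
  have Y1 : 0 < 1 + Y by rewrite ltr_pwDl.
  by rewrite lnM ?posrE// addrAC subrr add0r.
have -> : theta k.+1 - theta k = s * ln (1 + X) - ln (1 + Y).
  by rewrite -step_d -step_c /theta; ring.
clear step_d step_c; rewrite em; move: m m1 m0 mn mm @X @Y X0 Y0 {em} => m m1 m0 mn mm X Y X0 Y0.
have lnb (x : R) : 0 <= x -> x - x ^+ 2 <= ln (1 + x) <= x.
  move=> x0; have x1 : 0 < 1 + x by rewrite ltr_pwDl.
  rewrite le_ln1Dx ?andbT; last by rewrite (lt_le_trans _ x0)// ltrN10.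
  have h := @le_ln1Dx _ (- (x / (1 + x))).
  have {h}/h : -1 < - (x / (1 + x)) by rewrite ltrN2 ltr_pdivrMr// mul1r ltrDr.
  have -> : 1 - x / (1 + x) = (1 + x)^-1 by field; rewrite gt_eqF.
  rewrite lnV ?posrE// lerN2 => h; apply: le_trans h.
  by rewrite ler_pdivlMr//; nra.
have /andP[Xl Xu] := lnb X X0; have /andP[Yl Yu] := lnb Y Y0.
have XY : `|s * X - Y| <= s / m ^+ 2.
  have -> : s * X - Y = s * ((m - 2) / (m * (1 + m ^+ 2))).
    by rewrite /X /Y; field; rewrite ?mn ?gt_eqF.
  rewrite normrM (gtr0_norm s0) ler_wpM2l ?(ltW s0)// normrM normfV.
  rewrite (gtr0_norm (mulr_gt0 m0 mm)) ler_pdivrMr ?mulr_gt0//.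
  have -> : (m ^+ 2)^-1 * (m * (1 + m ^+ 2)) = m + m^-1 by field.
  rewrite ler_norml; have : 0 < m^-1 by rewrite invr_gt0.
  have : 1 <= m + m^-1.
    have : 0 < m^-1 by rewrite invr_gt0.
    lra.
  by move=> *; apply/andP; split; lra.
have X3 : X <= 3 / m.
  rewrite /X ler_pdivrMr// mulrAC ler_pdivlMr//; nra.
have X2 : X ^+ 2 <= 9 / m ^+ 2.
  have -> : 9 / m ^+ 2 = (3 / m) ^+ 2 by field.
  by rewrite ler_pXn2r// ?nnegrE// divr_ge0// ltW.
have Y2 : Y ^+ 2 = 4 * s ^+ 2 / m ^+ 2 by rewrite /Y; field.
apply: (@le_trans _ _ (ka1 / m ^+ 2)).
  have sX2 : s * X ^+ 2 <= s * (9 / m ^+ 2) by rewrite ler_wpM2l// ltW.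
  have sXl : s * (X - X ^+ 2) <= s * ln (1 + X) by rewrite ler_wpM2l// ltW.
  have sXu : s * ln (1 + X) <= s * X by rewrite ler_wpM2l// ltW.
  have -> : ka1 / m ^+ 2 = s / m ^+ 2 + s * (9 / m ^+ 2) + 4 * s ^+ 2 / m ^+ 2 by rewrite /ka1; field.
  move: XY; rewrite ler_norml => /andP[XY1 XY2]; rewrite -Y2 ler_norml.
  have := sqr_ge0 Y; have : 0 <= s * X ^+ 2 by rewrite mulr_ge0 ?sqr_ge0// ltW.
  move: (ln (1 + X)) (ln (1 + Y)) sXl sXu Yl Yu => lX lY sXl sXu Yl Yu h1 h2.
  by rewrite mulrBr in sXl; apply/andP; split; lra.
have -> : m^-1 - (m + 1)^-1 = (m * (m + 1))^-1.
  by field; rewrite ?mn ?gt_eqF// addr_gt0.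
rewrite -mulrA [_ * (ka1 * _)]mulrCA ler_wpM2l//.
rewrite ler_pdivlMr ?mulr_gt0 ?addr_gt0//.
have -> : (m ^+ 2)^-1 * (m * (m + 1)) = 1 + m^-1 by field.
by rewrite -lerBrDl (_ : 2 - 1 = 1 :> R) ?invf_le1//; ring.
Qed.

Let theta_cvg : cvgn theta.
Proof.
have [ka ka0 hka] := theta_step.
have step k := hka k; have inv0 k : 0 < k.+1%:R^-1 :> R by rewrite invr_gt0 ltr0n.
pose up k := theta k + ka * k.+1%:R^-1; pose lo k := theta k - ka * k.+1%:R^-1.
have up_dec : nonincreasing_seq up.
  apply/nonincreasing_seqP => k; rewrite /up.
  by have := step k; rewrite ler_norml mulrBr => /andP[];
    move: (ka / k.+1%:R) (ka / k.+2%:R) => x y; lra.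
have lo_inc : nondecreasing_seq lo.
  apply/nondecreasing_seqP => k; rewrite /lo.
  by have := step k; rewrite ler_norml mulrBr => /andP[];
    move: (ka / k.+1%:R) (ka / k.+2%:R) => x y; lra.
have up_cvg : cvgn up.
  apply: nonincreasing_is_cvgn => //; exists (lo 0%N) => _ [n _ <-].
  apply: (le_trans (lo_inc 0%N n (leq0n n))); rewrite /lo /up lerD2l.
  by apply: (@le_trans _ _ 0); [rewrite oppr_le0|]; rewrite mulr_ge0// ltW.
have h : up k - ka * k.+1%:R^-1 @[k --> \oo] --> limn up - ka * 0.
  apply: cvgB; first exact: up_cvg.
  by apply: cvgM; [exact: cvg_cst|exact: cvg_harmonic].
apply/cvg_ex; exists (limn up - ka * 0).
rewrite (_ : theta = (fun k => up k - ka * k.+1%:R^-1)); first exact: h.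
by apply/funext => k; rewrite /up addrK.
Qed.

Let ratio_cvg : exists2 L : R, 0 < L & d k / c k @[k --> \oo] --> L.
Proof.
exists (expR (limn theta)); first exact: expR_gt0.
rewrite (_ : (fun k => _) = expR \o theta).
  exact: (continuous_cvg _ (@continuous_expR R _) theta_cvg).
by apply/funext => k; rewrite /= /theta expRB !lnK ?posrE.
Qed.

Let part_d rho n := \sum_(0 <= k < n) d k * (1 - rho) ^+ k.

Let cvg_d rho : 0 < rho <= 1 -> cvgn (part_d rho).
Proof.
move=> /andP[r0 r1]; have q0 : 0 <= 1 - rho by lra.
have [L L0 hL] := ratio_cvg.
have [K hK] : exists K, forall k, d k / c k <= K.
  have [K [_ hK]] := cvg_seq_bounded (cvgP _ hL).
  by exists (K + 1) => k; apply: le_trans (ler_norm _) (hK _ _ _ I); rewrite ltrDl.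
apply: nondecreasing_is_cvgn.
  apply/nondecreasing_seqP => n; rewrite /part_d big_nat_recr//= lerDl.
  by rewrite mulr_ge0 ?exprn_ge0// ltW.
have K0 : 0 <= K by apply: le_trans (hK 0%N); rewrite divr_ge0 ?ltW.
exists (K * F (1 - rho)) => _ [n _ <-].
apply: (@le_trans _ _ (K * pseries c (1 - rho) n)).
  rewrite /pseries /series/= mulr_sumr; apply: ler_sum => k _.
  by rewrite mulrA ler_wpM2r ?exprn_ge0// -ler_pdivrMr.
rewrite ler_wpM2l//; apply: nondecreasing_cvgn_le; last by apply: cvg_c; rewrite q0/=; lra.
apply/nondecreasing_seqP => m; rewrite /pseries /series/= big_nat_recr//= lerDl.
by rewrite mulr_ge0 ?exprn_ge0// ltW.
Qed.

Definition weight_sum (rho : R) : R :=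
  limn (fun n => \sum_(0 <= k < n) weight s k.+1 * (1 - rho) ^+ k).

Lemma weight_sum_cvg rho : 0 < rho <= 1 ->
  \sum_(0 <= k < n) weight s k.+1 * (1 - rho) ^+ k @[n --> \oo] --> weight_sum rho.
Proof. exact: cvg_d. Qed.

(** Abel's theorem: [d] is asymptotic to a multiple of the coefficients of
    $(1 - q)^{-a}$, hence so are the sums when $q \to 1$. *)
Lemma weight_sum_asymptotics : exists2 La : R, 0 < La &
  forall e : R, 0 < e -> exists2 de, 0 < de & forall rho, 0 < rho <= 1 -> rho < de ->
  `|rho `^ (2 * s + 1) * weight_sum rho - La| <= e.
Proof.
have [L L0 hL] := ratio_cvg; exists L => // e e0.
have e2 : 0 < e / 2 by rewrite divr_gt0.
have /cvgrPdist_le/(_ _ e2)[K _ hK] := hL.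
have dc k : (K <= k)%N -> `|d k - L * c k| <= e / 2 * c k.
  move=> /hK /= h; rewrite -ler_pdivrMr// -[(c k)^-1]gtr0_norm ?invr_gt0//.
  rewrite -normrM mulrBl mulfK ?gt_eqF// distrC//.
pose CK := \sum_(0 <= k < K) `|d k - L * c k|.
have CK0 : 0 <= CK by exact: sumr_ge0.
exists (e / 2 / (CK + 1)); first by rewrite divr_gt0// ltr_wpDl.
move=> rho r01 rde; have /andP[r0 r1] := r01.
have q01 : 0 <= 1 - rho < 1 by apply/andP; split; lra.
have q0 : 0 <= 1 - rho by case/andP: q01.
have Fr := F_closed q01; rewrite (_ : 1 - (1 - rho) = rho) in Fr; last ring.
have key : `|weight_sum rho - L * F (1 - rho)| <= CK + e / 2 * F (1 - rho).
  have h : `|part_d rho n - L * pseries c (1 - rho) n| @[n --> \oo] -->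
      `|weight_sum rho - L * F (1 - rho)|.
    apply: cvg_norm; apply: cvgB; first exact: cvg_d.
    by apply: cvgM; [exact: cvg_cst|exact: cvg_c].
  apply: (cvgr_to_le h); exists K => // n /= nK.
  rewrite /part_d /pseries /series/= mulr_sumr -sumrB.
  apply: le_trans (ler_norm_sum _ _ _) _.
  rewrite (big_cat_nat _ nK)//=; apply: lerD.
    apply: ler_sum => k _; rewrite mulrA -mulrBl normrM ler_piMr//.
    by rewrite ger0_norm ?exprn_ge0// exprn_ile1//; lra.
  apply: (@le_trans _ _ (e / 2 * \sum_(K <= k < n) c k * (1 - rho) ^+ k)).
    rewrite mulr_sumr; apply: ler_sum_nat => k /andP[Kk _].
    rewrite !mulrA -mulrBl normrM [X in _ * X]ger0_norm ?exprn_ge0//.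
    by rewrite ler_wpM2r ?exprn_ge0// dc.
  rewrite ler_wpM2l ?(ltW e2)//.
  apply: (@le_trans _ _ (pseries c (1 - rho) n)).
    rewrite /pseries /series/= [leRHS](big_cat_nat _ nK)//= lerDr.
    by apply: sumr_ge0 => k _; rewrite mulr_ge0 ?exprn_ge0// ltW.
  apply: nondecreasing_cvgn_le; last exact: cvg_c.
  apply/nondecreasing_seqP => m; rewrite /pseries /series/= big_nat_recr//= lerDl.
  by rewrite mulr_ge0 ?exprn_ge0// ltW.
have ra : 0 < rho `^ a by exact: powR_gt0.
have rr : rho `^ a <= rho.
  rewrite -[leRHS]powRr1 ?(ltW r0)//; apply: ger_powR; first by rewrite r0.
  by have := s2; rewrite /a; lra.
have -> : rho `^ (2 * s + 1) * weight_sum rho - L =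
    rho `^ a * (weight_sum rho - L * F (1 - rho)).
  by rewrite mulrBr [_ * (L * _)]mulrCA [_ * F _]mulrC Fr mulr1.
rewrite normrM (gtr0_norm ra).
apply: le_trans (ler_wpM2l (ltW ra) key) _.
rewrite mulrDr mulrCA [_ * F _]mulrC Fr mulr1.
have : rho `^ a * CK <= e / 2.
  apply: (@le_trans _ _ (rho * (CK + 1))).
    by apply: ler_pM => //; [exact: ltW|rewrite lerDl].
  by rewrite -ler_pdivlMr ?ltr_wpDl// ltW.
lra.
Qed.

End WeightSeries.

(** * The radius along a solution *)

Section Radius.
Variable R : realType.
Variables (s : R) (a v : R -> nat -> R[i]) (J : R -> R[i]) (A : R -> nat -> R[i]).
Hypotheses (s2 : 2^-1 < s) (sys : szego_system s a v J A).
Variables (c0 p0 : R[i]).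
Hypotheses (c00 : c0 != 0) (init : forall k, a 0 k.+1 = c0 * p0 ^+ k).

(** Besides the formula for $\rho'^2$, the second derivative [G] is recorded: the
    former does not determine it at the times when $\rho' = 0$. *)
Theorem rank_one_radius : exists (rho g G : R -> R) (M Q N : R),
  [/\ 0 < M, 0 < Q & 0 <= N] /\
  [/\ forall t, 0 < rho t <= 1,
      forall t : R, is_derive t (1 : R) rho (g t),
      forall t : R, is_derive t (1 : R) g (G t),
      forall t, g t ^+ 2 = 4 * N * M * rho t ^+ 2 * (1 - rho t) -
        (N - Q ^+ 3 - Q ^+ 2 * M * rho t + M ^+ 2 * (M + Q) * rho t ^+ 2) ^+ 2 / M ^+ 2 &
      forall t, G t = (N - Q ^+ 3 - Q ^+ 2 * M * rho t + M ^+ 2 * (M + Q) * rho t ^+ 2) / M *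
        (Q ^+ 2 - 2 * M * (Q + M) * rho t) + 2 * N * M * (2 * rho t - 3 * rho t ^+ 2)] /\
  [/\ forall t, A t 0%N = Q%:C, forall t, normc (J t) ^+ 2 = N,
      forall t, normc (a t 0%N) ^+ 2 = Q - M * rho t &
      forall t k, normc (a t k.+1) ^+ 2 = M * rho t ^+ 2 * (1 - rho t) ^+ k].
Proof.
have [p [_ H]] := rank_one_system s2 sys c00 init.
pose b t := a t 0%N; pose c t := a t 1%N.
pose b_ t := (b t)^*%C; pose c_ t := (c t)^*%C; pose p_ t := (p t)^*%C.
pose rho t := 1 - normc (p t) ^+ 2.
have rE t : 1 - p t * p_ t = (rho t)%:C by rewrite /p_ mulcJ rmorphB/= rmorph1.
have p1 t : normc (p t) < 1 by have [[]] := H t.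
have rho01 t : 0 < rho t <= 1.
  rewrite /rho subr_gt0 exprn_ilt1 ?normc_ge0//=.
  by rewrite lerBlDr lerDl sqr_ge0.
have rho0 t : rho t != 0 by case/andP: (rho01 t) => h _; rewrite gt_eqF.
have r0 t : 1 - p t * p_ t != 0.
  by rewrite rE; apply/eqP => -[/eqP]; apply/negP.
have rJ t : ((1 - p t * p_ t)^-1)^*%C = (1 - p t * p_ t)^-1.
  by rewrite conjc_inv rE conjc_real.
have AE t : A t 0%N = b t * b_ t + c t * c_ t / (1 - p t * p_ t) by have [[]] := H t.
have JE t : J t = b t * (b t * b_ t + c t * c_ t / (1 - p t * p_ t)) +
   c t / (1 - p t * p_ t) * (b t * c_ t + c t * c_ t * p_ t / (1 - p t * p_ t)).
  by have [[]] := H t.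
have JE_ t : (J t)^*%C = b_ t * (b t * b_ t + c t * c_ t / (1 - p t * p_ t)) +
   c_ t / (1 - p t * p_ t) * (b_ t * c t + c_ t * c t * p t / (1 - p t * p_ t)).
  rewrite JE /b_ /c_ /p_ !(conjcD, conjcM, conjcK) !rJ /p_; ring.
have iJ : ('i%C : R[i])^*%C = - 'i%C by apply: complexP; rewrite /= ?oppr0.
have two : (2 : R[i])^*%C = 2 by rewrite conjc_nat.
have db t : cderiv b t (- 'i%C * (2 * J t * A t 0%N + (J t)^*%C * b t ^+ 2)).
  by have [_ []] := H t.
have dc t : cderiv c t (- 'i%C * (2 * J t * (b_ t * c t + c t * c_ t * p t / (1 - p t * p_ t)) +
  2 * (J t)^*%C * b t * c t)) by have [_ []] := H t.
have dp t : cderiv p t (- 'i%C * ((J t)^*%C * c t)) by have [_ []] := H t.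
have db_ t : cderiv b_ t ('i%C * (2 * (J t)^*%C * A t 0%N + J t * b_ t ^+ 2)).
  apply: cderiv_eq (cderivJ (db t)) _.
  rewrite AE /b_ /c_ /p_ !(two, conjcD, conjcM, conjcN, conjcK, conjcX) iJ opprK rJ /p_; ring.
have dc_ t : cderiv c_ t ('i%C * (2 * (J t)^*%C * (b t * c_ t + c_ t * c t * p_ t / (1 - p t * p_ t)) +
  2 * J t * b_ t * c_ t)).
  apply: cderiv_eq (cderivJ (dc t)) _.
  rewrite /b_ /c_ /p_ !(two, conjcD, conjcM, conjcN, conjcK, conjcX) iJ opprK rJ /p_; ring.
have dp_ t : cderiv p_ t ('i%C * (J t * c_ t)).
  apply: cderiv_eq (cderivJ (dp t)) _.
  by rewrite !(conjcM, conjcN, conjcK) iJ opprK.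
pose r t := 1 - p t * p_ t; pose Qf t := b t * b_ t + c t * c_ t / r t.
pose Mf t := c t * c_ t / r t ^+ 2; pose J_ t := (J t)^*%C.
have {}db t : cderiv b t (- 'i%C * (2 * J t * Qf t + J_ t * b t ^+ 2)) by rewrite /Qf -AE.
have {}db_ t : cderiv b_ t ('i%C * (2 * J_ t * Qf t + J t * b_ t ^+ 2)) by rewrite /Qf -AE.
have int := @rank_one_integrals R b b_ c c_ p p_ r Qf Mf J J_ (fun=> erefl) (fun=> erefl)
  (fun=> erefl) JE JE_ r0 db db_ dc dc_ dp dp_.
pose M := normc (c 0) ^+ 2 / rho 0 ^+ 2.
pose Q := normc (b 0) ^+ 2 + normc (c 0) ^+ 2 / rho 0.
pose N := normc (J 0) ^+ 2.
have rC t : r t = (rho t)%:C by exact: rE.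
have divC (x y : R) : (x / y)%:C = x%:C / y%:C by rewrite rmorphM fmorphV.
have MfE t : Mf t = (normc (c t) ^+ 2 / rho t ^+ 2)%:C.
  by rewrite /Mf /c_ mulcJ rC -rmorphXn/= divC.
have QfE t : Qf t = (normc (b t) ^+ 2 + normc (c t) ^+ 2 / rho t)%:C.
  by rewrite /Qf /b_ /c_ !mulcJ rC -divC -rmorphD.
have NE t : J t * J_ t = (normc (J t) ^+ 2)%:C by exact: mulcJ.
pose g t := complex.Re ('i%C * (J_ t * (c t * p_ t) - J t * (c_ t * p t))).
pose xi t := J_ t * (c t * p_ t).
have etaE t : J t * (c_ t * p t) = (xi t)^*%C by rewrite /xi !conjcM !conjcK.
have gC t : 'i%C * (J_ t * (c t * p_ t) - J t * (c_ t * p t)) = (g t)%:C.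
  apply: complexP => //=; rewrite etaE -/(xi t).
  by rewrite !cReImE/=; ring.
pose X t := N - Q ^+ 3 - Q ^+ 2 * M * rho t + M ^+ 2 * (M + Q) * rho t ^+ 2.
have cn t : 0 < normc (c t).
  have [[_ c_neq0 _ _ _] _] := H t.
  rewrite lt_neqAle normc_ge0 andbT eq_sym; apply/eqP => /eq0_normc /eqP; exact/negP.
have rp t : 0 < rho t by case/andP: (rho01 t).
have M0 : 0 < M by rewrite /M divr_gt0 ?exprn_gt0.
have Q0 : 0 < Q.
  by rewrite /Q ltr_wpDl ?sqr_ge0// divr_gt0 ?exprn_gt0.
have Mn : M%:C != 0 :> R[i] by apply/eqP => -[/eqP]; rewrite gt_eqF.
have Xadd t : J_ t * (c t * p_ t) + J t * (c_ t * p t) = (X t / M)%:C.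
  have [_ [_ _ h _]] := int t; apply: (mulfI Mn); rewrite -[M%:C]MfE h.
  rewrite NE QfE MfE rC -/M -/Q -/N /X.
  have -> : M%:C * (X t / M)%:C = (X t)%:C by rewrite -rmorphM/= mulrC divfK// gt_eqF.
  by rewrite -!(rmorphM, rmorphXn, rmorphD, rmorphB)/=.
have Gall t : exists Gt, is_derive t (1 : R) g Gt /\
    Gt = X t / M * (Q ^+ 2 - 2 * M * (Q + M) * rho t) + 2 * N * M * (2 * rho t - 3 * rho t ^+ 2).
  have [_ [_ _ _ [h _]]] := int t.
  exists (complex.Re ((J_ t * (c t * p_ t) + J t * (c_ t * p t)) *
     (Qf 0 ^+ 2 - 2 * Mf 0 * (Qf 0 + Mf 0) * r t) +
     2 * (J 0 * J_ 0) * Mf 0 * (2 * r t - 3 * r t ^+ 2))).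
  split; first exact: h.
  rewrite Xadd NE QfE MfE rC -/M -/Q -/N.
  have -> : (2 : R[i]) = (2 : R)%:C by rewrite rmorphMn/= rmorph1.
  have -> : (3 : R[i]) = (3 : R)%:C by rewrite rmorphMn/= rmorph1.
  by rewrite -!(rmorphM, rmorphXn, rmorphD, rmorphB)/=.
have /choice[G hG] := Gall.
have Qt t : normc (b t) ^+ 2 + normc (c t) ^+ 2 / rho t = Q.
  by have [[h _ _] _] := int t; move: h; rewrite !QfE => /complexI.
have Mt t : normc (c t) ^+ 2 = M * rho t ^+ 2.
  have [[_ h _] _] := int t; move: h; rewrite !MfE => /complexI h.
  by rewrite /M -h divfK// expf_neq0.
exists rho, g, G, M, Q, N; split; [by split => //; exact: sqr_ge0|split; split].
- exact: rho01.
- by move=> t; have [_ [[h _] _ _ _]] := int t; move: h; under eq_fun do rewrite rC.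
- by move=> t; case: (hG t).
- move=> t; have [_ [_ h _ _]] := int t; apply: complexI.
  rewrite -/(X t) rmorphXn/= -gC exprMn sqr_i.
  set x := J_ t * _ in h *; set y := J t * _ in h *.
  have -> : -1 * (x - y) ^+ 2 = 4 * (x * y) - (x + y) ^+ 2 by ring.
  rewrite h /x /y Xadd NE MfE rC -/M -/N.
  have -> : (4 : R[i]) = (4 : R)%:C by rewrite rmorphMn/= rmorph1.
  have -> : (1 : R[i]) = (1 : R)%:C by rewrite rmorph1.
  rewrite -!(rmorphM, rmorphXn, rmorphD, rmorphB)/=; congr (_%:C).
  by field; rewrite gt_eqF.
- by move=> t; case: (hG t).
- by move=> t; rewrite AE -[LHS]/(Qf t) QfE Qt.
- move=> t; have [[_ _ h] _] := int t; move: h; rewrite !NE => /complexI //.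
- move=> t; rewrite -(Qt t) Mt -/(b t).
  by field.
- move=> t k; have [[h _ _ _ _] _] := H t.
  rewrite h normcM normcX exprMn Mt -exprM mulnC exprM; congr (_ * _ ^+ _).
  by rewrite /rho; ring.
Qed.
End Radius.

(** * Initial data and Sobolev norms in L(1) *)

Section Initial.
Context {R : realType}.
Implicit Types (f : R -> R[i]).

(** A non-constant element of $\mathcal L(1)$ is, up to its mean, a geometric
    series in $e^{ix}$. *)
Lemma calL1_fourier f (u0 : R -> R[i]) : cmeasurable f -> eq_torus f u0 -> calL1 u0 ->
  ~ (exists z, forall x, u0 x = z) ->
  exists c p : R[i], [/\ c != 0, normc p < 1, cmeasurable u0 &
    forall k, fourier f k.+1%:Z = c * p ^+ k].
Proof.
move=> mf fu [b [c [p [p1 u0E]]]] nc.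
have {}p1 : normc p < 1 by move: p1; rewrite normCE -[1]/((1 : R)%:C) ltcR.
exists c, p.
pose a l := if l is k.+1 then c * p ^+ k else b.
have au x : csum (fun l => a l * expi (l%:Z%:~R * x)) (u0 x).
  have h : normc (p * expi x) < 1 by rewrite normcM normc_expi mulr1.
  rewrite u0E (_ : b = a 0%N * expi (0%:Z%:~R * x)); last by rewrite mul0r expi0 mulr1.
  apply: csumS; apply: eq_csum (csumZ (c * expi x) (csum_geometric h)) => l.
  by rewrite /a -[l.+1%:Z%:~R]/(l.+1%:R) expi_natr exprS exprMn; ring.
have mu0 := cmeasurable_fourier_series au.
split => //.
  apply/negP => /eqP c0; apply: nc; exists b => x.
  by rewrite u0E c0 !mul0r addr0.
move=> k.
have aB n : \sum_(0 <= l < n) normc (a l) <= normc b + normc c * (1 - normc p)^-1.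
  have q0 : 0 <= normc p := normc_ge0 p.
  case: n => [|n].
    rewrite big_geq// addr_ge0 ?normc_ge0// mulr_ge0 ?normc_ge0// invr_ge0; lra.
  rewrite big_nat_recl//=; apply: lerD => //.
  under eq_bigr do rewrite normcM normcX.
  rewrite -mulr_sumr ler_wpM2l ?normc_ge0//.
  rewrite -[leRHS]mul1r ler_pdivlMr ?subr_gt0// mulrC big_mkord.
  have := subrX1 (normc p) n; have : 0 <= normc p ^+ n by rewrite exprn_ge0.
  move: (\sum_(i < n) _) (normc p ^+ n) => x y; lra.
rewrite (eq_torus_fourier _ mf mu0 fu).
have := @fourier_csum _ u0 a _ mu0 aB; move=> ->//.
by apply: aeW => x _; exact: au.
Qed.
End Initial.

Section Norm.
Variables (R : realType) (s : R) (f : R -> R[i]) (M Q rho : R).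
Hypotheses (s2 : 2^-1 < s) (rho01 : 0 < rho <= 1) (fp : L2plus f).
Hypothesis f0 : normc (fourier f 0) ^+ 2 = Q - M * rho.
Hypothesis fS : forall k, normc (fourier f k.+1%:Z) ^+ 2 = M * rho ^+ 2 * (1 - rho) ^+ k.

Lemma rank_one_Hs_norm :
  Hs_norm s f = (Num.sqrt (Q - M * rho + M * rho ^+ 2 * weight_sum s rho))%:E.
Proof.
apply: Hs_norm_cvg => //; rewrite -cvg_shiftS /=.
under eq_fun do rewrite big_nat_recl//.
apply: cvgD; first by rewrite f0 /weight expr0n/= addr0 powR1 mul1r; exact: cvg_cst.
under eq_fun do under eq_bigr do rewrite fS mulrCA.
under eq_fun do rewrite -mulr_sumr.
by apply: cvgM; [exact: cvg_cst|exact: weight_sum_cvg].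
Qed.
End Norm.

(** * Growth and boundedness of the norms *)

Section Growth.
Context {R : realType}.

Lemma cvg_expRN (k : R) : 0 < k -> expR (- (k * t)) @[t --> +oo] --> (0 : R).
Proof.
move=> k0; have := @cvg_comp _ _ _ (fun x : R => k * x) (fun x => expR (- x)) _ _ _
  (gt0_cvgMry k0 _) (@cvgr_expR R).
by apply; exact: cvg_id.
Qed.

Lemma cosh_rate (k al be ga : R) : 0 < k ->
  (al * expR (k * t) + be * expR (- k * t) + ga) * expR (- (k * t)) @[t --> +oo] --> al.
Proof.
move=> k0; have E := cvg_expRN k0.
have e t : (al * expR (k * t) + be * expR (- k * t) + ga) * expR (- (k * t)) =
    al + be * (expR (- (k * t)) * expR (- (k * t))) + ga * expR (- (k * t)).
  rewrite mulNr !mulrDl -[al * _ * _]mulrA -expRD subrr expR0 mulr1; ring.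
under eq_fun do rewrite e.
rewrite (_ : nbhs al = nbhs (al + be * (0 * 0) + ga * 0)); last by rewrite !mulr0 !addr0.
apply: cvgD.
  by apply: cvgD; [exact: cvg_cst|apply: cvgM; [exact: cvg_cst|exact: cvgM]].
by apply: cvgM; [exact: cvg_cst|].
Qed.

Lemma powR_cvg (F : set_system R) (FF : Filter F) (f : R -> R) (l a : R) : 0 < l ->
  f x @[x --> F] --> l -> f x `^ a @[x --> F] --> l `^ a.
Proof.
move=> l0 fl; apply: (@cvg_comp _ _ _ f (fun x => x `^ a)); first exact: fl.
have : {for l, continuous (fun x : R => powR x a)}.
  apply: differentiable_continuous; apply/derivable1_diffP; apply: derivable_powR.
  by rewrite in_itv/= l0.
exact.
Qed.

Variables (s M Q : R) (rho : R -> R).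
Hypotheses (s2 : 2^-1 < s) (M0 : 0 < M) (rho01 : forall t, 0 < rho t <= 1).

Let Phi t := Q - M * rho t + M * rho t ^+ 2 * weight_sum s (rho t).

(** When the radius decays like $e^{-kt}$, only the last term of the squared
    norm grows, and it does so at the rate given by the Abelian theorem for the
    weights. *)
Lemma rank_one_growth : exists2 La : R, 0 < La & forall k al : R, 0 < k -> 0 < al ->
  (rho t)^-1 * expR (- (k * t)) @[t --> +oo] --> al ->
  Num.sqrt (Phi t) / (Num.sqrt (al `^ (2 * s - 1) * (M * La)) * expR (k * (s - 2^-1) * `|t|))
    @[t --> +oo] --> (1 : R).
Proof.
have [La La0 hLa] := weight_sum_asymptotics s2; exists La => // k al k0 al0 hz.
pose a := 2 * s - 1; have a0 : 0 < a by rewrite /a; have := s2; lra.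
pose E t : R := expR (- (k * t)); pose z t := (rho t)^-1 * E t.
have r0 t : 0 < rho t by case/andP: (rho01 t).
have rn t : rho t != 0 by rewrite gt_eqF.
have E0 t : 0 < E t by exact: expR_gt0.
have z0 t : 0 < z t by rewrite mulr_gt0 ?invr_gt0.
have zl : z t @[t --> +oo] --> al by [].
have rE : rho = (fun t => (z t)^-1 * E t).
  by apply/funext => t; rewrite /z invfM invrK mulfVK// gt_eqF.
have rl : rho t @[t --> +oo] --> (0 : R).
  rewrite rE -[0](mulr0 al^-1); apply: cvgM; last exact: cvg_expRN.
  by apply: cvgV => //; rewrite gt_eqF.
have rr : rho t @[t --> +oo] --> (0 : R)^'+.
  move=> P hP; have : nbhs (0 : R) (fun x => 0 < x -> P x) by exact: hP.
  by move=> /rl; apply: (@filterS _ (pinfty_nbhs R)) => t h; exact: h (r0 t).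
have ra : rho t `^ a @[t --> +oo] --> (0 : R) := cvg_comp _ _ rr (powR_cvg0 a0).
have rW : rho t `^ (2 * s + 1) * weight_sum s (rho t) @[t --> +oo] --> La.
  apply/cvgrPdist_le => e e0; have [de de0 h] := hLa e e0.
  have : \forall t \near +oo, `|0 - rho t| < de by move/cvgrPdist_lt: rl; exact.
  apply: filterS => t; rewrite sub0r normrN gtr0_norm// => rde.
  by rewrite distrC; exact: h.
have PhiE t : E t `^ a * Phi t = z t `^ a * (Q * rho t `^ a - M * (rho t `^ a * rho t)
    + M * (rho t `^ (2 * s + 1) * weight_sum s (rho t))).
  have -> : E t = z t * rho t by rewrite /z mulrAC mulVf// mul1r.
  have -> : rho t `^ (2 * s + 1) = rho t `^ a * rho t ^+ 2.
    rewrite -powR_mulrn ?(ltW (r0 t))// -powRD; last by rewrite rn implybT.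
    by congr (_ `^ _); rewrite /a; ring.
  by rewrite powRM ?(ltW (z0 t)) ?(ltW (r0 t))// /Phi; ring.
have PhiL : E t `^ a * Phi t @[t --> +oo] --> al `^ a * (M * La).
  under eq_fun do rewrite PhiE.
  have -> : M * La = Q * 0 - M * (0 * 0) + M * La by ring.
  apply: cvgM; first exact: powR_cvg.
  apply: cvgD; first apply: cvgB.
  - by apply: cvgM => //; exact: cvg_cst.
  - by apply: cvgM; [exact: cvg_cst|exact: cvgM].
  - by apply: cvgM => //; exact: cvg_cst.
set C := Num.sqrt _; have C0 : 0 < C by rewrite sqrtr_gt0 mulr_gt0 ?powR_gt0 ?mulr_gt0.
have sq t : 0 <= t -> Num.sqrt (Phi t) / (C * expR (k * (s - 2^-1) * `|t|)) =
    Num.sqrt (E t `^ a * Phi t) / C.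
  move=> t0; rewrite sqrtrM ?powR_ge0//.
  have -> : E t `^ a = expR (- (k * (s - 2^-1) * t)) ^+ 2.
    by rewrite /E -expRM -expRM_natl; apply: (congr1 expR); rewrite /a; field.
  by rewrite sqrtr_sqr (gtr0_norm (expR_gt0 _)) expRN (ger0_norm t0) invfM mulrCA mulrC [Num.sqrt (Phi t) * _]mulrC.
have : Num.sqrt (E t `^ a * Phi t) / C @[t --> +oo] --> (1 : R).
  rewrite -(divff (lt0r_neq0 C0)); apply: cvgM; last exact: cvg_cst.
  by apply: (@cvg_comp _ _ _ _ Num.sqrt _ _ _ PhiL); exact: sqrt_continuous.
apply: cvg_trans; apply: near_eq_cvg; near=> t.
by rewrite sq//; near: t; exact: nbhs_pinfty_ge.
Unshelve. all: by end_near. Qed.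

(** The weighted sum decreases with the radius. *)
Lemma rank_one_bounded d : 0 < d -> (forall t, d <= rho t) ->
  exists B : R, forall t, Phi t <= B.
Proof.
move=> d0 dr; have d1 : 0 < d <= 1.
  by rewrite d0 (le_trans (dr 0))//; case/andP: (rho01 0).
have W0 r : 0 < r <= 1 -> 0 <= weight_sum s r.
  move=> /[dup] /andP[_ r1] /(weight_sum_cvg s2) h; apply: (cvgr_to_ge h).
  apply: nearW => n; apply: sumr_ge0 => i _.
  by rewrite mulr_ge0 ?(ltW (weight_gt0 _ _))// exprn_ge0// subr_ge0.
exists (Q + M * weight_sum s d) => t.
have /andP[r0 r1] := rho01 t.
have WW : weight_sum s (rho t) <= weight_sum s d.
  apply: (ler_cvg_to (weight_sum_cvg s2 (rho01 t)) (weight_sum_cvg s2 d1)).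
  apply: nearW => n; apply: ler_sum => i _; rewrite ler_wpM2l ?(ltW (weight_gt0 _ _))//.
  by apply: lerXn2r; rewrite ?nnegrE ?subr_ge0 ?lerD2l ?lerN2 ?dr//; case/andP: d1.
have key : rho t ^+ 2 * weight_sum s (rho t) - rho t <= weight_sum s d.
  apply: le_trans WW; rewrite lerBlDr ler_wpDr ?(ltW r0)//.
  by rewrite ler_piMl ?W0// exprn_ile1// ltW.
by rewrite /Phi; have := ler_wpM2l (ltW M0) key; lra.
Qed.
End Growth.

Section Sup.
Variables (R : realType) (s : R) (u : R -> R -> R[i]).

Lemma Hs_norm_ge0 (f : R -> R[i]) : (0 <= Hs_norm s f)%E.
Proof. exact: poweR_ge0. Qed.

(** The quotient of a bounded norm by a growing exponential tends to [0], and
    not to [1]. *)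
Lemma exp_growth_unbounded : exp_growth_Hs s u -> unbounded_Hs s u.
Proof.
move=> [B [_ [C [B0 _ C0 _ h]]]]; rewrite /unbounded_Hs.
set S := ereal_sup _.
have ub t : (Hs_norm s (u t) <= S)%E by apply: ereal_sup_ubound; exists t.
have := le_trans (Hs_norm_ge0 (u 0)) (ub 0); case: S ub => [K| |] // ub.
rewrite lee_fin => K0; exfalso.
have g : (K * ((C * expR (B * `|t|))^-1)) @[t --> +oo] --> (0 : R).
  have : (K / C) * expR (- (B * t)) @[t --> +oo] --> (0 : R).
    by rewrite -[0](mulr0 (K / C)); apply: cvgM; [exact: cvg_cst|exact: cvg_expRN].
  apply: cvg_trans; apply: near_eq_cvg; near=> t.
  have t0 : 0 <= t by near: t; exact: nbhs_pinfty_ge.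
  by rewrite (ger0_norm t0) expRN invfM mulrA.
have g' : ((K * ((C * expR (B * `|t|))^-1))%:E) @[t --> +oo%R] --> (0 : \bar R)%E.
  by apply: cvg_EFin => //; exact: nearW.
have z0 : ((Hs_norm s (u t)) * ((C * expR (B * `|t|))^-1)%:E)%E @[t --> +oo%R] --> 0%E.
  apply: (squeeze_cvge _ (cvg_cst _) g'); apply: nearW => t.
  have p0 : 0 <= (C * expR (B * `|t|))^-1 by rewrite invr_ge0 mulr_ge0 ?expR_ge0// ltW.
  by rewrite mule_ge0 ?Hs_norm_ge0 ?lee_fin// EFinM lee_wpmul2r ?lee_fin// ub.
have [] : (0%:E = 1%:E :> \bar R)%E by apply: (cvg_unique _ z0 h); exact: ereal_hausdorff.
by move/eqP; rewrite eq_sym oner_eq0.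
Unshelve. all: by end_near. Qed.

Lemma unbounded_not_bounded (B : R) : (forall t, Hs_norm s (u t) <= B%:E)%E ->
  ~ unbounded_Hs s u.
Proof.
move=> h; rewrite /unbounded_Hs => e.
have : (ereal_sup (range (fun t => Hs_norm s (u t))) <= B%:E)%E.
  by apply: ub_ereal_sup => _ [t _ <-].
by rewrite e.
Qed.
End Sup.

(** * The dichotomy and the equivalence *)

Section Dichotomy.
Variables (R : realType) (s0 : R) (u : R -> R -> R[i]) (u0 : R -> R[i]).
Hypotheses (hs0 : 2^-1 < s0) (hu : is_solution s0 u u0) (hL1 : calL1 u0).
Hypothesis hnc : ~ exists a : R[i], forall x : R, u0 x = a.

(** Here [N] is the squared modulus of [J] and [Q] the mass, so that the
    relation between energy and mass reads $N = Q^3$. *)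
Lemma rank_one_dichotomy : exists N Q : R,
  [/\ energy u0 = 2^-1 * mass u0 ^+ 3 <-> N = Q ^+ 3,
      N = Q ^+ 3 -> forall s, 2^-1 < s -> exp_growth_Hs s u &
      N <> Q ^+ 3 -> forall s, 2^-1 < s -> ~ unbounded_Hs s u].
Proof.
have [v [J [A [sys HA]]]] := is_solution_system hs0 hu.
have uu0 : eq_torus (u 0) u0 by case: hu.
have mu : cmeasurable (u 0) by have [[/L2_measurable]] := HA 0.
have [c [p [c0 p1 mu0 init]]] := calL1_fourier mu uu0 hL1 hnc.
have [rho [g [G [M [Q [N [[M0 Q0 N0] [[rho01 dr dg gE GE] [AQ JN f0 fS]]]]]]]]] :=
  rank_one_radius hs0 sys c0 init.
have normE s t : 2^-1 < s -> Hs_norm s (u t) =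
    (Num.sqrt (Q - M * rho t + M * rho t ^+ 2 * weight_sum s (rho t)))%:E.
  by move=> s2; have [ut _ _] := HA t; apply: rank_one_Hs_norm.
have u0sq : eq_torus (fun x => u 0 x ^+ 2) (fun x => u0 x ^+ 2).
  by apply: aeS uu0 => x h Dx; rewrite h.
have msq f : cmeasurable f -> @cmeasurable R (fun x => f x ^+ 2).
  by move=> mf; under eq_fun do rewrite expr2; exact: cmeasurableM.
have massE : mass u0 = Q%:C.
  have [_ _ h] := HA 0; rewrite -(AQ 0) h; symmetry; exact: eq_torus_inner.
have JE : Jfun u0 = J 0.
  have [_ h _] := HA 0; rewrite h; symmetry.
  by apply: eq_torus_inner => //; exact: msq.
have half : (2^-1 : R[i]) = (2^-1 : R)%:C by rewrite fmorphV rmorphMn/= rmorph1.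
exists N, Q; split.
- rewrite /energy massE JE normCE -rmorphXn/= JN half -!rmorphXn -!rmorphM/=.
  split=> [/complexI|->//]; apply: mulfI; by rewrite invr_eq0.
- move=> NQ s s2.
  have [k [al [be [ga [k0 al0 be0 rE]]]]] :=
    radius_inverse_cosh M0 Q0 rho01 dr dg gE GE NQ.
  have [Lp Lp0 hp] := rank_one_growth Q s2 M0 rho01.
  have [Lm Lm0 hm] := rank_one_growth Q s2 M0 (fun t => rho01 (- t)).
  have E t : Hs_norm s (u t) \is a fin_num by rewrite normE.
  exists (k * (s - 2^-1)), (Num.sqrt (be `^ (2 * s - 1) * (M * Lm))),
    (Num.sqrt (al `^ (2 * s - 1) * (M * Lp))); split.
  + by rewrite mulr_gt0// subr_gt0.
  + by rewrite sqrtr_gt0 mulr_gt0 ?powR_gt0 ?mulr_gt0.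
  + by rewrite sqrtr_gt0 mulr_gt0 ?powR_gt0 ?mulr_gt0.
  + apply/cvgNy_compNP; under eq_fun do rewrite /= normE// -EFinM normrN.
    apply: cvg_EFin; first exact: nearW.
    have rE' t : (rho (- t))^-1 = be * expR (k * t) + al * expR (- k * t) + ga.
      by rewrite rE mulrNN mulrN -mulNr [X in X + _]addrC.
    apply: hm => //; under eq_fun do rewrite rE'.
    exact: cosh_rate.
  + under eq_fun do rewrite /= normE// -EFinM.
    apply: cvg_EFin; first exact: nearW.
    apply: hp => //; under eq_fun do rewrite rE.
    exact: cosh_rate.
- move=> NQ s s2.
  have [d d0 dr'] := radius_bounded_below M0 Q0 N0 rho01 gE NQ.
  have [B hB] := rank_one_bounded Q s2 M0 rho01 d0 dr'.
  apply: (@unbounded_not_bounded _ _ _ (Num.sqrt B)) => t.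
  by rewrite normE// lee_fin ler_wsqrtr.
Qed.
End Dichotomy.
Local Close Scope complex_scope.
Local Close Scope classical_set_scope.

Theorem proposition1p1 (R : realType) (s0 : R) (u : R -> R -> R[i])
    (u0 : R -> R[i])
    (hs0 : 2^-1 < s0)
    (hu : is_solution s0 u u0)
    (hL1 : calL1 u0)
    (hnc : ~ exists a : R[i], forall x : R, u0 x = a) :
  ((exists2 s : R, 2^-1 < s & unbounded_Hs s u) <->
     (forall s : R, 2^-1 < s -> exp_growth_Hs s u)) /\
  ((forall s : R, 2^-1 < s -> exp_growth_Hs s u) <->
     energy u0 = 2^-1 * mass u0 ^+ 3).
Proof.
have [N [Q [-> growth bounded]]] := rank_one_dichotomy hs0 hu hL1 hnc.
have i_iii : (exists2 s : R, 2^-1 < s & unbounded_Hs s u) -> N = Q ^+ 3.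
  by move=> [s s2 us]; apply: contrapT => NQ; exact: bounded us.
have ii_i : (forall s : R, 2^-1 < s -> exp_growth_Hs s u) ->
    exists2 s : R, 2^-1 < s & unbounded_Hs s u.
  by move=> h; exists s0 => //; exact/exp_growth_unbounded/h.
split; split; [by move=> /i_iii /growth|by []|by move=> /ii_i /i_iii|exact: growth].
Qed.
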